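(* Let $M$ be a complex manifold, $f:M\to M$ a holomorphic automorphism, and $\tau\in\mathbb{C}$ with $\operatorname{Im}\tau>0$. Let $M_f$ be the suspension, i.e. the quotient of $M\times\mathbb{C}$ by the free $\mathbb{Z}^2$-action generated by $(1,0)\cdot(x,z)=(f(x),z+1)$ and $(0,1)\cdot(x,z)=(x,z+\tau)$, with the complex structure induced from $M\times\mathbb{C}$. Suppose $M$ admits a balanced metric whose volume form is invariant under $f$. Then $M_f$ admits a balanced metric.
   Context: A Hermitian metric on a complex manifold of complex dimension $n$, identified with its positive $(1,1)$-form $\omega$, is called balanced if $d(\omega^{n-1})=0$. Its volume form is $\omega^n$ up to a constant factor, and invariance under $f$ means $f^*(\omega^n)=\omega^n$. *)

(* Defs.v *)
From HB Require Import structures.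
From mathcomp Require Import all_boot all_order all_algebra all_fingroup.
From mathcomp Require Import generic_quotient complex sesquilinear.
From mathcomp Require Import ring.
From mathcomp Require Import all_classical all_reals topology normedtype landau derive.
Set Implicit Arguments.
Unset Strict Implicit.
Unset Printing Implicit Defensive.
Import Order.TTheory GRing.Theory Num.Theory numFieldNormedType.Exports.
Local Open Scope classical_set_scope.
Local Open Scope complex_scope.
Local Open Scope ring_scope.

(* The topology of [C] is that of the norm; row vectors inherit theirs. *)
HB.instance Definition _ (R : realType) := NormedModule.copy R[i] R[i]^o.

Record chart (R : realType) (n : nat) (M : topologicalType) := Chart {
  cdom : set M;
  cimg : set 'rV[R[i]]_n;
  cmap : M -> 'rV[R[i]]_n;   (* relevant on cdom only *)
  cinv : 'rV[R[i]]_n -> M;   (* relevant on cimg only *)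
  cdom_open : open cdom;
  cimg_open : open cimg;
  cmapP : forall p, cdom p -> cimg (cmap p) /\ cinv (cmap p) = p;
  cinvP : forall x, cimg x -> cdom (cinv x) /\ cmap (cinv x) = x;
  cmap_cont : forall p, cdom p -> {for p, continuous cmap};
  cinv_cont : forall x, cimg x -> {for x, continuous cinv} }.

(* Differentiability between normed modules over [R[i]] is complex
   differentiability, so that differentiability at every point of an open set
   is holomorphy. *)
Record complexManifold (R : realType) (n : nat) := ComplexManifold {
  mspace :> topologicalType;
  atlas : set (chart R n mspace);
  atlas_cover : forall p, exists2 c, atlas c & cdom c p;
  atlas_holo : forall c d x, atlas c -> atlas d -> cimg c x ->
    cdom d (cinv c x) -> differentiable (cmap d \o cinv c) x;
  mspace_hausdorff : hausdorff_space mspace;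
  mspace_countable : @second_countable mspace }.

Definition holomorphic (R : realType) (m n : nat)
    (M : complexManifold R m) (N : complexManifold R n) (f : M -> N) :=
  continuous f /\
  forall (c : chart R m M) (d : chart R n N) x,
    atlas c -> atlas d -> cimg c x -> cdom d (f (cinv c x)) ->
    differentiable (cmap d \o f \o cinv c) x.

Record automorphism (R : realType) (n : nat) (M : complexManifold R n) :=
  Automorphism {
  aut :> M -> M;
  aut_inv : M -> M;
  autK : cancel aut aut_inv;
  aut_invK : cancel aut_inv aut;
  aut_holo : holomorphic aut;
  aut_inv_holo : holomorphic aut_inv }.

Section Calculus.
Variables (R : realType) (n : nat).
Implicit Types (f : 'rV[R[i]]_n -> R[i]) (V : set 'rV[R[i]]_n).
Implicit Types (v w x : 'rV[R[i]]_n).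

Definition rline f v x : R -> R[i] := fun t => f (x + t%:C *: v).

Definition rderivable f v x :=
  derivable (fun t => complex.Re (rline f v x t)) 0 1 /\
  derivable (fun t => complex.Im (rline f v x t)) 0 1.

(* The derivative of [f] at [x] along [v], for a real parameter. *)
Definition rderiv f v x : R[i] :=
  derive1 (fun t => complex.Re (rline f v x t)) 0 +i*
  derive1 (fun t => complex.Im (rline f v x t)) 0.

(* [class_C k V f]: on the open set [V], [f] is of class C^k as a function of
   2n real variables. *)
Fixpoint class_C (k : nat) V f : Prop :=
  (forall x, V x -> {for x, continuous f}) /\
  if k is k'.+1 then forall v,
    (forall x, V x -> rderivable f v x) /\ class_C k' V (rderiv f v)
  else True.

Definition smooth V f := forall k, class_C k V f.

(* Complex-valued differential [k]-forms: [a x] is meant to be alternating and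
   real multilinear. *)
Definition form (k : nat) := 'rV[R[i]]_n -> ('I_k -> 'rV[R[i]]_n) -> R[i].

Definition wedge k l (a : form k) (b : form l) : form (k + l) := fun x u =>
  (k`! * l`!)%:R^-1 * \sum_(s : 'S_(k + l)) (-1) ^+ s *
    a x (fun i => u (s (lshift l i))) * b x (fun j => u (s (rshift k j))).

Fixpoint wedge_pow (a : form 2) (p : nat) : form (p * 2) :=
  if p is p'.+1 then wedge a (@wedge_pow a p') else fun _ _ => 1.

Definition ext_d k (a : form k) : form k.+1 := fun x u =>
  \sum_(i < k.+1) (-1) ^+ i *
    rderiv (fun y => a y (fun j => u (lift i j))) (u i) x.

Definition closed_on V k (a : form k) := forall x u, V x -> ext_d a x u = 0.

Definition herm (H : 'M[R[i]]_n) v w : R[i] :=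
  (v *m H *m (map_mx Num.conj w)^T) 0 0.

(* (i/2) \sum_(j, k) H_jk dz_j /\ d(conj z_k) *)
Definition fundamental_form (H : 'rV[R[i]]_n -> 'M[R[i]]_n) : form 2 :=
  fun x u => 'i%C / 2%:R *
    (herm (H x) (u ord0) (u ord_max) - herm (H x) (u ord_max) (u ord0)).

End Calculus.

Definition pullback (R : realType) (m n k : nat)
    (F : 'rV[R[i]]_m -> 'rV[R[i]]_n) (a : form R n k) : form R m k :=
  fun x u => a (F x) (fun i => 'd F x (u i)).

Arguments wedge_pow {R n} a p.

(* A Hermitian metric, through its Gram matrices in the charts of the atlas;
   the matrices attached to other charts are irrelevant. *)
Record hermitianMetric (R : realType) (n : nat) (M : complexManifold R n) :=
  HermitianMetric {
  gram : chart R n M -> 'rV[R[i]]_n -> 'M[R[i]]_n;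
  gram_smooth : forall c, atlas c ->
    forall i j, smooth (cimg c) (fun x => gram c x i j);
  gram_hermitian : forall c x, atlas c -> cimg c x -> gram c x \is hermsymmx;
  gram_posdef : forall c x v, atlas c -> cimg c x -> v != 0 ->
    0 < herm (gram c x) v v;
  gram_change : forall c d x, atlas c -> atlas d -> cimg c x ->
    cdom d (cinv c x) -> forall v w,
    herm (gram c x) v w =
    herm (gram d (cmap d (cinv c x)))
      ('d (cmap d \o cinv c) x v) ('d (cmap d \o cinv c) x w) }.

Section Metrics.
Variables (R : realType) (n : nat) (M : complexManifold R n).
Implicit Types (h : hermitianMetric M) (c : chart R n M).

Definition metric_form h c : form R n 2 := fundamental_form (gram h c).

(* For [n = 0] the condition is [d 1 = 0], which holds trivially. *)
Definition balanced h := forall c, atlas c ->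
  closed_on (cimg c) (wedge_pow (metric_form h c) n.-1).

(* The pullback of [omega ^ n] along [f] is [omega ^ n], read in charts. *)
Definition volume_invariant h (f : M -> M) := forall c d x u,
  atlas c -> atlas d -> cimg c x -> cdom d (f (cinv c x)) ->
  pullback (cmap d \o f \o cinv c) (wedge_pow (metric_form h d) n) x u =
  wedge_pow (metric_form h c) n x u.

End Metrics.

Lemma near_differentiable (K : numFieldType) (V W : normedModType K)
    (f g : V -> W) (x : V) :
  (\near x, f x = g x) -> differentiable f x -> differentiable g x.
Proof.
move=> fg df; have fgx : f x = g x by exact: nbhs_singleton fg.
have [dfc dfo] := (diff_locallyP _ _).1 df.
have dgo : g \o shift x = cst (g x) + 'd f x +o_ 0 id.
  apply/eqaddoP => e e0; move/eqaddoP: dfo => /(_ e e0) H.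
  move: fg; rewrite (near_shift 0) subr0 => fg'.
  near=> y.
  have <- : (f \o shift x - (cst (f x) + 'd f x)) y =
            (g \o shift x - (cst (g x) + 'd f x)) y.
    rewrite -fgx /= !fctE /=; congr (_ - _); near: y; exact: fg'.
  by near: y.
have e := diff_unique dfc dgo.
by apply/diff_locallyP; rewrite e.
Unshelve. all: by end_near. Qed.

Section Holo.
Variable R : realType.

Lemma holomorphic_id n (M : complexManifold R n) : holomorphic (idfun : M -> M).
Proof. by split=> [x|c d x cM dM cx dx]; [exact: cvg_id|exact: atlas_holo]. Qed.

Lemma holomorphic_comp m n p (M : complexManifold R m) (N : complexManifold R n)
    (P : complexManifold R p) (f : M -> N) (g : N -> P) :
  holomorphic f -> holomorphic g -> holomorphic (g \o f).
Proof.
move=> [fc fh] [gc gh]; split=> [x|c d x cM dP cx dx].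
  exact: (continuous_comp (fc x) (gc _)).
have [e eN ex] := atlas_cover (f (cinv c x)).
have ei := (cmapP ex).1; have ek := (cmapP ex).2.
have h1 := fh c e x cM eN cx ex.
have h2 : differentiable (cmap d \o g \o cinv e) ((cmap e \o f \o cinv c) x).
  by apply: gh => //=; rewrite ek.
apply: (near_differentiable _ (differentiable_comp h1 h2)).
have cf : {for x, continuous (f \o cinv c)}.
  exact: (continuous_comp (cinv_cont cx) (fc _)).
have : nbhs x ((f \o cinv c) @^-1` cdom e).
  by apply: cf; apply: open_nbhs_nbhs; split => //; exact: cdom_open.
by apply: filterS => y /= ey; rewrite (cmapP ey).2.
Qed.

Lemma holomorphic_iter n (M : complexManifold R n) (f : M -> M) k :
  holomorphic f -> holomorphic (iter k f).
Proof.
move=> hf; elim: k => [|k IH]; first exact: holomorphic_id.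
exact: holomorphic_comp IH hf.
Qed.
End Holo.

Section Blocks.
Variables (R : realType) (n : nat).

Lemma lsubmx_continuous : continuous (lsubmx : 'rV[R[i]]_(n + 1) -> 'rV_n).
Proof.
move=> x A [P xP sPA]; exists (fun i j => if fintype.split j is inl k then P i k else setT).
  move=> i j; case: fintype.splitP => k jk; last exact: filterT.
  have -> : x i j = lsubmx x i k by rewrite mxE; congr (x _ _); exact: val_inj.
  exact: xP.
move=> y yP; apply: sPA => i j; rewrite !mxE.
by have := yP i (lshift 1 j); rewrite (unsplitK (inl j : 'I_n + 'I_1)).
Qed.

Lemma last_continuous :
  continuous (fun x : 'rV[R[i]]_(n + 1) => rsubmx x 0 0).
Proof.
move=> x; rewrite /continuous_at mxE.
rewrite (_ : (fun y => _) = (fun y : 'rV[R[i]]_(n + 1) => y 0 (rshift n 0))); last first.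
  by apply: funext => y; rewrite mxE.
exact: coord_continuous.
Qed.

Lemma lsubmx_differentiable (x : 'rV[R[i]]_(n + 1)) :
  differentiable (lsubmx : 'rV[R[i]]_(n + 1) -> 'rV[R[i]]_n) x.
Proof. exact/linear_differentiable/lsubmx_continuous. Qed.

Lemma last_differentiable (x : 'rV[R[i]]_(n + 1)) :
  differentiable (fun x : 'rV[R[i]]_(n + 1) => rsubmx x 0 0) x.
Proof.
rewrite (_ : (fun y => _) = (fun y : 'rV[R[i]]_(n + 1) => y 0 (rshift n 0))); last first.
  by apply: funext => y; rewrite mxE.
exact: differentiable_coord.
Qed.

Lemma row_mx0_continuous :
  continuous ((row_mx^~ 0) : 'rV[R[i]]_n -> 'rV[R[i]]_(n + 1)).
Proof.
move=> x A [P xP sPA]; exists (fun i j => P i (lshift 1 j)).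
  by move=> i j; have := xP i (lshift 1 j); rewrite row_mxEl.
move=> y yP; apply: sPA => i j; rewrite -(splitK j); case: (fintype.split j) => k /=.
  by rewrite row_mxEl; exact: yP.
rewrite row_mxEr; have := xP i (rshift n k); rewrite row_mxEr.
exact: nbhs_singleton.
Qed.

Lemma row_0mx_continuous :
  continuous (fun z : R[i] => row_mx 0 z%:M : 'rV[R[i]]_(n + 1)).
Proof.
move=> x A [P xP sPA].
have := xP 0 (rshift n 0); rewrite row_mxEr mxE eqxx mulr1n.
apply: filterS => y yP; apply: sPA => i j.
rewrite -(splitK j); case: (fintype.split j) => k /=.
  have := xP i (lshift 1 k); rewrite !row_mxEl; exact: nbhs_singleton.
by rewrite row_mxEr !ord1 mxE eqxx mulr1n.
Qed.

Fact row_mx0_linear : linear ((row_mx^~ 0) : 'rV[R[i]]_n -> 'rV[R[i]]_(n + 1)).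
Proof. by move=> a u v; rewrite scale_row_mx add_row_mx scaler0 addr0. Qed.

Fact row_0mx_linear : linear (fun z : R[i] => row_mx 0 z%:M : 'rV[R[i]]_(n + 1)).
Proof.
move=> a u v.
by rewrite scale_row_mx add_row_mx scaler0 addr0 scale_scalar_mx raddfD.
Qed.

Lemma row_mx_split (x : 'rV[R[i]]_n) (z : R[i]) :
  row_mx x z%:M = row_mx x 0 + row_mx 0 z%:M :> 'rV_(n + 1).
Proof. by rewrite add_row_mx addr0 add0r. Qed.

Lemma row_mx_differentiable (V : normedModType R[i]) (f : V -> 'rV[R[i]]_n)
    (g : V -> R[i]) x : differentiable f x -> differentiable g x ->
  differentiable (fun y => row_mx (f y) (g y)%:M : 'rV[R[i]]_(n + 1)) x.
Proof.
move=> df dg.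
pose L1 := GRing.isLinear.Build _ _ _ _ _ row_mx0_linear.
pose l1 : {linear 'rV[R[i]]_n -> 'rV[R[i]]_(n + 1)} := HB.pack (row_mx^~ 0) L1.
pose L2 := GRing.isLinear.Build _ _ _ _ _ row_0mx_linear.
pose l2 : {linear R[i] -> 'rV[R[i]]_(n + 1)} := HB.pack (fun z : R[i] => row_mx 0 z%:M : 'rV[R[i]]_(n + 1)) L2.
rewrite (_ : (fun y => _) = (l1 \o f) + (l2 \o g)).
  apply: differentiableD.
    apply: differentiable_comp => //; apply: linear_differentiable; exact: row_mx0_continuous.
  apply: differentiable_comp => //; apply: linear_differentiable; exact: row_0mx_continuous.
by apply: funext => y; rewrite row_mx_split.
Qed.

Lemma row_mx_continuous (T : topologicalType) (f : T -> 'rV[R[i]]_n)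
    (g : T -> R[i]) x : {for x, continuous f} -> {for x, continuous g} ->
  {for x, continuous (fun y => row_mx (f y) (g y)%:M : 'rV[R[i]]_(n + 1))}.
Proof.
move=> cf cg.
rewrite (_ : (fun y => _) = (fun y => row_mx (f y) 0 + row_mx 0 (g y)%:M)); last first.
  by apply: funext => y; rewrite row_mx_split.
apply: cvgD; first exact: (@continuous_comp _ _ _ f (row_mx^~ 0) x cf (@row_mx0_continuous _)).
exact: (@continuous_comp _ _ _ g (fun z => row_mx 0 z%:M) x cg (@row_0mx_continuous _)).
Qed.
End Blocks.

Section Lattice.
Variables (R : realType) (tau : R[i]).

Definition period (a : int * int) : R[i] := a.1%:~R + a.2%:~R * tau.

Lemma lattice_gap : 0 < complex.Im tau -> exists2 d : R[i], 0 < d &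
  forall a, a != 0 -> d <= `|period a|.
Proof.
move=> t0; pose d := Num.min 1 (complex.Im tau).
have d0 : 0 < d by rewrite lt_min ltr01.
exists d%:C; first by rewrite ltcR.
have intC (m : int) : (m%:~R : R[i]) = (m%:~R)%:C by rewrite rmorph_int.
have Rabs (m : int) : m != 0 -> 1 <= `|m%:~R| :> R.
  move=> m0; rewrite -intr_norm -[1]/(1%:~R) ler_int.
  by rewrite -gtz0_ge1 normr_gt0.
case=> m k mk0; rewrite /period /=; case: (eqVneq k 0) => [k0|k0].
  rewrite k0 mul0r addr0 intC normc_def /= expr0n mulr0n addr0 sqrtr_sqr lecR.
  rewrite ge_min Rabs //; move: mk0; apply: contraNneq => ->.
  by rewrite k0.
have : `|k%:~R * complex.Im tau| <= complex.Re `|m%:~R + k%:~R * tau|.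
  rewrite !intC normc_def /=.
  case: (tau) => a b /=; rewrite !mul0r addr0 add0r -sqrtr_sqr ler_wsqrtr //.
  by rewrite lerDr sqr_ge0.
rewrite normrM (gtr0_norm t0) => H.
have E : `|m%:~R + k%:~R * tau| = (complex.Re `|m%:~R + k%:~R * tau|)%:C.
  by rewrite normc_def.
rewrite E lecR; apply: le_trans H.
apply: le_trans (_ : complex.Im tau <= _); first by rewrite ge_min lexx orbT.
by rewrite ler_peMl ?(ltW t0) ?Rabs.
Qed.

Lemma complex_second_countable : @second_countable R[i].
Proof.
pose D (q : rat * rat * rat) : set R[i] :=
  [set z | `|z - (ratr q.1.1 +i* ratr q.1.2)| < (ratr q.2)%:C].
have Dball q : D q = ball_ Num.norm (ratr q.1.1 +i* ratr q.1.2) (ratr q.2)%:C.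
  by apply/seteqP; split => z; rewrite /D /= distrC.
exists (range D); first exact: sub_countable (card_image_le _ _) (countableP _).
split.
  move=> _ [q _ <-].
  case: (ltP 0 (ratr q.2 : R)) => q0.
    by rewrite Dball ball_normE; apply: ball_open; rewrite ltcR.
  rewrite (_ : D q = set0); first exact: open0.
  apply/seteqP; split => // z; rewrite /D /= => H.
  have := le_lt_trans (normr_ge0 _) H; rewrite ltcR => /lt_le_trans/(_ q0).
  by rewrite ltxx.
move=> x V /nbhs_ballP[e /= e0 eV].
have eR : e = (complex.Re e)%:C.
  by apply/eqP; rewrite eq_complex /= eqxx /=; have := ltW e0; rewrite lecE => /andP[].
have r0 : 0 < complex.Re e by rewrite -ltcR -eR.
set r := complex.Re e in eR r0.
have [q /[!in_itv]/= /andP[q1 q2]] : exists q, ratr q \in `]0, (r / 2)[.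
  by apply: rat_in_itvoo; rewrite divr_gt0.
have near (y : R) : exists p : rat, `|y - ratr p| < ratr q / 2.
  have [|p] := @rat_in_itvoo _ (y - ratr q / 2) (y + ratr q / 2).
    by rewrite ltrBlDr -addrA ltrDl -splitr.
  by rewrite in_itv /= => /andP[p1 p2]; exists p; rewrite distrC ltr_distl p1 p2.
have [p1 hp1] := near (complex.Re x); have [p2 hp2] := near (complex.Im x).
have hx : D (p1, p2, q) x.
  rewrite /D /= normc_def ltcR.
  set a := complex.Re _; set b := complex.Im _.
  have ha : a = complex.Re x - ratr p1 by rewrite /a; case: (x).
  have hb : b = complex.Im x - ratr p2 by rewrite /b; case: (x).
  apply: (@le_lt_trans _ _ (`|a| + `|b|)).
    rewrite -[leRHS]ger0_norm ?addr_ge0 // -[leRHS]sqrtr_sqr ler_wsqrtr // sqrrD.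
    rewrite !real_normK ?num_real //.
    by rewrite -addrA lerD2l lerDr mulrn_wge0 // mulr_ge0.
  by rewrite [ltRHS]splitr ltrD // ?ha ?hb.
exists (D (p1, p2, q)); first by split => //; exists (p1, p2, q).
move=> z hz; apply: eV; rewrite -ball_normE /=.
apply: (le_lt_trans (ler_distD (ratr p1 +i* ratr p2) _ _)).
apply: (@lt_trans _ _ ((ratr q)%:C + (ratr q)%:C)).
  by apply: ltrD; [exact: hx|rewrite distrC; exact: hz].
by rewrite eR -rmorphD ltcR -mulr2n -mulr_natr -ltr_pdivlMr.
Qed.
End Lattice.

Lemma openX (S T : topologicalType) (A : set S) (B : set T) :
  open A -> open B -> open (A `*` B).
Proof.
move=> oA oB; rewrite openE => -[a b] [/= Aa Bb]; exists (A, B) => //.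
by split; apply: open_nbhs_nbhs.
Qed.

Section Suspension.
Variables (R : realType) (n : nat) (M : complexManifold R n).
Variables (f : automorphism M) (tau : R[i]).
Local Notation N := (M * R[i])%type.

Definition aut_iter (m : int) : M -> M :=
  match m with Posz k => iter k f | Negz k => iter k.+1 (aut_inv f) end.

(* The action of Z^2 with (1, 0).(x, z) = (f x, z + 1) and
   (0, 1).(x, z) = (x, z + tau). *)
Definition susp_act (a : int * int) (p : N) : N :=
  (aut_iter a.1 p.1, p.2 + period tau a).

Definition susp_rel (p q : N) := `[< exists a, susp_act a p = q >].

Lemma aut_iterS m x : aut_iter (m + 1) x = f (aut_iter m x).
Proof.
case: m => [k|[|k]]; first by rewrite addrC -intS.
  by rewrite /= aut_invK.
have -> : Negz k.+1 + 1 = Negz k by rewrite !NegzE (intS k.+1) opprD addrAC addNr add0r.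
by rewrite /= aut_invK.
Qed.

Lemma aut_iterB m x : aut_iter (m - 1) x = aut_inv f (aut_iter m x).
Proof. by rewrite -{2}(subrK 1 m) aut_iterS autK. Qed.

Lemma aut_iterD m k x : aut_iter (m + k) x = aut_iter m (aut_iter k x).
Proof.
elim/int_ind: m => [|m IH|m IH]; first by rewrite add0r.
  by rewrite intS -addrA ![1 + _]addrC !aut_iterS IH.
by rewrite intS opprD -addrA ![- 1 + _]addrC !aut_iterB IH.
Qed.

Lemma aut_iter_holo m : holomorphic (aut_iter m).
Proof.
by case: m => k; apply: holomorphic_iter; [exact: aut_holo|exact: aut_inv_holo].
Qed.

Lemma period0 : period tau 0 = 0.
Proof. by rewrite /period /= mul0r addr0. Qed.

Lemma periodD a b : period tau (a + b) = period tau a + period tau b.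
Proof. by rewrite /period /= !rmorphD /= mulrDl addrACA. Qed.

Lemma susp_act0 p : susp_act 0 p = p.
Proof. by case: p => x z; rewrite /susp_act period0 addr0. Qed.

Lemma susp_actD a b p : susp_act (a + b) p = susp_act a (susp_act b p).
Proof. by rewrite /susp_act /= aut_iterD periodD addrA addrAC. Qed.

Lemma susp_act_continuous a : continuous (susp_act a).
Proof.
move=> p.
have h1 : {for p, continuous (fun p : N => aut_iter a.1 p.1)}.
  apply: (@continuous_comp _ _ _ fst (aut_iter a.1)); first exact: cvg_fst.
  exact: (aut_iter_holo a.1).1.
have h2 : {for p, continuous (fun p : N => p.2 + period tau a)}.
  by apply: cvgD; [exact: cvg_snd|exact: cvg_cst].
exact: (cvg_pair h1 h2).
Qed.

Lemma susp_rel_refl : reflexive susp_rel.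
Proof. by move=> p; apply/asboolP; exists 0; rewrite susp_act0. Qed.

Lemma susp_rel_sym : symmetric susp_rel.
Proof.
suff H p q : susp_rel p q -> susp_rel q p by move=> p q; apply/idP/idP; exact: H.
move=> /asboolP[a <-]; apply/asboolP; exists (- a).
by rewrite -susp_actD addNr susp_act0.
Qed.

Lemma susp_rel_trans : transitive susp_rel.
Proof.
move=> q p r /asboolP[a <-] /asboolP[b <-]; apply/asboolP; exists (b + a).
by rewrite susp_actD.
Qed.

Definition susp_equiv :=
  EquivRel susp_rel susp_rel_refl susp_rel_sym susp_rel_trans.

Definition susp_space : topologicalType :=
  quotient_topology {eq_quot susp_equiv}%qT.

Definition susp_proj (p : N) : susp_space :=
  \pi_(quotient_topology {eq_quot susp_equiv}%qT)%qT p.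

Definition susp_repr (q : susp_space) : N :=
  @repr _ (quotient_topology {eq_quot susp_equiv}%qT) q.

Lemma susp_reprK q : susp_proj (susp_repr q) = q.
Proof. exact: reprK. Qed.

Lemma susp_projP p q : susp_proj p = susp_proj q <-> exists a, susp_act a p = q.
Proof.
split=> [|H]; first by move/eqquotP => /= /asboolP.
by apply/eqquotP => /=; apply/asboolP.
Qed.

Lemma susp_proj_act a p : susp_proj (susp_act a p) = susp_proj p.
Proof. by apply/esym/susp_projP; exists a. Qed.

Lemma susp_proj_continuous : continuous susp_proj.
Proof. exact: pi_continuous. Qed.

Lemma susp_proj_open (A : set N) : open A -> open (susp_proj @` A).
Proof.
move=> oA; rewrite /open /= /quotient_open.
rewrite (_ : _ @^-1` _ = \bigcup_a (susp_act a @^-1` A)).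
  apply: bigcup_open => a _; apply: open_comp => // p _.
  exact: susp_act_continuous.
apply/seteqP; split=> [p [q Aq /esym/susp_projP[a aq]]|p [a _ Aa]].
  by exists a => //=; rewrite aq.
by exists (susp_act a p) => //; exact: susp_proj_act.
Qed.

(* [B] is disjoint from its translates by the nonzero periods, so that
   [susp_proj] is injective on [U `*` B] for every [U]. *)
Definition evenly_covered (B : set R[i]) :=
  open B /\ forall z a, B z -> B (z + period tau a) -> a = 0.

Section Chart.
Variables (c : chart R n M) (B : set R[i]) (hB : evenly_covered B).

Definition susp_lift (q : susp_space) : N :=
  xget (susp_repr q) [set p | (cdom c `*` B) p /\ susp_proj p = q].

Definition susp_cdom : set susp_space := susp_proj @` (cdom c `*` B).

Definition susp_cimg : set 'rV[R[i]]_(n + 1) :=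
  [set x | cimg c (lsubmx x) /\ B (rsubmx x 0 0)].

Definition susp_cmap (q : susp_space) : 'rV[R[i]]_(n + 1) :=
  row_mx (cmap c (susp_lift q).1) (susp_lift q).2%:M.

Definition susp_cinv (x : 'rV[R[i]]_(n + 1)) : susp_space :=
  susp_proj (cinv c (lsubmx x), rsubmx x 0 0).

Lemma susp_liftK p : (cdom c `*` B) p -> susp_lift (susp_proj p) = p.
Proof.
move=> cp; apply: xget_unique => // q [cq /susp_projP[a aq]].
have a0 : a = 0.
  apply: (hB.2 q.2) => //; first exact: cq.2.
  by rewrite -[_ + _]/(susp_act a q).2 aq; exact: cp.2.
by rewrite -aq a0 susp_act0.
Qed.

Lemma susp_cdom_open : open susp_cdom.
Proof.
apply: susp_proj_open; apply: openX; [exact: cdom_open|exact: hB.1].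
Qed.

Lemma susp_cimg_open : open susp_cimg.
Proof.
apply: openI.
  apply: (@open_comp _ _ (lsubmx : 'rV[R[i]]_(n + 1) -> 'rV[R[i]]_n)).
    by move=> x _; exact: lsubmx_continuous.
  exact: cimg_open.
apply: (@open_comp _ _ (fun x : 'rV[R[i]]_(n + 1) => rsubmx x 0 0)).
  by move=> x _; exact: last_continuous.
exact: hB.1.
Qed.

Lemma susp_cmapP q : susp_cdom q ->
  susp_cimg (susp_cmap q) /\ susp_cinv (susp_cmap q) = q.
Proof.
move=> [p cp <-]; rewrite /susp_cimg /susp_cinv /susp_cmap /= susp_liftK //.
rewrite row_mxKl row_mxKr mxE eqxx mulr1n.
have [h1 ->] := cmapP cp.1; split; last by case: (p).
by split => //; exact: cp.2.
Qed.

Lemma susp_cinvP x : susp_cimg x ->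
  susp_cdom (susp_cinv x) /\ susp_cmap (susp_cinv x) = x.
Proof.
move=> [cx Bx]; have [h1 h2] := cinvP cx.
split; first by exists (cinv c (lsubmx x), rsubmx x 0 0).
rewrite /susp_cmap susp_liftK //= h2.
by rewrite -[in RHS](hsubmxK x) -mx11_scalar.
Qed.

Lemma susp_cmap_cont q : susp_cdom q -> {for q, continuous susp_cmap}.
Proof.
move=> [p cp <-] A; rewrite /= {1}/susp_cmap susp_liftK // => nA.
pose g (p : N) : 'rV[R[i]]_(n + 1) := row_mx (cmap c p.1) p.2%:M.
have gc : {for p, continuous g}.
  apply: row_mx_continuous; last exact: cvg_snd.
  apply: (@continuous_comp _ _ _ fst (cmap c)); first exact: cvg_fst.
  exact: cmap_cont cp.1.
have np : nbhs p (g @^-1` A `&` (cdom c `*` B)).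
  apply: filterI; first exact: gc.
  apply: open_nbhs_nbhs; split => //.
  by apply: openX; [exact: cdom_open|exact: hB.1].
have [W [oW Wp] sW] : exists2 W, open_nbhs p W &
    W `<=` g @^-1` A `&` (cdom c `*` B) by move: np; rewrite nbhsE.
have : nbhs (susp_proj p) (susp_proj @` W).
  by apply: open_nbhs_nbhs; split; [exact: susp_proj_open|exists p].
apply: filterS => _ [r Wr <-]; have [gr cr] := sW _ Wr.
by rewrite /= /susp_cmap susp_liftK.
Qed.

Lemma susp_cinv_pre_cont x : susp_cimg x ->
  {for x, continuous (fun x : 'rV[R[i]]_(n + 1) =>
    (cinv c (lsubmx x), rsubmx x 0 0) : N)}.
Proof.
move=> [cx Bx].
have h : {for x, continuous (fun x : 'rV[R[i]]_(n + 1) => cinv c (lsubmx x))}.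
  apply: (@continuous_comp _ _ _ lsubmx (cinv c)).
    exact: lsubmx_continuous.
  exact: cinv_cont.
exact: (cvg_pair h (@last_continuous _ _ x)).
Qed.

Lemma susp_cinv_cont x : susp_cimg x -> {for x, continuous susp_cinv}.
Proof.
move=> cx; apply: (@continuous_comp _ _ _ _ susp_proj).
  exact: susp_cinv_pre_cont.
exact: susp_proj_continuous.
Qed.

Definition susp_chart : chart R (n + 1) susp_space :=
  Chart susp_cdom_open susp_cimg_open susp_cmapP susp_cinvP
        susp_cmap_cont susp_cinv_cont.

End Chart.

Definition susp_atlas : set (chart R (n + 1) susp_space) :=
  [set d | exists c B (hB : evenly_covered B), atlas c /\ d = susp_chart c hB].

Lemma susp_atlas_holo d e x : susp_atlas d -> susp_atlas e -> cimg d x ->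
  cdom e (cinv d x) -> differentiable (cmap e \o cinv d) x.
Proof.
move=> [c1 [B1 [h1 [M1 ->]]]] [c2 [B2 [h2 [M2 ->]]]] /= cx.
move=> [r cr /esym/susp_projP[a ar]].
pose l (y : 'rV[R[i]]_(n + 1)) : N := (cinv c1 (lsubmx y), rsubmx y 0 0).
have lc : {for x, continuous (susp_act a \o l)}.
  apply: (@continuous_comp _ _ _ l); first exact: (susp_cinv_pre_cont cx).
  exact: susp_act_continuous.
have nx : nbhs x ((susp_act a \o l) @^-1` (cdom c2 `*` B2)).
  apply: lc; apply: open_nbhs_nbhs; split; last first.
    change ((cdom c2 `*` B2)
      (susp_act a (cinv c1 (lsubmx x), rsubmx x 0 0))).
    by rewrite ar.
  by apply: openX; [exact: cdom_open|exact: h2.1].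
pose F (y : 'rV[R[i]]_(n + 1)) : 'rV[R[i]]_(n + 1) :=
  row_mx ((cmap c2 \o aut_iter a.1 \o cinv c1) (lsubmx y))
    (rsubmx y 0 0 + period tau a)%:M.
apply: (@near_differentiable _ _ _ F).
  apply: filterS nx => y cy.
  rewrite /= /susp_cinv -(susp_proj_act a) /susp_cmap susp_liftK //.
apply: row_mx_differentiable.
  apply: (@differentiable_comp _ _ _ _ lsubmx).
    exact: lsubmx_differentiable.
  apply: (aut_iter_holo a.1).2 => //; first exact: cx.1.
  by move: cr.1; rewrite -ar.
by apply: differentiableD; [exact: last_differentiable|exact: differentiable_cst].
Qed.

Hypothesis tau0 : 0 < complex.Im tau.

Lemma susp_atlas_cover q : exists2 d, susp_atlas d & cdom d q.
Proof.
have [e e0 he] := lattice_gap tau0.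
set p := susp_repr q.
have hB : evenly_covered (ball p.2 (e / 2%:R)).
  split; first by apply: ball_open; rewrite divr_gt0.
  move=> z a; rewrite -ball_normE /= => za zb; apply/eqP; apply: contraT => a0.
  have := he _ a0; rewrite -(addrK z (period tau a)) [_ + z]addrC.
  move=> /le_lt_trans H; have := H _ (le_lt_trans (ler_distD p.2 _ _) _).
  move=> /(_ e); rewrite ltxx => ->//.
  by rewrite [ltRHS]splitr ltrD // distrC.
have [c cM cp] := atlas_cover p.1.
exists (susp_chart c hB); first by exists c, (ball p.2 (e / 2%:R)), hB.
exists p; last exact: susp_reprK.
by split => //=; apply: ballxx; rewrite divr_gt0.
Qed.

Lemma susp_separate (p q : N) (A B : set M) (r : R[i]) : 0 < r ->
  open A -> open B -> A p.1 -> B q.1 ->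
  (forall b x, `|q.2 - p.2 - period tau b| < r -> A x -> B (aut_iter b.1 x) ->
    False) ->
  exists2 UV : set susp_space * set susp_space,
    susp_proj p \in UV.1 /\ susp_proj q \in UV.2 &
    [/\ open UV.1, open UV.2 & UV.1 `&` UV.2 == set0].
Proof.
move=> r0 oA oB Ap Bq H.
exists (susp_proj @` (A `*` ball p.2 (r / 2%:R)),
        susp_proj @` (B `*` ball q.2 (r / 2%:R))) => /=.
  split; apply/mem_set.
    by exists p => //; split => //=; apply: ballxx; rewrite divr_gt0.
  by exists q => //; split => //=; apply: ballxx; rewrite divr_gt0.
split.
- by apply: susp_proj_open; apply: openX => //; apply: ball_open; rewrite divr_gt0.
- by apply: susp_proj_open; apply: openX => //; apply: ball_open; rewrite divr_gt0.
apply/eqP/seteqP; split => // _ [[u [Au bu] <-] [v [Bv bv]]].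
move=> /esym/susp_projP[b uv]; apply: (H b u.1) => //; last first.
  by move: Bv; rewrite -uv.
move: bu bv; rewrite -!ball_normE /= => bu bv.
have -> : q.2 - p.2 - period tau b = (q.2 - v.2) - (p.2 - u.2).
  by rewrite -uv /=; ring.
by rewrite [ltRHS]splitr (le_lt_trans (ler_normB _ _)) // ltrD.
Qed.

Lemma susp_hausdorff : hausdorff_space susp_space.
Proof.
have [e e0 he] := lattice_gap tau0.
have small a : `|period tau a| < e -> a = 0.
  move=> h; apply/eqP; apply: contraT => /he /le_lt_trans/(_ h).
  by rewrite ltxx.
have e2 : 0 < e / 2%:R by rewrite divr_gt0.
rewrite open_hausdorff => x y; rewrite -(susp_reprK x) -(susp_reprK y).
set p0 := susp_repr x; set q := susp_repr y.
case: (pselect (exists a, `|q.2 - p0.2 - period tau a| < e / 2%:R)); last first.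
  move=> /forallNP h _; apply: (susp_separate e2 openT openT) => //.
  by move=> b _ hb _ _; exact: h hb.
move=> [a]; rewrite -(susp_proj_act a p0).
set p := susp_act a p0 => ha pq.
have {}ha : `|q.2 - p.2| < e / 2%:R by rewrite /p /= opprD addrA.
case: (eqVneq q.2 p.2) => [qp2|qp2].
  have qp1 : p.1 != q.1.
    apply: contra_neq pq => pq1; congr susp_proj.
    by rewrite [p]surjective_pairing [q]surjective_pairing qp2 pq1.
  have : hausdorff_space M := @mspace_hausdorff _ _ M; rewrite open_hausdorff => /(_ _ _ qp1).
  move=> [[A B] /= [/set_mem Ap /set_mem Bq] [oA oB /eqP AB0]].
  apply: (@susp_separate p q A B _ e0 oA oB Ap Bq) => b z.
  rewrite qp2 subrr sub0r normrN => /small -> Az Bz.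
  by have : (A `&` B) z by []; rewrite AB0.
have qp0 : 0 < `|q.2 - p.2| by rewrite normr_gt0 subr_eq0.
apply: (susp_separate qp0 openT openT) => // b z hb _ _.
have b0 : b = 0.
  apply: small; rewrite -normrN -(addKr (q.2 - p.2) (- _)) addrC.
  rewrite (le_lt_trans (ler_normB _ _)) // [ltRHS]splitr ltrD //.
  exact: lt_trans hb ha.
by move: hb; rewrite b0 period0 subr0 ltxx.
Qed.

Lemma susp_second_countable : @second_countable susp_space.
Proof.
have [BM cM [oM bM]] := mspace_countable M.
have [BC cC [oC bC]] := complex_second_countable R.
exists ((fun UW => susp_proj @` (UW.1 `*` UW.2)) @` (BM `*` BC)).
  exact: sub_countable (card_image_le _ _) (countableX cM cC).
split.
  move=> _ [[U W] [/= hU hW] <-]; apply: susp_proj_open.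
  by apply: openX; [exact: oM|exact: oC].
move=> x V nV; set p := susp_repr x.
have : nbhs p (susp_proj @^-1` V).
  by apply: susp_proj_continuous; rewrite susp_reprK.
move=> [[P Q] /= [nP nQ] PQ].
have [U [hU Up] UP] := bM _ _ nP.
have [W [hW Wp] WQ] := bC _ _ nQ.
exists (susp_proj @` (U `*` W)).
  split; first by exists (U, W).
  by exists p => //; exact: susp_reprK.
by move=> _ [r [Ur Wr] <-]; apply: PQ; split; [exact: UP|exact: WQ].
Qed.

(* The suspension M_f, with the quotient topology and the complex structure
   whose charts are the charts (c x id) of M x C carried over by [susp_proj]
   from the sets [cdom c `*` B] on which it is injective. *)
Definition suspension : complexManifold R (n + 1) :=
  ComplexManifold susp_atlas_cover susp_atlas_holo susp_hausdorff
    susp_second_countable.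

End Suspension.

(* Main.v *)
Require Import Defs.
From HB Require Import structures.
From mathcomp Require Import all_boot all_order all_algebra all_fingroup.
From mathcomp Require Import complex spectral ring lra.
From mathcomp Require Import all_classical all_reals interval_inference topology normedtype landau derive.
From mathcomp Require Import sequences realfun exp trigo measure lebesgue_measure lebesgue_integral ftc.
Set Implicit Arguments.
Unset Strict Implicit.
Unset Printing Implicit Defensive.
Import Order.TTheory GRing.Theory Num.Theory numFieldNormedType.Exports.
Local Open Scope classical_set_scope.
Local Open Scope complex_scope.
Local Open Scope ring_scope.

(** Let H be the Gram matrix of a Hermitian metric omega of dimension n in a
    chart.  Expanding wedge powers into minors turns d(omega^(n-1)) = 0 into the
    equations sum_a d/dz_a (adj H)_(b,a) = 0, together with their conjugates,
    which are equivalent to them because adj H is hermitian.  These equations are linear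
    in adj H.  Under a biholomorphic change of variables with Jacobian J they
    are preserved, by Piola's identity sum_a d/dz_a (adj J)_(l,a) = 0, which
    rests on the symmetry of second derivatives; holomorphic functions have
    holomorphic derivatives by Goursat's theorem and Cauchy's formula.

    Hence all h_m = (f^m)^* h are balanced, and by hypothesis they have the same
    determinant D.  Let s : C -> R be real linear with s(1) = 1 and s(tau) = 0,
    and let rho be a bump function on (-1, 1).  The form
    K = sum_m rho(s(z) - m) H_(-m)^-1 on the duals of the tangent spaces of M is
    equivariant under Z^2.  With g > 0 such that g^n = D det K, the metric
    sigma = g K^-1 on the directions of M, plus g |dz|^2, descends to M_f.  Since
    det sigma = D, its adjugate is D K (+) D with D K = sum_m rho(s(z) - m) adj H_(-m);
    as D does not depend on z and rho(s(z) - m) does not depend on the point of M,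
    this adjugate satisfies the equations, so the metric is balanced. *)

(** Gluing the metrics h_m directly with weights in z fails: the closedness of omega^(n-1) is not a
    linear condition on omega, so it does not survive a convex combination. It is linear in the
    adjugate, and this is why the blending is done on the dual side and only then turned back into a
    metric. Inverses are blended rather than adjugates because they transform as tensors, whereas
    adjugates also pick up the factor |det J|^2; the common determinant D converts one into the
    other.

    The sum of the weights may vary with z, since K only has to be positive and equivariant.
    Derivatives of the weights never enter: the mixed blocks of the adjugate vanish, so its rows in
    the directions of M are differentiated in those directions only. As the generator tau acts
    trivially on M, the level s must vanish on it, while s(1) = 1 lets the other generator shift m
    by one.

    Maps are given as complex differentiable only. The smoothness of pulled back metrics, as well as
    Piola's identity, therefore rests on the regularity of holomorphic functions, which accounts for
    the complex analysis at the beginning. *)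

Local Notation re := (@complex.Re _).
Local Notation im := (@complex.Im _).

(** * Goursat's theorem *)

Section SegmentIntegral.
Variable R : realType.
Implicit Types (z w : R[i]) (g h : R -> R[i]) (a b c t : R).
Local Notation mu := (@lebesgue_measure R).

Lemma ReD z w : re (z + w) = re z + re w.
Proof. by case: z; case: w. Qed.
Lemma ImD z w : im (z + w) = im z + im w.
Proof. by case: z; case: w. Qed.
Lemma ReN z : re (- z) = - re z. Proof. by case: z. Qed.
Lemma ImN z : im (- z) = - im z. Proof. by case: z. Qed.
Lemma ReM z w : re (z * w) =
  re z * re w - im z * im w.
Proof. by case: z; case: w. Qed.
Lemma ImM z w : im (z * w) =
  re z * im w + im z * re w.
Proof. by case: z; case: w. Qed.

Lemma eqCP z w : re z = re w -> im z = im w ->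
  z = w.
Proof. by case: z w => a b [c d] /= -> ->. Qed.

Lemma normC_Re z : (re `|z|)%:C = `|z|.
Proof. by rewrite normc_def. Qed.

Lemma norm_Re_le z : (`|re z|)%:C <= `|z|.
Proof. exact: normc_ge_Re. Qed.

Lemma norm_Im_le z : (`|im z|)%:C <= `|z|.
Proof.
rewrite normc_def lecR -(sqrtr_sqr (im z)) ler_wsqrtr //.
by rewrite lerDr sqr_ge0.
Qed.

Lemma norm_le_ReIm z : `|z| <= (`|re z| + `|im z|)%:C.
Proof.
rewrite normc_def lecR -[leRHS]ger0_norm ?addr_ge0 // -[leRHS]sqrtr_sqr.
rewrite ler_wsqrtr // sqrrD !real_normK ?num_real // -addrA lerD2l lerDr.
by rewrite mulrn_wge0 // mulr_ge0.
Qed.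

Lemma norm_realC (x : R) : `|x%:C| = (`|x|)%:C.
Proof. by rewrite normc_def /= expr0n /= addr0 sqrtr_sqr. Qed.

Lemma gt0_realC (e : R[i]) : 0 < e -> exists2 r : R, 0 < r & e = r%:C.
Proof.
move=> e0; have e_r : e = (re e)%:C.
  by apply: eqCP => //=; move: (ltW e0); rewrite lecE => /andP[/eqP].
by exists (re e) => //; rewrite -ltcR -e_r.
Qed.

Lemma Re_continuous : continuous (re : R[i] -> R).
Proof.
move=> z A /nbhs_ballP[e /= e0 eA].
apply/nbhs_ballP; exists e%:C; rewrite /= ?ltcR // => w.
rewrite -ball_normE /= => zw; apply: eA; rewrite -ball_normE /= -ltcR.
apply: le_lt_trans zw; by rewrite -ReN -ReD; exact: norm_Re_le.
Qed.

Lemma Im_continuous : continuous (im : R[i] -> R).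
Proof.
move=> z A /nbhs_ballP[e /= e0 eA].
apply/nbhs_ballP; exists e%:C; rewrite /= ?ltcR // => w.
rewrite -ball_normE /= => zw; apply: eA; rewrite -ball_normE /= -ltcR.
apply: le_lt_trans zw; by rewrite -ImN -ImD; exact: norm_Im_le.
Qed.

Lemma ReIm_cvg (T : Type) (F : set_system T) (FF : Filter F) (f : T -> R[i]) z :
  (re \o f) x @[x --> F] --> re z ->
  (im \o f) x @[x --> F] --> im z ->
  f x @[x --> F] --> z.
Proof.
move=> /cvgrPdist_lt hr /cvgrPdist_lt hi; apply/cvgrPdist_lt => e.
move=> /gt0_realC[r r0 ->].
have r2 : 0 < r / 2 by rewrite divr_gt0.
near=> x.
have h1 : `|re z - re (f x)| < r / 2 by near: x; exact: hr.
have h2 : `|im z - im (f x)| < r / 2 by near: x; exact: hi.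
apply: (le_lt_trans (norm_le_ReIm _)); rewrite ltcR [ltRHS]splitr.
by apply: ltrD; rewrite ?ReD ?ImD ?ReN ?ImN.
Unshelve. all: by end_near. Qed.

Lemma realC_continuous : continuous (fun x : R => x%:C).
Proof.
move=> x; apply: (@ReIm_cvg _ (nbhs x) _ (fun x => x%:C)) => /=.
  exact: cvg_id.
exact: cvg_cst.
Qed.

(** Two-sided continuity, at the end points too: integrands are restrictions of functions continuous
    at every point of the contour, and the condition passes to subsegments at once. *)
Definition ccont a b g := forall t, a <= t <= b -> {for t, continuous g}.

Lemma ccont_cst a b z : ccont a b (fun=> z).
Proof. by move=> t _; exact: cvg_cst. Qed.

Lemma ccont_id a b : ccont a b (fun t => t%:C).
Proof. by move=> t _; exact: realC_continuous. Qed.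

Lemma ccontD a b g h : ccont a b g -> ccont a b h -> ccont a b (fun t => g t + h t).
Proof. by move=> cg ch t abt; apply: cvgD; [exact: cg|exact: ch]. Qed.

Lemma ccontM a b g h : ccont a b g -> ccont a b h -> ccont a b (fun t => g t * h t).
Proof. by move=> cg ch t abt; apply: cvgM; [exact: cg|exact: ch]. Qed.

Lemma ccontN a b g : ccont a b g -> ccont a b (fun t => - g t).
Proof. by move=> cg t abt; apply: cvgN; exact: cg. Qed.

Lemma ccont_integrable a b (f : R -> R) :
  (forall t, a <= t <= b -> {for t, continuous f}) ->
  mu.-integrable `[a, b] (EFin \o f).
Proof.
move=> cf; apply: continuous_compact_integrable; first exact: segment_compact.
apply: continuous_in_subspaceT => t /set_mem; rewrite /= in_itv /=.
exact: cf.
Qed.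

Lemma ccont_Re a b g : ccont a b g -> mu.-integrable `[a, b] (EFin \o (re \o g)).
Proof.
move=> cg; apply: ccont_integrable => t /cg gt.
by apply: (@continuous_comp _ _ _ g); [exact: gt|exact: Re_continuous].
Qed.

Lemma ccont_Im a b g : ccont a b g -> mu.-integrable `[a, b] (EFin \o (im \o g)).
Proof.
move=> cg; apply: ccont_integrable => t /cg gt.
by apply: (@continuous_comp _ _ _ g); [exact: gt|exact: Im_continuous].
Qed.

Definition cint a b g : R[i] :=
  (\int[mu]_(t in `[a, b]) re (g t)) +i*
  (\int[mu]_(t in `[a, b]) im (g t)).

Lemma eq_cint a b g h : (forall t, a <= t <= b -> g t = h t) -> cint a b g = cint a b h.
Proof.
move=> gh; congr (_ +i* _); apply: eq_Rintegral => t /set_mem;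
  by rewrite /= in_itv /= => /gh ->.
Qed.

Lemma cintD a b g h : ccont a b g -> ccont a b h ->
  cint a b (fun t => g t + h t) = cint a b g + cint a b h.
Proof.
move=> cg ch; apply: eqCP; rewrite ?ReD ?ImD /cint /=.
  under eq_Rintegral do rewrite ReD.
  by rewrite RintegralD //; exact: ccont_Re.
under eq_Rintegral do rewrite ImD.
by rewrite RintegralD //; exact: ccont_Im.
Qed.

Lemma cintZ a b z g : ccont a b g -> cint a b (fun t => z * g t) = z * cint a b g.
Proof.
move=> cg; have mI : measurable `[a, b]%classic by [].
have iZ r f : mu.-integrable `[a, b] (EFin \o f) ->
    mu.-integrable `[a, b] (EFin \o (fun x => r * f x)).
  by move=> fi; apply: eq_integrable (integrableZl _ r fi).
have gr := ccont_Re cg; have gi := ccont_Im cg.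
apply: eqCP; rewrite ?ReM ?ImM /cint /=.
  under eq_Rintegral do rewrite ReM.
  by rewrite RintegralB ?RintegralZl //; exact: iZ.
under eq_Rintegral do rewrite ImM.
by rewrite RintegralD ?RintegralZl //; exact: iZ.
Qed.

Lemma cintN a b g : ccont a b g -> cint a b (fun t => - g t) = - cint a b g.
Proof.
move=> cg; rewrite -mulN1r -cintZ //; apply: eq_cint => t _.
by rewrite mulN1r.
Qed.

Lemma cintB a b g h : ccont a b g -> ccont a b h ->
  cint a b (fun t => g t - h t) = cint a b g - cint a b h.
Proof.
by move=> cg ch; rewrite (cintD cg (ccontN ch)) (cintN ch).
Qed.

Lemma Rint_cst a b (r : R) : a <= b -> \int[mu]_(t in `[a, b]) r = r * (b - a).
Proof.
move=> ab; rewrite Rintegral_cst // [X in fine X]lebesgue_measure_itv /= lte_fin.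
move: ab; rewrite le_eqVlt => /predU1P[->|->//].
by rewrite ltxx subrr.
Qed.

Lemma cint_cst a b z : a <= b -> cint a b (fun=> z) = z * (b - a)%:C.
Proof.
move=> ab; apply: eqCP; rewrite ?ReM ?ImM /cint /= Rint_cst //; ring.
Qed.

Lemma cint_split a c b g : a <= c -> c <= b -> ccont a b g ->
  cint a b g = cint a c g + cint c b g.
Proof.
move=> ac cb cg.
have H (f : R -> R) : mu.-integrable `[a, b] (EFin \o f) ->
    \int[mu]_(t in `[a, b]) f t =
    \int[mu]_(t in `[a, c]) f t + \int[mu]_(t in `[c, b]) f t.
  move=> fi; have := Rintegral_itvB fi.
  move=> /(_ c); rewrite !bnd_simp => /(_ ac cb) /eqP; rewrite subr_eq => /eqP ->.
  rewrite addrC; congr (_ + _); apply: Rintegral_itv_obnd_cbnd.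
  by apply: integrableS fi => //; apply: subset_itvr; rewrite bnd_simp.
by apply: eqCP; rewrite ?ReD ?ImD /cint /=; apply: H;
  [exact: ccont_Re|exact: ccont_Im].
Qed.

(** Real and imaginary parts are estimated separately, whence the factor 2. The sharp constant is
    irrelevant below, where only orders of magnitude count. *)
Lemma cint_norm a b g (B : R) : a <= b -> ccont a b g ->
  (forall t, a <= t <= b -> `|g t| <= B%:C) ->
  `|cint a b g| <= (2 * B * (b - a))%:C.
Proof.
move=> ab cg gB; apply: (le_trans (norm_le_ReIm _)); rewrite lecR.
have H (f : R -> R) : mu.-integrable `[a, b] (EFin \o f) ->
    (forall t, a <= t <= b -> `|f t| <= B) ->
    `|\int[mu]_(t in `[a, b]) f t| <= B * (b - a).
  move=> fi fB; apply: (le_trans (le_normr_Rintegral _ _)) => //.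
  rewrite -Rint_cst //; apply: le_Rintegral => //.
  - by have := integrable_norm fi; apply: eq_integrable.
  - by apply: ccont_integrable => t _; exact: cvg_cst.
rewrite -mulrA mulr_natl mulr2n; apply: lerD; apply: H.
- exact: ccont_Re.
- by move=> t /gB gt; rewrite -lecR; apply: (le_trans (norm_Re_le _)).
- exact: ccont_Im.
- by move=> t /gB gt; rewrite -lecR; apply: (le_trans (norm_Im_le _)).
Qed.

Lemma cint_id a b : a <= b ->
  cint a b (fun t => t%:C) = ((b ^+ 2 - a ^+ 2) / 2)%:C.
Proof.
rewrite le_eqVlt => /predU1P[->|ab].
  rewrite subrr mul0r /cint /=.
  by apply: eqCP => /=; rewrite set_itv1 Rintegral_set1.
apply: eqCP => /=; last by rewrite Rint_cst ?mul0r // ltW.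
pose F (x : R) := x ^+ 2 / 2.
have dF (x : R) : is_derive x 1 F x.
  rewrite /F; apply: is_derive_eq; rewrite ?scaler0 ?addr0 /GRing.scale /=.
  by field.
rewrite /Rintegral (@continuous_FTC2 _ _ F) //.
- by rewrite -EFinB /= /F mulrBl.
- by apply: continuous_in_subspaceT => x _; exact: cvg_id.
- split.
  + by move=> x _; apply: ex_derive.
  + by apply: cvg_at_right_filter; apply/differentiable_continuous/derivable1_diffP; apply: ex_derive.
  + by apply: cvg_at_left_filter; apply/differentiable_continuous/derivable1_diffP; apply: ex_derive.
- by move=> x _; rewrite derive1E; apply: derive_val.
Qed.

End SegmentIntegral.

(** * Differentiability and continuity in epsilon-delta form *)

Section DiffEps.
Variables (K : numFieldType) (V W : normedModType K).
Implicit Types (f : V -> W).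

Lemma diff_eps f x : differentiable f x -> forall e : K, 0 < e ->
  exists2 d : K, 0 < d & forall h, `|h| < d ->
    `|f (x + h) - f x - 'd f x h| <= e * `|h|.
Proof.
move=> /diff_locallyP[_ /eqaddoP fo] e /fo /nbhs_ballP[d /= d0 H].
exists d => // h hd; have := H h; rewrite -ball_normE /= sub0r normrN => /(_ hd).
by rewrite !fctE /= opprD addrA [h + x]addrC.
Qed.

Lemma diff_intro f x (L : {linear V -> W}) : continuous L ->
  (forall e : K, 0 < e -> exists2 d : K, 0 < d & forall h, `|h| < d ->
    `|f (x + h) - f x - L h| <= e * `|h|) ->
  differentiable f x /\ 'd f x = L :> (V -> W).
Proof.
move=> cL H.
have fo : f \o shift x = cst (f x) + L +o_ 0 id.
  apply/eqaddoP => e /H[d d0 Hd]; apply/nbhs_ballP; exists d => // h.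
  rewrite -ball_normE /= sub0r normrN => /Hd.
  by rewrite !fctE /= opprD addrA [h + x]addrC.
have e := diff_unique cL fo; split=> //.
by apply/diff_locallyP; rewrite e.
Qed.

Lemma cont_eps f x : {for x, continuous f} -> forall e : K, 0 < e ->
  exists2 d : K, 0 < d & forall h, `|h| < d -> `|f (x + h) - f x| < e.
Proof.
move=> /cvgrPdist_lt H e /H /nbhs_ballP[d /= d0 Hd]; exists d => // h hd.
by rewrite distrC; apply: Hd; rewrite -ball_normE /= opprD addrA subrr sub0r normrN.
Qed.

Lemma eps_cont f x : (forall e : K, 0 < e ->
  exists2 d : K, 0 < d & forall h, `|h| < d -> `|f (x + h) - f x| < e) ->
  {for x, continuous f}.
Proof.
move=> H; apply/cvgrPdist_lt => e /H[d d0 Hd]; apply/nbhs_ballP; exists d => // y.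
rewrite -ball_normE /= distrC => /Hd; rewrite [x + _]addrC subrK distrC; exact.
Qed.

End DiffEps.

Section Goursat.
Variable R : realType.
Implicit Types (phi psi : R[i] -> R[i]) (a b c d x y : R).

Lemma horiz_continuous y : continuous (fun x : R => x +i* y : R[i]).
Proof.
move=> x; apply: (@ReIm_cvg _ _ (nbhs x) _ (fun x => x +i* y)) => /=.
  exact: cvg_id.
exact: cvg_cst.
Qed.

Lemma vert_continuous x : continuous (fun y : R => x +i* y : R[i]).
Proof.
move=> y; apply: (@ReIm_cvg _ _ (nbhs y) _ (fun y => x +i* y)) => /=.
  exact: cvg_cst.
exact: cvg_id.
Qed.

Definition rcont phi a b c d := forall x y, a <= x <= b -> c <= y <= d ->
  {for x +i* y, continuous phi}.

Lemma rcont_h phi a b c d y : rcont phi a b c d -> c <= y <= d ->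
  ccont a b (fun x => phi (x +i* y)).
Proof.
move=> cp cy t at_; apply: (@continuous_comp _ _ _ (fun x => x +i* y) phi).
  exact: horiz_continuous.
exact: cp.
Qed.

Lemma rcont_v phi a b c d x : rcont phi a b c d -> a <= x <= b ->
  ccont c d (fun y => phi (x +i* y)).
Proof.
move=> cp cy t at_; apply: (@continuous_comp _ _ _ (fun y => x +i* y) phi).
  exact: vert_continuous.
exact: cp.
Qed.

Lemma rcontS phi a b c d a' b' c' d' : a <= a' -> b' <= b -> c <= c' -> d' <= d ->
  rcont phi a b c d -> rcont phi a' b' c' d'.
Proof.
move=> ha hb hc hd H x y /andP[x1 x2] /andP[y1 y2]; apply: H.
  by rewrite (le_trans ha) // (le_trans x2).
by rewrite (le_trans hc) // (le_trans y2).
Qed.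

Lemma rcontB phi psi a b c d : rcont phi a b c d -> rcont psi a b c d ->
  rcont (fun z => phi z - psi z) a b c d.
Proof.
move=> cp cq x y hx hy; have h1 := cp x y hx hy; have h2 := cq x y hx hy.
exact: (cvgB h1 h2).
Qed.

(** The contour integral of [phi] along the boundary of [a, b] x [c, d], counterclockwise; dz = i dy
    on the vertical sides. *)
Definition rect_int phi a b c d : R[i] :=
  cint a b (fun x => phi (x +i* c)) - cint a b (fun x => phi (x +i* d)) +
  'i%C * cint c d (fun y => phi (b +i* y)) - 'i%C * cint c d (fun y => phi (a +i* y)).

Lemma rect_intB phi psi a b c d : a <= b -> c <= d ->
  rcont phi a b c d -> rcont psi a b c d ->
  rect_int (fun z => phi z - psi z) a b c d =
  rect_int phi a b c d - rect_int psi a b c d.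
Proof.
move=> ab cd cp cq.
have ha : a <= a <= b by rewrite lexx. have hb : a <= b <= b by rewrite lexx ab.
have hc : c <= c <= d by rewrite lexx. have hd : c <= d <= d by rewrite lexx cd.
rewrite /rect_int !cintB; [ring|..];
  by [exact: rcont_h cp _|exact: rcont_h cq _|exact: rcont_v cp _|exact: rcont_v cq _].
Qed.

(** The perimeter is twice (b - a) + (d - c), and [cint_norm] loses another factor 2. *)
Lemma rect_int_norm phi a b c d (B : R) : a <= b -> c <= d ->
  rcont phi a b c d ->
  (forall x y, a <= x <= b -> c <= y <= d -> `|phi (x +i* y)| <= B%:C) ->
  `|rect_int phi a b c d| <= (4 * B * ((b - a) + (d - c)))%:C.
Proof.
move=> ab cd cp hB.
have ha : a <= a <= b by rewrite lexx. have hb : a <= b <= b by rewrite lexx ab.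
have hc : c <= c <= d by rewrite lexx. have hd : c <= d <= d by rewrite lexx cd.
have i1 : `|'i%C : R[i]| = 1 by rewrite normc_def /= expr0n expr1n add0r sqrtr1.
rewrite /rect_int (le_trans (ler_normB _ _)) //.
rewrite (_ : _ %:C = (2 * B * (b - a))%:C + (2 * B * (b - a))%:C +
   (2 * B * (d - c))%:C + (2 * B * (d - c))%:C); last first.
  by rewrite -!rmorphD /=; congr (_ %:C); ring.
rewrite lerD //; last first.
  by rewrite normrM i1 mul1r cint_norm //; [exact: rcont_v cp _|move=> t ht; exact: hB].
rewrite (le_trans (ler_normD _ _)) // lerD //; last first.
  by rewrite normrM i1 mul1r cint_norm //; [exact: rcont_v cp _|move=> t ht; exact: hB].
by rewrite (le_trans (ler_normB _ _)) // lerD // cint_norm //;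
  [exact: rcont_h cp _|move=> t ht; exact: hB|exact: rcont_h cp _|move=> t ht; exact: hB].
Qed.

Lemma rect_int_affine (u v : R[i]) a b c d : a <= b -> c <= d ->
  rect_int (fun z => u + v * z) a b c d = 0.
Proof.
move=> ab cd.
have E (w s : R[i]) a' b' : a' <= b' -> cint a' b' (fun t => w + s * t%:C) =
    w * (b' - a')%:C + s * ((b' ^+ 2 - a' ^+ 2) / 2)%:C.
  move=> ab'; rewrite cintD; [|exact: ccont_cst|]; last first.
    by apply: ccontM; [exact: ccont_cst|exact: ccont_id].
  by rewrite cint_cst // cintZ ?cint_id //; exact: ccont_id.
have hE y : cint a b (fun x => u + v * (x +i* y)) =
    cint a b (fun x => (u + v * (0 +i* y)) + v * x%:C).
  by apply: eq_cint => t _; rewrite -addrA -mulrDr; congr (_ + _ * _); simpc.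
have vE x : cint c d (fun y => u + v * (x +i* y)) =
    cint c d (fun y => (u + v * x%:C) + (v * 'i%C) * y%:C).
  by apply: eq_cint => t _; rewrite -mulrA -addrA -mulrDr; congr (_ + _ * _); simpc.
rewrite /rect_int !hE !vE !E //.
rewrite (_ : (0 +i* c) = 'i%C * c%:C); last by simpc.
rewrite (_ : (0 +i* d) = 'i%C * d%:C); last by simpc.
rewrite !rmorphM !rmorphB /= !rmorphXn /= !fmorphV /= !rmorph_nat.
by field.
Qed.

Lemma rect_int_quarter phi a m b c n d : a <= m -> m <= b -> c <= n -> n <= d ->
  rcont phi a b c d ->
  rect_int phi a b c d = rect_int phi a m c n + rect_int phi m b c n +
    rect_int phi a m n d + rect_int phi m b n d.
Proof.
move=> am mb cn nd cp; have ab := le_trans am mb; have cd := le_trans cn nd.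
have ha : a <= a <= b by rewrite lexx. have hb : a <= b <= b by rewrite lexx ab.
have hm : a <= m <= b by rewrite am. have hn : c <= n <= d by rewrite cn.
have hc : c <= c <= d by rewrite lexx. have hd : c <= d <= d by rewrite lexx cd.
rewrite /rect_int.
rewrite (cint_split am mb (rcont_h cp hc)) (cint_split am mb (rcont_h cp hd)).
rewrite (cint_split cn nd (rcont_v cp ha)) (cint_split cn nd (rcont_v cp hb)).
ring.
Qed.

Lemma ler_norm_sum4 (K : numDomainType) (u v w z r : K) :
  `|u| <= r -> `|v| <= r -> `|w| <= r -> `|z| <= r -> `|u + v + w + z| <= r + r + r + r.
Proof.
move=> u1 v1 w1 z1; apply: le_trans (ler_normD _ _) (lerD _ z1).
by apply: le_trans (ler_normD _ _) (lerD _ w1); apply: le_trans (ler_normD _ _) (lerD u1 v1).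
Qed.

(** Subtracting the tangent affine function, whose integral is 0, leaves an integrand of size e P on
    a rectangle of half perimeter P; the perimeter contributes a second factor P. *)
Lemma goursat_local phi x0 y0 (e : R) : 0 < e ->
  differentiable phi (x0 +i* y0) -> exists2 r : R, 0 < r &
  forall a b c d, a <= x0 <= b -> c <= y0 <= d -> (b - a) + (d - c) < r ->
    rcont phi a b c d ->
    `|rect_int phi a b c d| <= (4 * e * ((b - a) + (d - c)) ^+ 2)%:C.
Proof.
move=> e0 dphi; have e0' : 0 < e%:C :> R[i] by rewrite ltcR.
have [_ /gt0_realC[r r0 ->] H] := diff_eps dphi e0'.
exists r => // a b c d /andP[ax xb] /andP[cy yd] Pr cp.
have ab := le_trans ax xb; have cd := le_trans cy yd.
set p := x0 +i* y0 in dphi H *; set L := 'd phi p in H *.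
have LE h : L h = L 1 * h by rewrite mulrC -[RHS]linearZ /= -[h *: 1]/(h * 1) mulr1.
pose A z := (phi p - L 1 * p) + L 1 * z.
have cA : rcont A a b c d.
  move=> x y _ _; apply: (@continuousD _ _ _ (fun=> _) ( *%R (L 1))).
    exact: cst_continuous.
  exact: mulrl_continuous.
have -> : rect_int phi a b c d = rect_int (fun z => phi z - A z) a b c d.
  by rewrite rect_intB // rect_int_affine // subr0.
set P := (b - a) + (d - c).
have -> : 4 * e * P ^+ 2 = 4 * (e * P) * P by ring.
apply: (rect_int_norm ab cd (rcontB cp cA)) => x y /andP[h1 h2] /andP[h3 h4].
have hP : `|(x +i* y) - p| <= P%:C.
  apply: (le_trans (norm_le_ReIm _)); rewrite lecR /p ReD ImD ReN ImN /= /P.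
  by apply: lerD; rewrite ler_norml; apply/andP; split; lra.
have E : p + ((x +i* y) - p) = x +i* y by rewrite addrC subrK.
have := H ((x +i* y) - p); rewrite E LE.
have -> : phi (x +i* y) - phi p - L 1 * ((x +i* y) - p) = phi (x +i* y) - A (x +i* y).
  by rewrite /A; ring.
move=> /(_ _)/le_trans; apply.
  by apply: le_lt_trans hP _; rewrite ltcR.
by rewrite rmorphM /= ler_wpM2l // ltW.
Qed.

Lemma exp2_small (L e : R) : 0 < e -> exists k, L / 2 ^+ k < e.
Proof.
move=> e0; case: (lerP L 0) => L0.
  by exists 0; rewrite expr0 divr1 (le_lt_trans L0).
have /archi_boundP := ltW (divr_gt0 L0 e0); set k := Num.bound _ => hk.
exists k; rewrite ltr_pdivrMr ?exprn_gt0 // mulrC -ltr_pdivrMr //.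
apply: (lt_trans hk); rewrite -natrX ltr_nat; exact: ltn_expl.
Qed.

(** Bisection. One of the four quarters keeps at least a quarter of the modulus of the integral,
    while the square of the half perimeter is divided by 4. A nonzero integral would thus yield
    nested rectangles violating [goursat_local] at their common point. *)
Lemma goursat phi a b c d : a <= b -> c <= d ->
  (forall x y, a <= x <= b -> c <= y <= d -> differentiable phi (x +i* y)) ->
  rect_int phi a b c d = 0.
Proof.
move=> ab cd dphi.
have cp : rcont phi a b c d by move=> x y hx hy; exact/differentiable_continuous/dphi.
apply/eqP; apply: contraT; rewrite -normr_gt0 => I0.
set L := b - a; set H := d - c; set P := L + H.
have L0 : 0 <= L by rewrite subr_ge0. have H0 : 0 <= H by rewrite subr_ge0.
have [v v0 Iv] := gt0_realC I0.
(* This makes 4 e P^2 < v, so the whole rectangle is bad; the [+ 1] covers P = 0. *)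
pose e := v / (8 * (P ^+ 2 + 1)).
have q0 : 0 < P ^+ 2 + 1 by rewrite ltr_wpDl ?sqr_ge0.
have e0 : 0 < e by rewrite divr_gt0 // mulr_gt0.
pose l k := L / 2 ^+ k; pose h k := H / 2 ^+ k.
have l0 k : 0 <= l k by rewrite divr_ge0 // exprn_ge0.
have h0 k : 0 <= h k by rewrite divr_ge0 // exprn_ge0.
have lS k : l k = l k.+1 + l k.+1.
  by rewrite /l exprS; field; rewrite expf_neq0 ?pnatr_eq0.
have hS k : h k = h k.+1 + h k.+1.
  by rewrite /h exprS; field; rewrite expf_neq0 ?pnatr_eq0.
(* The rectangles of the [k]-th bisection on which the integral is too large
   for [goursat_local]. *)
pose bad k (p : R * R) := [/\ a <= p.1, p.1 + l k <= b, c <= p.2, p.2 + h k <= d &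
  (4 * e * (l k + h k) ^+ 2)%:C < `|rect_int phi p.1 (p.1 + l k) p.2 (p.2 + h k)|].
have bad0 : bad 0 (a, c).
  rewrite /bad /l /h /= !expr0 !divr1 [a + _]addrC [c + _]addrC !subrK lexx lexx.
  split=> //; rewrite Iv ltcR -/P /e.
  rewrite (_ : 4 * _ * _ = v * ((P ^+ 2) / (2 * (P ^+ 2 + 1)))); last by field; lra.
  rewrite -[ltRHS]mulr1 ltr_pM2l // ltr_pdivrMr ?mulr_gt0 // mul1r.
  by have := sqr_ge0 P; lra.
have step k p : bad k p -> exists q, bad k.+1 q /\
    [/\ p.1 <= q.1, q.1 + l k.+1 <= p.1 + l k, p.2 <= q.2 &
      q.2 + h k.+1 <= p.2 + h k].
  case: p => x y [/= ax xb cy yd B].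
  have lk := l0 k.+1; have hk := h0 k.+1.
  have := lS k; have := hS k; set l' := l k.+1; set h' := h k.+1 => hS' lS'.
  rewrite -/l' -/h' in lk hk.
  have cp' : rcont phi x (x + l k) y (y + h k) by exact: rcontS cp.
  have Q : rect_int phi x (x + l k) y (y + h k) =
    rect_int phi x (x + l') y (y + h') + rect_int phi (x + l') (x + l' + l') y (y + h')
    + rect_int phi x (x + l') (y + h') (y + h' + h')
    + rect_int phi (x + l') (x + l' + l') (y + h') (y + h' + h').
    have ex : x + l k = x + l' + l' by rewrite lS' addrA.
    have ey : y + h k = y + h' + h' by rewrite hS' addrA.
    by rewrite ex ey in cp' *; apply: rect_int_quarter; rewrite ?lerDl.
  apply: contrapT => no.
  have nb x' y' : x <= x' -> x' + l' <= x + l k -> y <= y' -> y' + h' <= y + h k ->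
      `|rect_int phi x' (x' + l') y' (y' + h')| <= (4 * e * (l' + h') ^+ 2)%:C.
    move=> h1 h2 h3 h4; rewrite real_leNgt ?normr_real //; last first.
      by rewrite ger0_real // ler0c mulr_ge0 ?sqr_ge0 // mulr_ge0 // ltW.
    apply/negP => Hb; apply: no; exists (x', y'); split; last by split.
    by split => //=; [exact: le_trans h1|exact: le_trans xb|exact: le_trans h3|exact: le_trans yd].
  move: B; rewrite Q; apply/negP; rewrite -real_leNgt ?normr_real //; last first.
    by rewrite ger0_real // ler0c mulr_ge0 ?sqr_ge0 // mulr_ge0 // ltW.
  rewrite (_ : _%:C = (4 * e * (l' + h') ^+ 2)%:C + (4 * e * (l' + h') ^+ 2)%:C +
    (4 * e * (l' + h') ^+ 2)%:C + (4 * e * (l' + h') ^+ 2)%:C); last first.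
    by rewrite lS' hS' -!rmorphD /=; congr (_%:C); ring.
  have nb1 := nb x y; have nb2 := nb (x + l') y; have nb3 := nb x (y + h').
  have nb4 := nb (x + l') (y + h').
  by apply: ler_norm_sum4; [apply: nb1|apply: nb2|apply: nb3|apply: nb4]; clear -lS' hS' lk hk; lra.
pose nxt k p : R * R := xget p [set q | bad k.+1 q /\
    [/\ p.1 <= q.1, q.1 + l k.+1 <= p.1 + l k, p.2 <= q.2 &
      q.2 + h k.+1 <= p.2 + h k]].
pose s := fix s k := if k is k'.+1 then nxt k' (s k') else (a, c).
have sbad k : bad k (s k).
  elim: k => //= k IH; rewrite /nxt; case: xgetP => [q _ []//|no].
  by have [q Hq] := step _ _ IH; case: (no q Hq).
have sstep k : [/\ (s k).1 <= (s k.+1).1, (s k.+1).1 + l k.+1 <= (s k).1 + l k,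
      (s k).2 <= (s k.+1).2 & (s k.+1).2 + h k.+1 <= (s k).2 + h k].
  rewrite /=; rewrite {1 2 3 4}/nxt; case: xgetP => [q _ []//|no].
  by have [q Hq] := step _ _ (sbad k); case: (no q Hq).
have nest i j : (i <= j)%N -> [/\ (s i).1 <= (s j).1, (s j).1 + l j <= (s i).1 + l i,
      (s i).2 <= (s j).2 & (s j).2 + h j <= (s i).2 + h i].
  elim: j => [|j IH]; first by rewrite leqn0 => /eqP->.
  rewrite leq_eqVlt => /predU1P[->//|]; rewrite ltnS => /IH[i1 i2 i3 i4].
  have [j1 j2 j3 j4] := sstep j.
  by split; [exact: le_trans j1|exact: le_trans i2|exact: le_trans j3|exact: le_trans i4].
have bnd i j : (s i).1 <= (s j).1 + l j /\ (s i).2 <= (s j).2 + h j.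
  case: (leqP i j) => [/nest[i1 _ i3 _]|/ltnW/nest[_ i2 _ i4]].
    by split; [apply: (le_trans i1)|apply: (le_trans i3)]; rewrite lerDl.
  by split; [apply: le_trans i2|apply: le_trans i4]; rewrite lerDl.
(* Every lower left corner is bounded by every upper right corner, so the suprema of the lower left
   coordinates give a point of all the rectangles. *)
pose X := [set (s k).1 | k in setT]; pose Y := [set (s k).2 | k in setT].
have supX j : (s j).1 <= sup X <= (s j).1 + l j.
  apply/andP; split; [apply: ub_le_sup => //|apply: ge_sup] => //.
  - by exists ((s 0).1 + l 0) => _ [i _ <-]; exact: (bnd i 0).1.
  - by exists j.
  - by exists (s 0).1; exists 0.
  - by move=> _ [i _ <-]; exact: (bnd i j).1.
have supY j : (s j).2 <= sup Y <= (s j).2 + h j.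
  apply/andP; split; [apply: ub_le_sup => //|apply: ge_sup] => //.
  - by exists ((s 0).2 + h 0) => _ [i _ <-]; exact: (bnd i 0).2.
  - by exists j.
  - by exists (s 0).2; exists 0.
  - by move=> _ [i _ <-]; exact: (bnd i j).2.
have hx : a <= sup X <= b.
  have := supX 0; have [] := sbad 0; rewrite /= => h1 h2 _ _ _ /andP[h3 h4].
  by rewrite h3 (le_trans h4).
have hy : c <= sup Y <= d.
  have := supY 0; have [] := sbad 0; rewrite /= => _ _ h1 h2 _ /andP[h3 h4].
  by rewrite h3 (le_trans h4).
have [r r0 Hr] := goursat_local e0 (dphi _ _ hx hy).
have [k hk] := exp2_small P r0.
have [b1 b2 b3 b4 B] := sbad k; move: B.
rewrite real_ltNge ?normr_real //; last first.
  by rewrite ger0_real // ler0c mulr_ge0 ?sqr_ge0 // mulr_ge0 // ltW.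
have := Hr _ _ _ _ (supX k) (supY k); rewrite ![_ + l k - _]addrC ![_ + h k - _]addrC !addKr.
move=> ->//; first by rewrite -mulrDl.
exact: rcontS cp.
Qed.

End Goursat.

(** * Cauchy's formula on circles *)

Section ComplexExp.
Variable R : realType.
Implicit Types (g : R[i] -> R[i]) (x y t r : R) (z h : R[i]).

Definition expi t : R[i] := cos t +i* sin t.
Definition cexp z : R[i] := (expR (re z))%:C * expi (im z).

Lemma expi0 : expi 0 = 1. Proof. by rewrite /expi cos0 sin0. Qed.

Lemma expiD x y : expi (x + y) = expi x * expi y.
Proof. by apply: eqCP; rewrite ?ReM ?ImM /= ?cosD ?sinD // addrC. Qed.

Lemma expi_2pi : expi (2 * pi) = 1.
Proof. by rewrite /expi mulr_natl cos2pi sin2pi. Qed.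

Lemma norm_expi t : `|expi t| = 1.
Proof. by rewrite normc_def /= cos2Dsin2 sqrtr1. Qed.

Lemma expi_neq0 t : expi t != 0.
Proof. by rewrite -normr_eq0 norm_expi oner_eq0. Qed.

Lemma cexpD z h : cexp (z + h) = cexp z * cexp h.
Proof. by rewrite /cexp ReD ImD expRD expiD rmorphM /= mulrACA. Qed.

Lemma norm_cexp z : `|cexp z| = (expR (re z))%:C.
Proof. by rewrite normrM norm_expi mulr1 norm_realC gtr0_norm // expR_gt0. Qed.

Lemma expi_continuous : continuous expi.
Proof.
move=> t; apply: (@ReIm_cvg _ _ (nbhs t) _ expi) => /=.
  exact: continuous_cos.
exact: continuous_sin.
Qed.

Lemma real_deriv_eps (f : R -> R) (x d : R) : is_derive x 1 f d ->
  forall e : R, 0 < e -> exists2 r : R, 0 < r & forall t, `|t| < r ->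
    `|f (x + t) - f x - d * t| <= e * `|t|.
Proof.
move=> fd e e0; have df : differentiable f x.
  by apply/derivable1_diffP; apply: ex_derive.
have [r r0 H] := diff_eps df e0; exists r => // t /H.
rewrite -[in 'd f x t](mulr1 t) -[t * 1]/(t *: 1) linearZ /= -deriveE //.
by rewrite derive_val /GRing.scale /= mulrC.
Qed.

(** The derivative of the exponential at 0, from those of the real exponential, cosine and sine;
    [cexpD] carries it to every point. *)
Lemma cexp_near0 (e : R) : 0 < e -> exists2 r : R, 0 < r & forall h,
  `|h| < r%:C -> `|cexp h - 1 - h| <= e%:C * `|h|.
Proof.
move=> e0; pose d := Num.min 1 (e / 8).
have d0 : 0 < d by rewrite lt_min ltr01 /= divr_gt0.
have d1 : d <= 1 by rewrite ge_min lexx.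
have d8 : d <= e / 8 by rewrite ge_min lexx orbT.
clearbody d.
have [r1 r10 H1] := real_deriv_eps (is_derive_expR 0) d0.
have [r2 r20 H2] := real_deriv_eps (is_derive_cos 0) d0.
have [r3 r30 H3] := real_deriv_eps (is_derive_sin 0) d0.
exists (Num.min (Num.min r1 r2) (Num.min r3 d)).
  by rewrite !lt_min r10 r20 r30 d0.
move=> h hr; rewrite -normC_Re in hr *; set n := re `|h| in hr *.
have xn : `|re h| <= n by rewrite -lecR normC_Re; exact: norm_Re_le.
have yn : `|im h| <= n by rewrite -lecR normC_Re; exact: norm_Im_le.
move: hr; rewrite ltcR !lt_min => /andP[/andP[n1 n2] /andP[n3 n4]].
have := H1 (re h) (le_lt_trans xn n1); have := H2 (im h) (le_lt_trans yn n2).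
have := H3 (im h) (le_lt_trans yn n3).
rewrite !add0r expR0 sin0 cos0 oppr0 mul0r !subr0 ?addr0 !mul1r => h3 h2 h1.
set x := re h in xn h1; set y := im h in yn h2 h3.
have n0 : 0 <= n by exact: le_trans (normr_ge0 _) xn.
have -> : cexp h - 1 - h = (expR x - 1 - x)%:C * expi y +
   (1 + x)%:C * ((cos y - 1)%:C + 'i%C * (sin y - y)%:C) + 'i%C * (x * y)%:C.
  by apply: eqCP; rewrite !(ReM, ImM, ReD, ImD, ReN, ImN) /= -/x -/y; ring.
have i1 : `|'i%C : R[i]| = 1 by rewrite normc_def /= expr0n expr1n add0r sqrtr1.
rewrite -rmorphM /=.
apply: (le_trans (ler_normD _ _)); apply: (le_trans (lerD (ler_normD _ _) (lexx _))).
rewrite !normrM norm_expi i1 mulr1 mul1r !norm_realC.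
have h5 : `|(cos y - 1)%:C + 'i%C * (sin y - y)%:C| <= (d * n + d * n)%:C.
  apply: (le_trans (ler_normD _ _)); rewrite normrM i1 mul1r !norm_realC -rmorphD lecR.
  by apply: lerD; [apply: (le_trans h2)|apply: (le_trans h3)]; rewrite ler_wpM2l // ltW.
have x1 : `|1 + x| <= 2.
  by apply: (le_trans (ler_normD _ _)); rewrite normr1 (_ : 2 = 1 + 1) // lerD2l; lra.
have h6 : (`|1 + x|)%:C * `|(cos y - 1)%:C + 'i%C * (sin y - y)%:C| <=
    2%:C * (d * n + d * n)%:C.
  by apply: ler_pM => //; rewrite ?ler0c ?lecR.
apply: (le_trans (lerD (lerD (lexx _) h6) (lexx _))).
rewrite -!rmorphM -!rmorphD lecR /=.
have h7 : `|x * y| <= d * n.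
  by rewrite normrM ler_pM // (le_trans xn) // ltW.
have h8 : `|expR x - 1 - x| <= d * n.
  by apply: (le_trans h1); rewrite ler_wpM2l // ltW.
have : d * n <= e / 8 * n by rewrite ler_wpM2r.
rewrite -!mulrA => h9.
have h10 : 0 <= e * n by rewrite mulr_ge0 // ltW.
move: h7 h8 h9; set u := `|x * y|; set v := `|_ - x|; set w := d * n => h7 h8 h9.
have : 8^-1 * n = n / 8 by rewrite mulrC.
by move=> E; rewrite E mulrA in h9; lra.
Qed.

Lemma mul_continuousC (c : R[i]) : continuous ( *%R c : R[i] -> R[i]).
Proof. exact: mulrl_continuous. Qed.

Lemma cexp_differentiable z : differentiable cexp z.
Proof.
have lin : linear (fun h : R[i] => cexp z * h : R[i]).
  by move=> a u v; rewrite mulrDr /GRing.scale /= mulrCA.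
pose L0 := GRing.isLinear.Build _ _ _ _ _ lin.
pose L : {linear R[i] -> R[i]} := HB.pack (fun h : R[i] => cexp z * h : R[i]) L0.
have cL : continuous L by exact: mul_continuousC.
have n0 : 0 < expR (re z) by exact: expR_gt0.
apply: (diff_intro cL _).1 => e /gt0_realC[e' e0 ->].
have [r r0 H] := cexp_near0 (divr_gt0 e0 n0).
exists r%:C; first by rewrite ltcR.
move=> h /H hh; rewrite cexpD -[L h]/(cexp z * h).
rewrite -[X in _ - X - _]mulr1 -!mulrBr normrM norm_cexp.
rewrite (_ : e'%:C = (expR (re z))%:C * (e' / expR (re z))%:C); last first.
  by rewrite -rmorphM /= mulrC divfK // gt_eqF.
by rewrite -mulrA ler_wpM2l // ler0c ltW.
Qed.

Lemma cexp_neq0 z : cexp z != 0.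
Proof. by rewrite -normr_gt0 norm_cexp ltcR expR_gt0. Qed.

(* In the coordinate [z = exp (s + i t)] the circles centred at 0 are the
   vertical segments of length [2 pi], and the two horizontal sides of the
   contour cancel by periodicity. *)
Lemma circle_int_cst g r r' : 0 < r' -> r' <= r ->
  (forall z, z != 0 -> `|z| <= r%:C -> differentiable g z) ->
  cint 0 (2 * pi) (fun t => g (r'%:C * expi t)) =
  cint 0 (2 * pi) (fun t => g (r%:C * expi t)).
Proof.
move=> r0 rr dg; have r0' := lt_le_trans r0 rr.
have E s t : cexp (s +i* t) = (expR s)%:C * expi t by [].
have := @goursat R (g \o cexp) (ln r') (ln r) 0 (2 * pi).
rewrite ler_ln ?posrE // => /(_ rr).
have pi0 : 0 <= 2 * pi :> R by rewrite mulr_ge0 // pi_ge0.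
move=> /(_ pi0) H; have {}H := H _.
have : rect_int (g \o cexp) (ln r') (ln r) 0 (2 * pi) = 0.
  apply: H => s t /andP[_ s2] _; apply: differentiable_comp.
    exact: cexp_differentiable.
  apply: dg; first exact: cexp_neq0.
  by rewrite norm_cexp lecR /= -[leRHS]lnK ?posrE // ler_expR.
rewrite /rect_int /=.
have -> : cint (ln r') (ln r) (fun s => g (cexp (s +i* (2 * pi)))) =
    cint (ln r') (ln r) (fun s => g (cexp (s +i* 0))).
  by apply: eq_cint => s _; rewrite !E expi_2pi expi0.
rewrite subrr add0r -mulrBr => /eqP; rewrite mulf_eq0 => /orP[|].
  by rewrite eq_complex /= oner_eq0 andbF.
rewrite subr_eq0 => /eqP H2; apply/esym; move: H2.
rewrite (eq_cint (h := fun t => g (r%:C * expi t))); last first.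
  by move=> t _; rewrite E lnK.
move=> ->; apply: eq_cint => t _; by rewrite E lnK.
Qed.

(** By [circle_int_cst] the circle may be shrunk, and continuity at 0 identifies the limit.
    Differentiability is asked away from 0 only, so that difference quotients qualify. *)
Lemma circle_mean g r : 0 < r ->
  (forall z, z != 0 -> `|z| <= r%:C -> differentiable g z) ->
  {for 0, continuous g} ->
  cint 0 (2 * pi) (fun t => g (r%:C * expi t)) = g 0 * (2 * pi)%:C.
Proof.
move=> r0 dg g0.
have pi0 : 0 <= 2 * pi :> R by rewrite mulr_ge0 // pi_ge0.
have cg r' : 0 < r' -> r' <= r -> ccont 0 (2 * pi) (fun t => g (r'%:C * expi t)).
  move=> r'0 r'r t _; apply: (@continuous_comp _ _ _ (fun t => r'%:C * expi t) g).
    by apply: cvgM; [exact: cvg_cst|exact: expi_continuous].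
  apply/differentiable_continuous/dg.
    by rewrite mulf_neq0 ?expi_neq0 // gt_eqF // ltcR.
  by rewrite normrM norm_expi mulr1 norm_realC lecR gtr0_norm.
apply/eqP; rewrite -subr_eq0 -normr_eq0 eq_le normr_ge0 andbT.
apply/ler_addgt0Pl => _ /gt0_realC[e e0 ->]; rewrite addr0.
(* [cint_norm] multiplies the bound of the integrand by 2 (2 pi) = 4 pi. *)
have q0 : 0 < 4 * pi + 1 :> R by rewrite ltr_wpDl // mulr_ge0 // pi_ge0.
have e1 : 0 < (e / (4 * pi + 1))%:C :> R[i] by rewrite ltcR divr_gt0.
have [_ /gt0_realC[d d0 ->] Hd] := cont_eps g0 e1.
pose r' := Num.min r (d / 2).
have r'0 : 0 < r' by rewrite lt_min r0 divr_gt0.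
have r'r : r' <= r by rewrite ge_min lexx.
have r'd : r' < d by rewrite gt_min; apply/orP; right; lra.
have -> : (2 * pi)%:C = (2 * pi - 0)%:C :> R[i] by rewrite subr0.
rewrite -(circle_int_cst r'0 r'r dg) -cint_cst // -cintB; [|exact: cg|exact: ccont_cst].
apply: (le_trans (cint_norm (B := e / (4 * pi + 1)) pi0 _ _)).
- by apply: ccontD; [exact: cg|exact: ccont_cst].
- move=> t _; rewrite ltW // -[r'%:C * _]add0r; apply: Hd.
  by rewrite normrM norm_expi mulr1 norm_realC ltcR gtr0_norm.
rewrite lecR subr0.
rewrite (_ : _ * _ = e * ((4 * pi) / (4 * pi + 1))); last by ring.
rewrite ler_piMr ?(ltW e0) // ler_pdivrMr // mul1r; lra.
Qed.

End ComplexExp.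

Section HolomorphicDerivative.
Variables (R : realType) (V : normedModType R[i]).
Implicit Types (F : V -> R[i]) (U : set V) (x y v h : V) (t r : R).

Lemma eps_is_derive (f : R -> R) (x d : R) :
  (forall e : R, 0 < e -> exists2 r : R, 0 < r & forall t, `|t| < r ->
    `|f (x + t) - f x - t * d| <= e * `|t|) -> is_derive x 1 f d.
Proof.
move=> H.
have lin : linear (fun t : R => t * d : R).
  by move=> a u w; rewrite mulrDl /GRing.scale /= mulrA.
pose L0 := GRing.isLinear.Build _ _ _ _ _ lin.
pose L : {linear R -> R} := HB.pack (fun t : R => t * d : R) L0.
have cL : continuous L by exact: mulrr_continuous.
have [df E] := diff_intro cL H.
apply: DeriveDef; first exact/derivable1_diffP.
by rewrite deriveE // E /= mul1r.
Qed.

Lemma norm_realZ t h : `|t%:C *: h| = (`|t|)%:C * `|h|.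
Proof. by rewrite normrZ norm_realC. Qed.

Lemma normV_re h : `|h| = (re `|h|)%:C.
Proof. by apply: eqCP => //=; move: (normr_ge0 h); rewrite lecE => /andP[/eqP]. Qed.

Lemma line_eps F x h : differentiable F x ->
  forall e : R, 0 < e -> exists2 r : R, 0 < r & forall t, `|t| < r ->
    `|F (x + t%:C *: h) - F x - t%:C * 'd F x h| <= (e * `|t|)%:C.
Proof.
move=> dF e e0.
have h0 : 0 <= re `|h| by rewrite -ler0c -normV_re.
(* The [+ 1], here and in similar estimates, covers the zero vector. *)
have q0 : 0 < re `|h| + 1 by rewrite ltr_wpDl.
have e1 : 0 < (e / (re `|h| + 1))%:C :> R[i] by rewrite ltcR divr_gt0.
have [_ /gt0_realC[r r0 ->] H] := diff_eps dF e1.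
exists (r / (re `|h| + 1)); first by rewrite divr_gt0.
move=> t; rewrite ltr_pdivlMr // => tr.
have /H : `|t%:C *: h| < r%:C.
  rewrite norm_realZ normV_re -rmorphM ltcR /=; apply: le_lt_trans tr.
  by rewrite ler_wpM2l // lerDl.
rewrite linearZ /= => /le_trans; apply.
rewrite norm_realZ normV_re -!rmorphM lecR /=.
rewrite mulrCA [leRHS]mulrC ler_wpM2l // -mulrA ler_piMr ?(ltW e0) //.
by rewrite mulrC ler_pdivrMr // mul1r lerDl.
Qed.

Lemma line_derive_Re F x h t : differentiable F (x + t%:C *: h) ->
  is_derive t 1 (fun s : R => re (F (x + s%:C *: h))) (re ('d F (x + t%:C *: h) h)).
Proof.
move=> dF; apply: eps_is_derive => e e0.
have [r r0 H] := line_eps h dF e0; exists r => // s /H.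
have -> : x + (t + s)%:C *: h = x + t%:C *: h + s%:C *: h.
  by rewrite rmorphD scalerDl addrA.
move=> Hs.
rewrite -lecR; apply: le_trans Hs; apply: le_trans (norm_Re_le _).
by rewrite !ReD !ReN ReM /= mul0r subr0.
Qed.

Lemma line_derive_Im F x h t : differentiable F (x + t%:C *: h) ->
  is_derive t 1 (fun s : R => im (F (x + s%:C *: h))) (im ('d F (x + t%:C *: h) h)).
Proof.
move=> dF; apply: eps_is_derive => e e0.
have [r r0 H] := line_eps h dF e0; exists r => // s /H.
have -> : x + (t + s)%:C *: h = x + t%:C *: h + s%:C *: h.
  by rewrite rmorphD scalerDl addrA.
move=> Hs.
rewrite -lecR; apply: le_trans Hs; apply: le_trans (norm_Im_le _).
by rewrite !ImD !ImN ImM /= mul0r addr0.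
Qed.

Lemma real_mean_value (f f' : R -> R) (B : R) :
  (forall t, 0 <= t <= 1 -> is_derive t 1 f (f' t) /\ `|f' t| <= B) ->
  `|f 1 - f 0| <= B.
Proof.
move=> H; have [||c c01 ->] := @MVT _ f f' 0 1 ltr01.
- by move=> t; rewrite in_itv /= => /andP[t0 t1]; apply: (H t _).1; rewrite !ltW.
- apply: continuous_in_subspaceT => t /set_mem; rewrite /= in_itv /= => /H[d _].
  by apply/differentiable_continuous/derivable1_diffP; apply: ex_derive.
- rewrite subr0 mulr1; move: c01; rewrite in_itv /= => /andP[c0 c1].
  by apply: (H c _).2; rewrite !ltW.
Qed.

(** The mean value theorem fails for complex values; it is applied to the real and imaginary parts
    of F(x + t h) - t w, hence the factor 2. *)
Lemma mean_value F x h (w : R[i]) (B : R) :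
  (forall t, 0 <= t <= 1 -> differentiable F (x + t%:C *: h) /\
    `|'d F (x + t%:C *: h) h - w| <= B%:C) ->
  `|F (x + h) - F x - w| <= (2 * B)%:C.
Proof.
move=> H; apply: (le_trans (norm_le_ReIm _)); rewrite lecR mulr_natl mulr2n.
have x1 : x + h = x + 1%:C *: h by rewrite scale1r.
have x0 : x = x + 0%:C *: h by rewrite scale0r addr0.
apply: lerD.
- have := @real_mean_value (fun t => re (F (x + t%:C *: h)) - t * re w)
    (fun t => re ('d F (x + t%:C *: h) h) - re w) B.
  rewrite -x0 -x1 mul1r mul0r subr0 !ReD !ReN addrAC; apply => t /H[d1 d2].
  split; last by rewrite -lecR -ReN -ReD (le_trans (norm_Re_le _)).
  have d3 := line_derive_Re d1.
  have d4 : is_derive t 1 (fun s : R => s * re w) (re w).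
    by apply: is_derive_eq; rewrite /GRing.scale /=; ring.
  exact: is_deriveB.
- have := @real_mean_value (fun t => im (F (x + t%:C *: h)) - t * im w)
    (fun t => im ('d F (x + t%:C *: h) h) - im w) B.
  rewrite -x0 -x1 mul1r mul0r subr0 !ImD !ImN addrAC; apply => t /H[d1 d2].
  split; last by rewrite -lecR -ImN -ImD (le_trans (norm_Im_le _)).
  have d3 := line_derive_Im d1.
  have d4 : is_derive t 1 (fun s : R => s * im w) (im w).
    by apply: is_derive_eq; rewrite /GRing.scale /=; ring.
  exact: is_deriveB.
Qed.

Definition cmean (g : R -> R[i]) : R[i] := cint 0 (2 * pi) g / (2 * pi)%:C.

Local Notation cc := (ccont 0 (2 * pi)).

Lemma pi2_gt0 : 0 < 2 * pi :> R. Proof. by rewrite mulr_gt0 // pi_gt0. Qed.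

Lemma cmean_norm (g : R -> R[i]) (B : R) : cc g -> (forall t, `|g t| <= B%:C) ->
  `|cmean g| <= (2 * B)%:C.
Proof.
move=> cg gB; rewrite /cmean normrM normfV norm_realC (gtr0_norm pi2_gt0).
rewrite ler_pdivrMr ?ltcR ?pi2_gt0 // -rmorphM /=.
have := cint_norm (ltW pi2_gt0) cg (fun t _ => gB t).
by rewrite subr0.
Qed.

Lemma cmeanB (g g' : R -> R[i]) : cc g -> cc g' ->
  cmean (fun t => g t - g' t) = cmean g - cmean g'.
Proof. by move=> cg cg'; rewrite /cmean (cintB cg cg') mulrBl. Qed.

Lemma cmeanD (g g' : R -> R[i]) : cc g -> cc g' ->
  cmean (fun t => g t + g' t) = cmean g + cmean g'.
Proof. by move=> cg cg'; rewrite /cmean (cintD cg cg') mulrDl. Qed.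

Lemma cmeanZ (c : R[i]) (g : R -> R[i]) : cc g ->
  cmean (fun t => c * g t) = c * cmean g.
Proof. by move=> cg; rewrite /cmean (cintZ c cg) mulrA. Qed.

Lemma eq_cmean (g g' : R -> R[i]) : g =1 g' -> cmean g = cmean g'.
Proof. by move=> /funext ->. Qed.

Lemma circle_continuous F x v : (forall z : R[i], `|z| <= 1 -> {for x + z *: v, continuous F}) ->
  cc (fun t => (F (x + expi t *: v) - F x) / expi t).
Proof.
move=> dF t _; apply: cvgM; last first.
  by apply: cvgV; [exact: expi_neq0|exact: expi_continuous].
apply: cvgB; last exact: cvg_cst.
have h1 : {for t, continuous (fun t => x + expi t *: v)}.
  by apply: cvgD; [exact: cvg_cst|apply: cvgZr_tmp; exact: expi_continuous].
apply: (@continuous_comp _ _ _ (fun t => x + expi t *: v) F t h1).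
by apply: dF; rewrite norm_expi.
Qed.

(** [circle_mean] for the difference quotient in z, extended by the derivative at z = 0. The unit
    circle is general enough because [v] carries the radius. *)
Lemma cauchy_derivative F x v :
  (forall z : R[i], `|z| <= 1 -> differentiable F (x + z *: v)) ->
  'd F x v = cmean (fun t => (F (x + expi t *: v) - F x) / expi t).
Proof.
move=> dF.
have dFx : differentiable F x by have := dF 0; rewrite scale0r addr0 normr0 ler01; apply.
pose g (z : R[i]) : R[i] := if z == 0 then 'd F x v else (F (x + z *: v) - F x) / z.
have dline (z : R[i]) : differentiable (fun z : R[i] => x + z *: v) z.
  apply: differentiableD; first exact: differentiable_cst.
  by apply: (@differentiableZl _ _ _ (fun z : R[i] => z) v); exact: ex_diff.
have dg (z : R[i]) : z != 0 -> `|z| <= 1 -> differentiable g z.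
  move=> z0 z1; apply: (@near_differentiable _ _ _ (fun z : R[i] => (F (x + z *: v) - F x) / z : R[i])).
    have zp : 0 < `|z| by rewrite normr_gt0.
    apply/nbhs_ballP; exists `|z| => // w; rewrite -ball_normE /= => wz.
    rewrite /g; case: eqP => // w0; move: wz; by rewrite w0 subr0 ltxx.
  apply: differentiableM; last first.
    by apply: differentiableV => //; exact: ex_diff.
  apply: differentiableB; last exact: differentiable_cst.
  by apply: (@differentiable_comp _ _ _ _ (fun z : R[i] => x + z *: v) F) => //; exact: dF.
have cg : {for 0, continuous g}.
  apply: eps_cont => _ /gt0_realC[e e0 ->].
  have v0 : 0 <= re `|v| by rewrite -ler0c -normV_re.
  have q0 : 0 < re `|v| + 1 by rewrite ltr_wpDl.
  have e1 : 0 < (e / (re `|v| + 1))%:C :> R[i] by rewrite ltcR divr_gt0.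
  have [_ /gt0_realC[r r0 ->] H] := diff_eps dFx e1.
  exists (r / (re `|v| + 1))%:C; first by rewrite ltcR divr_gt0.
  move=> z zr; rewrite add0r {2}/g eqxx /g; case: eqVneq => [_|z0].
    by rewrite subrr normr0 ltcR.
  have zp : 0 < `|z| by rewrite normr_gt0.
  have vq : `|v| < (re `|v| + 1)%:C by rewrite {1}normV_re ltcR ltrDl.
  have /H : `|z *: v| < r%:C.
    rewrite normrZ (_ : r%:C = (r / (re `|v| + 1))%:C * (re `|v| + 1)%:C); last first.
      by rewrite -rmorphM /= divfK // gt_eqF.
    by rewrite ltr_pM.
  rewrite linearZ /= => Hz.
  rewrite -(ltr_pM2l zp) -normrM mulrBr mulrCA mulfV // mulr1.
  apply: (le_lt_trans Hz); rewrite normrZ mulrCA ltr_pM2l //.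
  rewrite [ltRHS](_ : _ = (e / (re `|v| + 1))%:C * (re `|v| + 1)%:C).
    by rewrite ltr_pM2l.
  by rewrite -rmorphM /= divfK // gt_eqF.
have := @circle_mean R g 1 ltr01 dg cg.
rewrite {2}/g eqxx => H; rewrite /cmean.
have p0 : (2 * pi)%:C != 0 :> R[i] by rewrite gt_eqF // ltcR pi2_gt0.
rewrite -[LHS](mulfK p0) -H; congr (_ / _); apply: eq_cint => t _.
by rewrite mul1r /g (negPf (expi_neq0 _)).
Qed.

End HolomorphicDerivative.

(** * Derivatives of holomorphic functions *)

Lemma diffZ_app (K : numFieldType) (V W : normedModType K) (f : V -> W) (s : K) x h :
  differentiable f x -> 'd (fun y => s *: f y) x h = s *: 'd f x h.
Proof. by move=> df; rewrite -[fun y => _]/(s *: f) diffZ. Qed.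

Section LocalEstimates.
Variables (R : realType) (V : normedModType R[i]).
Implicit Types (x y v h : V).

Lemma linearZC (L : {linear V -> R[i]}) (a : R[i]) v : L (a *: v) = a * L v.
Proof. exact: linearZ. Qed.

(** Scaling [v] to length d / 2, strictly inside the ball where the bound is known, produces the
    factor 2. *)
Lemma linear_bound (L : V -> R[i]) (d B : R) : 0 < d ->
  (forall a v, L (a *: v) = a * L v) ->
  (forall v, `|v| < d%:C -> `|L v| <= B%:C) ->
  forall v, `|L v| <= (2 * B / d)%:C * `|v|.
Proof.
move=> d0 LZ LB v; have [->|v0] := eqVneq v 0.
  by have := LZ 0 0; rewrite scale0r mul0r => ->; rewrite !normr0 mulr0.
have : 0 < `|v| by rewrite normr_gt0.
rewrite normV_re; set n := re `|v| => n0'; have n0 : 0 < n by rewrite -ltcR.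
pose s := d / (2 * n).
have s0 : 0 < s by rewrite divr_gt0 // mulr_gt0.
have := LB (s%:C *: v); rewrite norm_realZ gtr0_norm // normV_re -/n -rmorphM /= ltcR.
have -> : s * n = d / 2 by rewrite /s; field; rewrite gt_eqF.
rewrite ltr_pdivrMr // ltr_pMr // ltr1n => /(_ isT).
rewrite LZ normrM norm_realC (gtr0_norm s0) => H.
have s0' : 0 < s%:C :> R[i] by rewrite ltcR.
rewrite -(ler_pM2l s0'); apply: (le_trans H); rewrite -!rmorphM lecR /=.
rewrite (_ : s * _ = B) // /s; field.
by rewrite !gt_eqF.
Qed.

Variables (F : V -> R[i]) (x0 : V) (d M : R).
Hypothesis d0 : 0 < d.
Hypothesis FU : forall y, `|y - x0| < (4 * d)%:C -> differentiable F y.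
Hypothesis FM : forall y, `|y - x0| < (4 * d)%:C -> `|F y| <= M%:C.

Lemma near_add y h (a b : R) : `|y - x0| < a%:C -> `|h| < b%:C ->
  `|y + h - x0| < (a + b)%:C.
Proof.
move=> ya hb; rewrite addrAC rmorphD.
by apply: (le_lt_trans (ler_normD _ _)); exact: ltrD.
Qed.

Lemma near_le y (a b : R) : a <= b -> `|y - x0| < a%:C -> `|y - x0| < b%:C.
Proof. by move=> ab /lt_le_trans; apply; rewrite lecR. Qed.

Lemma norm_seg (z : R[i]) v (e : R) : `|z| <= 1 -> `|v| < e%:C -> `|z *: v| < e%:C.
Proof.
move=> z1; apply: le_lt_trans; rewrite normrZ -[leRHS]mul1r.
by rewrite ler_wpM2r.
Qed.

Lemma norm_seg_real (t : R) : 0 <= t <= 1 -> `|t%:C : R[i]| <= 1.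
Proof. by move=> /andP[t0 t1]; rewrite norm_realC lecR ger0_norm. Qed.

(** Each estimate gives up a distance [d]: from the bound M on the ball of radius 4d come a bound of
    the derivative on radius 3d, a Lipschitz bound of [F] on 2d and one of the derivative on d. In
    [K1] and [K2] one factor 2 comes from [cmean_norm] and one from [linear_bound]. *)
Definition K1 := 2 * (2 * (M + M)) / d.

Lemma M_ge0 : 0 <= M.
Proof.
have : `|F x0| <= M%:C by apply: FM; rewrite subrr normr0 ltcR mulr_gt0.
by move=> /(le_trans (normr_ge0 _)); rewrite ler0c.
Qed.

Lemma K1_ge0 : 0 <= K1.
Proof. by rewrite divr_ge0 ?(ltW d0) // !mulr_ge0 // addr_ge0 // M_ge0. Qed.

Lemma diff_bound y v : `|y - x0| < (3 * d)%:C -> `|'d F y v| <= K1%:C * `|v|.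
Proof.
move=> yd; apply: (@linear_bound ('d F y) d (2 * (M + M))) => //.
  by move=> a w; rewrite linearZ.
move=> w wd.
have near z : `|z| <= 1 -> `|y + z *: w - x0| < (4 * d)%:C.
  move=> z1; apply: (@near_le _ (3 * d + d)); first by move: d0; lra.
  by apply: near_add => //; exact: norm_seg.
rewrite cauchy_derivative; last by move=> z /near; exact: FU.
apply: cmean_norm.
  by apply: circle_continuous => z /near/FU; exact: differentiable_continuous.
move=> t; rewrite normrM normfV norm_expi invr1 mulr1 rmorphD.
apply: (le_trans (ler_normB _ _)); apply: lerD; apply: FM.
  by apply: near; rewrite norm_expi.
by have := near 0; rewrite scale0r addr0 normr0 ler01; apply.
Qed.

Lemma lipschitz_bound y h : `|y - x0| < (2 * d)%:C -> `|h| < d%:C ->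
  `|F (y + h) - F y| <= (2 * (K1 * re `|h|))%:C.
Proof.
move=> yd hd; rewrite -[F _ - F _]subr0; apply: mean_value => t t01.
have nt : `|y + t%:C *: h - x0| < (3 * d)%:C.
  apply: (@near_le _ (2 * d + d)); first by move: d0; lra.
  by apply: near_add => //; apply: norm_seg => //; exact: norm_seg_real.
split; first by apply: FU; apply: near_le nt; move: d0; lra.
by rewrite subr0 rmorphM /= -normV_re; exact: diff_bound.
Qed.

Definition K2 := 2 * (2 * (4 * K1)) / d.

Lemma K2_ge0 : 0 <= K2.
Proof. by rewrite /K2 divr_ge0 ?(ltW d0) // mulr_ge0 // mulr_ge0 // mulr_ge0 // K1_ge0. Qed.

(** Cauchy's formula at y + h and at y, on circles with the same direction: regrouped, the
    integrands differ by two increments of [F] along [h], to which [lipschitz_bound] applies. *)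
Lemma diff_lipschitz y h v : `|y - x0| < d%:C -> `|h| < d%:C ->
  `|'d F (y + h) v - 'd F y v| <= (K2 * re `|h|)%:C * `|v|.
Proof.
move=> yd hd.
have h0 : 0 <= re `|h| by rewrite -ler0c -normV_re.
have -> : K2 * re `|h| = 2 * (2 * (4 * K1 * re `|h|)) / d by rewrite /K2; ring.
apply: (@linear_bound (fun v => 'd F (y + h) v - 'd F y v)) => //.
  by move=> a w; rewrite !linearZC mulrBr.
move=> w wd.
have near z : `|z| <= 1 -> `|y + z *: w - x0| < (2 * d)%:C.
  move=> z1; apply: (@near_le _ (d + d)); first by move: d0; lra.
  by apply: near_add => //; exact: norm_seg.
have nearh z : `|z| <= 1 -> `|y + h + z *: w - x0| < (4 * d)%:C.
  move=> z1; apply: (@near_le _ (d + d + d)); first by move: d0; lra.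
  by apply: near_add; [exact: near_add|exact: norm_seg].
have near4 z : `|z| <= 1 -> `|y + z *: w - x0| < (4 * d)%:C.
  by move=> /near; apply: near_le; move: d0; lra.
rewrite (cauchy_derivative (x := y + h)); last by move=> z /nearh/FU.
rewrite cauchy_derivative; last by move=> z /near4/FU.
have c1 : ccont 0 (2 * pi) (fun t => (F (y + h + expi t *: w) - F (y + h)) / expi t).
  by apply: circle_continuous => z /nearh/FU; exact: differentiable_continuous.
have c2 : ccont 0 (2 * pi) (fun t => (F (y + expi t *: w) - F y) / expi t).
  by apply: circle_continuous => z /near4/FU; exact: differentiable_continuous.
rewrite -(cmeanB c1 c2); apply: (cmean_norm (ccontD c1 (ccontN c2))) => t /=.
rewrite -mulrBl normrM normfV norm_expi invr1 mulr1.
rewrite opprB addrA addrAC -addrA.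
have -> : 4 * K1 * re `|h| = 2 * (K1 * re `|h|) + 2 * (K1 * re `|h|) by ring.
rewrite (_ : _ - _ + _ = (F (y + expi t *: w + h) - F (y + expi t *: w)) -
   (F (y + h) - F y)); last by rewrite [y + h + _]addrAC; ring.
rewrite rmorphD; apply: (le_trans (ler_normB _ _)); apply: lerD.
  by apply: lipschitz_bound => //; apply: near; rewrite norm_expi.
by apply: lipschitz_bound => //; apply: near_le yd; move: d0; lra.
Qed.

Lemma taylor_bound y h : `|y - x0| < d%:C -> `|h| < d%:C ->
  `|F (y + h) - F y - 'd F y h| <= (2 * (K2 * re `|h| ^+ 2))%:C.
Proof.
move=> yd hd; have h0 : 0 <= re `|h| by rewrite -ler0c -normV_re.
apply: mean_value => t t01.
have t1 := norm_seg_real t01.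
have th := norm_seg t1 hd.
split; first by apply: FU; apply: (@near_le _ (d + d)); [move: d0; lra|exact: near_add].
apply: (le_trans (diff_lipschitz _ yd th)).
rewrite [`|h|]normV_re -rmorphM lecR /= expr2 mulrA ler_wpM2r // ler_wpM2l ?K2_ge0 //.
rewrite -lecR -!normV_re normrZ -[leRHS]mul1r; by rewrite ler_wpM2r.
Qed.

Lemma diff_continuous_base y v : `|y - x0| < d%:C ->
  {for y, continuous (fun y => 'd F y v)}.
Proof.
move=> yd; apply: eps_cont => _ /gt0_realC[e e0 ->].
have v0 : 0 <= re `|v| by rewrite -ler0c -normV_re.
have q0 : 0 < K2 * re `|v| + 1 by rewrite ltr_wpDl // mulr_ge0 // K2_ge0.
exists (Num.min d (e / (K2 * re `|v| + 1)))%:C.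
  by rewrite ltcR lt_min d0 divr_gt0.
move=> h; rewrite [`|h|]normV_re ltcR lt_min => /andP[hd he].
have h0 : 0 <= re `|h| by rewrite -ler0c -normV_re.
have hd' : `|h| < d%:C by rewrite normV_re ltcR.
apply: (le_lt_trans (diff_lipschitz _ yd hd')).
rewrite [`|v|]normV_re -rmorphM ltcR /=.
move: he; rewrite ltr_pdivlMr //; apply: le_lt_trans.
have -> : K2 * re `|h| * re `|v| = re `|h| * (K2 * re `|v|) by ring.
by rewrite mulrDr mulr1 lerDl.
Qed.

(** Differentiation under the integral in Cauchy's formula. The error is the mean of differences of
    two Taylor remainders, at x0 + e^(it) v and at x0, and is quadratic in [h] by [taylor_bound]. *)
Lemma diff_differentiable_small v : `|v| < (d / 2)%:C ->
  differentiable (fun y => 'd F y v) x0 /\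
  forall h, 'd (fun y => 'd F y v) x0 h =
    cmean (fun t => ('d F (x0 + expi t *: v) h - 'd F x0 h) / expi t).
Proof.
move=> vd.
have x0d (e : R) : 0 < e -> `|x0 - x0| < e%:C by rewrite subrr normr0 ltcR.
have vdd : `|v| < d%:C by apply: lt_trans vd _; rewrite ltcR; move: d0; lra.
have near z : `|z| <= 1 -> `|x0 + z *: v - x0| < d%:C.
  move=> z1; apply: (@near_le _ (d/2 + d/2)); first by move: d0; lra.
  by apply: near_add; [apply: x0d; move: d0; lra|exact: norm_seg].
have dc h : ccont 0 (2 * pi) (fun t => ('d F (x0 + expi t *: v) h - 'd F x0 h) / expi t).
  by apply: (@circle_continuous _ _ (fun y => 'd F y h)) => z /near; exact: diff_continuous_base.
pose L h := cmean (fun t => ('d F (x0 + expi t *: v) h - 'd F x0 h) / expi t).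
have linL : linear L.
  move=> a u w; rewrite /L -[a *: cmean _]cmeanZ // -cmeanD //; last first.
    by apply: ccontM => //; exact: ccont_cst.
  by apply: eq_cmean => t; rewrite !linearP /= /GRing.scale /=; ring.
pose L0 := GRing.isLinear.Build _ _ _ _ _ linL.
pose LL : {linear V -> R[i]} := HB.pack L L0.
have cL : continuous LL.
  apply/linear_bounded_continuous; apply/linear_boundedP.
  near=> r; move=> h; rewrite /= /L.
  have h0 : 0 <= re `|h| by rewrite -ler0c -normV_re.
  have : `|cmean (fun t => ('d F (x0 + expi t *: v) h - 'd F x0 h) / expi t)| <=
     (2 * (K2 * re `|v| * re `|h|))%:C.
    apply: cmean_norm => // t; rewrite normrM normfV norm_expi invr1 mulr1.
    have := @diff_lipschitz x0 (expi t *: v) h (x0d _ d0).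
    rewrite normrZ norm_expi mul1r => /(_ vdd) /le_trans; apply.
    by rewrite [`|h|]normV_re -rmorphM.
  move=> /le_trans; apply; rewrite [`|h|]normV_re /=.
  rewrite (_ : 2 * _ = (2 * (K2 * re `|v|)) * re `|h|); last by ring.
  rewrite rmorphM /= ler_wpM2r ?ler0c //.
  near: r; apply: nbhs_pinfty_ge; rewrite ger0_real // ler0c.
  by rewrite mulr_ge0 // mulr_ge0 ?K2_ge0 // -ler0c -normV_re.
suff H : forall e : R[i], 0 < e -> exists2 r : R[i], 0 < r & forall h, `|h| < r ->
    `|'d F (x0 + h) v - 'd F x0 v - LL h| <= e * `|h|.
  have [df dE] := @diff_intro _ _ _ (fun y => 'd F y v) x0 LL cL H.
  by split; [exact: df|move=> h; exact: (congr1 (fun g : V -> R[i] => g h) dE)].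
move=> _ /gt0_realC[e e0 ->].
have q0 : 0 < 8 * K2 + 1 by rewrite ltr_wpDl // mulr_ge0 // K2_ge0.
exists (Num.min d (e / (8 * K2 + 1)))%:C; first by rewrite ltcR lt_min d0 divr_gt0.
move=> h; rewrite [`|h|]normV_re ltcR lt_min => /andP[hd he].
have h0 : 0 <= re `|h| by rewrite -ler0c -normV_re.
have hd' : `|h| < d%:C by rewrite normV_re ltcR.
have nearh z : `|z| <= 1 -> `|x0 + h + z *: v - x0| < (4 * d)%:C.
  move=> z1; apply: (@near_le _ (d + d + d)); first by move: d0; lra.
  by apply: near_add; [apply: near_add => //; exact: x0d|exact: norm_seg].
have near4 z : `|z| <= 1 -> `|x0 + z *: v - x0| < (4 * d)%:C.
  by move=> /near; apply: near_le; move: d0; lra.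
have c1 : ccont 0 (2 * pi) (fun t => (F (x0 + h + expi t *: v) - F (x0 + h)) / expi t).
  by apply: circle_continuous => z /nearh/FU; exact: differentiable_continuous.
have c2 : ccont 0 (2 * pi) (fun t => (F (x0 + expi t *: v) - F x0) / expi t).
  by apply: circle_continuous => z /near4/FU; exact: differentiable_continuous.
rewrite (cauchy_derivative (x := x0 + h)); last by move=> z /nearh/FU.
rewrite cauchy_derivative; last by move=> z /near4/FU.
rewrite -[LL h]/(L h) /L.
rewrite -(cmeanB c1 c2) -(cmeanB (ccontD c1 (ccontN c2)) (dc h)).
apply: (@le_trans _ _ (2 * (4 * K2 * re `|h| ^+ 2))%:C).
  apply: (cmean_norm (ccontD (ccontD c1 (ccontN c2)) (ccontN (dc h)))) => t /=.
  rewrite -!mulrBl normrM normfV norm_expi invr1 mulr1.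
  have -> : 4 * K2 * re `|h| ^+ 2 = 2 * (K2 * re `|h| ^+ 2) + 2 * (K2 * re `|h| ^+ 2) by ring.
  have E : F (x0 + h + expi t *: v) - F (x0 + h) - (F (x0 + expi t *: v) - F x0) -
    ('d F (x0 + expi t *: v) h - 'd F x0 h) =
    (F (x0 + expi t *: v + h) - F (x0 + expi t *: v) - 'd F (x0 + expi t *: v) h) -
    (F (x0 + h) - F x0 - 'd F x0 h) by rewrite [x0 + h + _]addrAC; ring.
  rewrite E rmorphD; apply: (le_trans (ler_normB _ _)); apply: lerD; apply: taylor_bound => //.
    by apply: near; rewrite norm_expi.
  exact: x0d.
rewrite (_ : 2 * _ = 8 * K2 * re `|h| * re `|h|); last by ring.
rewrite -rmorphM lecR /= ler_wpM2r //.
move: he; rewrite ltr_pdivlMr // => he; move: h0; lra.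
Unshelve. all: by end_near. Qed.

End LocalEstimates.

Section HolomorphicSmooth.
Variables (R : realType) (V : normedModType R[i]).
Implicit Types (F : V -> R[i]) (U : set V).

(** Continuity makes [F] bounded near [x], and the scalar [s] shrinks [v] until the local estimates
    apply; homogeneity removes [s] afterwards. *)
Lemma holomorphic_second F U x v : open U ->
  (forall y, U y -> differentiable F y) -> U x -> exists s : R[i],
  [/\ s != 0, forall z : R[i], `|z| <= 1 -> U (x + z *: (s *: v)),
    differentiable (fun y => 'd F y (s *: v)) x &
    forall h, 'd (fun y => 'd F y (s *: v)) x h =
      cmean (fun t => ('d F (x + expi t *: (s *: v)) h - 'd F x h) / expi t)].
Proof.
move=> oU dF Ux.
have [_ /gt0_realC[e1 e10 ->] H1] : exists2 e : R[i], 0 < e & ball x e `<=` U.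
  by have /nbhs_ballP[e /= e0 He] := open_nbhs_nbhs (conj oU Ux); exists e.
have [_ /gt0_realC[e2 e20 ->] H2] := cont_eps (differentiable_continuous (dF _ Ux)) ltr01.
pose d := Num.min e1 e2 / 4; have d0 : 0 < d by rewrite divr_gt0 // lt_min e10.
have d4 : 4 * d = Num.min e1 e2 by rewrite /d; field.
have FU y : `|y - x| < (4 * d)%:C -> differentiable F y.
  rewrite d4 => yd; apply/dF/H1; rewrite -ball_normE /= distrC.
  by apply: (lt_le_trans yd); rewrite lecR ge_min lexx.
have FM y : `|y - x| < (4 * d)%:C -> `|F y| <= (re `|F x| + 1)%:C.
  rewrite d4 => yd; have := H2 (y - x); rewrite [x + _]addrC subrK => H.
  have -> : (re `|F x| + 1)%:C = 1 + `|F x|.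
    by rewrite -{2}normC_Re; apply: eqCP; rewrite ?ReD ?ImD /=; ring.
  rewrite -[F y](subrK (F x)) (le_trans (ler_normD _ _)) // lerD //.
  by rewrite ltW // H // (lt_le_trans yd) // lecR ge_min lexx orbT.
pose s := d / (4 * (re `|v| + 1)).
have v0 : 0 <= re `|v| by rewrite -ler0c -normV_re.
have q0 : 0 < re `|v| + 1 by rewrite ltr_wpDl.
have s0 : 0 < s by rewrite divr_gt0 // mulr_gt0.
have sv : `|s%:C *: v| < (d / 2)%:C.
  rewrite norm_realZ gtr0_norm // [`|v|]normV_re -rmorphM ltcR /=.
  have -> : s * re `|v| = d / 4 * (re `|v| / (re `|v| + 1)).
    by rewrite /s; field; rewrite gt_eqF.
  apply: (@le_lt_trans _ _ (d / 4)); last by lra.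
  apply: ler_piMr; first by rewrite divr_ge0 // ltW.
  by rewrite ler_pdivrMr // mul1r lerDl.
have s0' : s%:C != 0 :> R[i] by rewrite gt_eqF // ltcR.
have [h1 h2] := diff_differentiable_small d0 FU FM sv.
exists s%:C; split => // z z1; apply: H1.
rewrite -ball_normE /= opprD addrA subrr sub0r normrN.
have := norm_seg z1 sv; move/lt_le_trans; apply.
rewrite lecR; apply: (@le_trans _ _ (Num.min e1 e2)); last by rewrite ge_min lexx.
rewrite -d4; lra.
Qed.

Lemma holomorphic_derivative F U x v : open U ->
  (forall y, U y -> differentiable F y) -> U x ->
  differentiable (fun y => 'd F y v) x.
Proof.
move=> oU dF Ux; have [s [s0 _ ds _]] := holomorphic_second v oU dF Ux.
rewrite (_ : (fun y => _) = (fun y => s^-1 * 'd F y (s *: v))); last first.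
  by apply/funext => y; rewrite linearZC mulKf.
apply: differentiableM; first exact: differentiable_cst.
exact: ds.
Qed.

(** The mean obtained by differentiating Cauchy's formula along [h] is itself Cauchy's formula, in
    the direction [v], for the holomorphic function that gives the derivative along [h]. *)
Lemma holomorphic_derivative_sym F U x v h : open U ->
  (forall y, U y -> differentiable F y) -> U x ->
  'd (fun y => 'd F y v) x h = 'd (fun y => 'd F y h) x v.
Proof.
move=> oU dF Ux; have [s [s0 sU ds sE]] := holomorphic_second v oU dF Ux.
apply: (mulfI s0); rewrite -[RHS]linearZC.
have e : 'd (fun y => 'd F y h) x (s *: v) =
    cmean (fun t => ('d F (x + expi t *: (s *: v)) h - 'd F x h) / expi t).
  by apply: (@cauchy_derivative _ _ (fun y => 'd F y h)) => z /sU; exact: holomorphic_derivative oU dF.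
apply: (etrans _ (esym e)); apply: (etrans _ (sE h)).
have dv := holomorphic_derivative v oU dF Ux.
rewrite (_ : (fun y => 'd F y (s *: v)) = (fun y => s *: ('d F y v : R[i]^o))); last first.
  by apply/funext => y; rewrite linearZC.
exact: (esym (diffZ_app s h dv)).
Qed.

End HolomorphicSmooth.

(** * Real differentiability *)

Lemma near_continuous (T W : topologicalType) (U : set T) (f g : T -> W) x :
  open U -> U x -> (forall y, U y -> f y = g y) ->
  {for x, continuous f} -> {for x, continuous g}.
Proof.
move=> oU Ux fg fc; rewrite /prop_for /continuous_at -(fg x Ux).
apply: cvg_trans fc; apply: near_eq_cvg.
by have := open_nbhs_nbhs (conj oU Ux); apply: filterS => y /fg ->.
Qed.

Section RealCalculus.
Variables (R : realType) (n : nat).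
Local Notation V := 'rV[R[i]]_n.
Implicit Types (f g : V -> R[i]) (U W : set V) (x v : V) (c d : R[i]).

(** Existence and value of the derivative in one relation, which composes under algebraic
    operations; [rderiv] alone is a total function. *)
Definition has_rderiv f v x c := forall e : R, 0 < e ->
  exists2 r : R, 0 < r & forall t, `|t| < r ->
    `|f (x + t%:C *: v) - f x - t%:C * c| <= (e * `|t|)%:C.

Lemma rline0 x v : x + 0%:C *: v = x.
Proof. by rewrite scale0r addr0. Qed.

Lemma has_rderiv_is_derive f v x c : has_rderiv f v x c ->
  is_derive (0 : R) 1 (fun t => re (rline f v x t)) (re c) /\
  is_derive (0 : R) 1 (fun t => im (rline f v x t)) (im c).
Proof.
move=> H; split; apply: eps_is_derive => e e0; have [r r0 Hr] := H e e0;
  exists r => // t /Hr Ht; rewrite add0r /rline rline0 -lecR; apply: le_trans Ht.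
  apply: le_trans (norm_Re_le _).
  by rewrite !ReD !ReN ReM /= mul0r subr0.
apply: le_trans (norm_Im_le _).
by rewrite !ImD !ImN ImM /= mul0r addr0.
Qed.

Lemma has_rderivP f v x c : has_rderiv f v x c ->
  rderivable f v x /\ rderiv f v x = c.
Proof.
move=> /has_rderiv_is_derive[h1 h2]; split; first by split; apply: ex_derive.
by apply: eqCP; rewrite /rderiv /= derive1E derive_val.
Qed.

Lemma rderivable_has f v x : rderivable f v x ->
  has_rderiv f v x (rderiv f v x).
Proof.
move=> [d1 d2] e e0; have e2 : 0 < e / 2 by rewrite divr_gt0.
have i1 : is_derive (0 : R) 1 (fun t => re (rline f v x t)) (re (rderiv f v x)).
  exact: (DeriveDef d1 (esym (derive1E _ _))).
have i2 : is_derive (0 : R) 1 (fun t => im (rline f v x t)) (im (rderiv f v x)).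
  exact: (DeriveDef d2 (esym (derive1E _ _))).
have [r1 r10 H1] := real_deriv_eps i1 e2; have [r2 r20 H2] := real_deriv_eps i2 e2.
exists (Num.min r1 r2); first by rewrite lt_min r10.
move=> t; rewrite lt_min => /andP[/H1 h1 /H2 h2].
apply: (le_trans (norm_le_ReIm _)); rewrite lecR.
have -> : e * `|t| = e / 2 * `|t| + e / 2 * `|t| by field.
apply: lerD.
  apply: le_trans h1; rewrite add0r /rline rline0.
  by rewrite !ReD !ReN ReM /= mul0r subr0 mulrC.
apply: le_trans h2; rewrite add0r /rline rline0.
by rewrite !ImD !ImN ImM /= mul0r addr0 mulrC.
Qed.

Lemma is_derive_has f v x c :
  is_derive (0 : R) 1 (fun t => re (rline f v x t)) (re c) ->
  is_derive (0 : R) 1 (fun t => im (rline f v x t)) (im c) ->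
  has_rderiv f v x c.
Proof.
move=> h1 h2; have <- : rderiv f v x = c.
  by apply: eqCP; rewrite /rderiv /= derive1E derive_val.
by apply: rderivable_has; split; apply: ex_derive.
Qed.

Lemma has_rderiv_cst v x c : has_rderiv (fun=> c) v x 0.
Proof.
move=> e e0; exists 1 => // t _; rewrite subrr mulr0 subr0 normr0 ler0c.
by rewrite mulr_ge0 // ltW.
Qed.

Lemma has_rderivD f g v x c d : has_rderiv f v x c -> has_rderiv g v x d ->
  has_rderiv (fun y => f y + g y) v x (c + d).
Proof.
move=> /has_rderiv_is_derive[a1 a2] /has_rderiv_is_derive[b1 b2].
apply: is_derive_has; rewrite /rline.
  by under eq_fun do rewrite ReD; rewrite ReD; exact: is_deriveD.
by under eq_fun do rewrite ImD; rewrite ImD; exact: is_deriveD.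
Qed.

Lemma has_rderivM f g v x c d : has_rderiv f v x c -> has_rderiv g v x d ->
  has_rderiv (fun y => f y * g y) v x (c * g x + f x * d).
Proof.
move=> /has_rderiv_is_derive[a1 a2] /has_rderiv_is_derive[b1 b2].
have ex h : rline h v x 0 = h x by rewrite /rline rline0.
apply: is_derive_has.
  have -> : (fun t => re (rline (fun y => f y * g y) v x t)) = (fun t =>
    re (rline f v x t) * re (rline g v x t) - im (rline f v x t) * im (rline g v x t)).
    by apply/funext => t; rewrite /rline ReM.
  by apply: is_derive_eq; rewrite !ex /GRing.scale /= !(ReD, ReM); ring.
have -> : (fun t => im (rline (fun y => f y * g y) v x t)) = (fun t =>
  re (rline f v x t) * im (rline g v x t) + im (rline f v x t) * re (rline g v x t)).
  by apply/funext => t; rewrite /rline ImM.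
by apply: is_derive_eq; rewrite !ex /GRing.scale /= !(ImD, ImM); ring.
Qed.

Lemma has_rderiv_conj f v x c : has_rderiv f v x c ->
  has_rderiv (fun y => (f y)^*) v x c^*.
Proof.
move=> H e e0; have [r r0 Hr] := H e e0; exists r => // t /Hr.
rewrite -normcJ !rmorphB rmorphM /= /conjc /= oppr0; exact.
Qed.

(* [powR] is used at positive reals only, where it is the real power. *)
Lemma has_rderiv_powR f v x c (a : R) : 0 < re (f x) -> has_rderiv f v x c ->
  has_rderiv (fun y => (re (f y) `^ a)%:C) v x
    (a%:C * (re (f x) `^ (a - 1))%:C * (re c)%:C).
Proof.
move=> f0 /has_rderiv_is_derive[h1 _]; apply: is_derive_has; last first.
  rewrite -!rmorphM /=; exact: is_derive_cst.
rewrite -!rmorphM /= /rline /=.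
have f0' : 0 < re (rline f v x 0) by rewrite /rline rline0.
have h2 := is_derive1_powR a f0'.
have h3 := is_derive1_comp h2 h1.
by apply: (is_derive_eq h3); rewrite /rline rline0.
Qed.

Lemma has_rderiv_near f g U v x c : open U -> U x -> (forall y, U y -> f y = g y) ->
  has_rderiv f v x c -> has_rderiv g v x c.
Proof.
move=> oU Ux fg H e e0; have [r r0 Hr] := H e e0.
have /nbhs_ballP[_ /= /gt0_realC[d d0 ->] Hd] := open_nbhs_nbhs (conj oU Ux).
have q0 : 0 < re `|v| + 1 by rewrite ltr_wpDl // -ler0c -normV_re.
exists (Num.min r (d / (re `|v| + 1))); first by rewrite lt_min r0 divr_gt0.
move=> t; rewrite lt_min ltr_pdivlMr // => /andP[tr td].
rewrite -!fg //; first exact: Hr.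
apply: Hd; rewrite -ball_normE /= opprD addrA subrr sub0r normrN norm_realZ.
rewrite [`|v|]normV_re -rmorphM ltcR /=; apply: le_lt_trans td.
by rewrite ler_wpM2l // lerDl.
Qed.

Lemma cC_mon k U f : class_C k.+1 U f -> class_C k U f.
Proof.
elim: k f => [|k IH] f [fc fd]; split => // v; have [d1 d2] := fd v.
by split => //; exact: IH.
Qed.

Lemma cCS k U W f : W `<=` U -> class_C k U f -> class_C k W f.
Proof.
move=> WU; elim: k f => [|k IH] f [fc fd]; first by split=> // x /WU; exact: fc.
split=> [x /WU|v]; first exact: fc.
by have [d1 d2] := fd v; split=> [x /WU/d1 //|]; exact: IH.
Qed.

(** Pulled back metrics and the blended dual form have a single smooth formula only near each
    point. *)
Lemma cC_local k U f :
  (forall x, U x -> exists W, [/\ open W, W x & class_C k W f]) -> class_C k U f.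
Proof.
elim: k f => [|k IH] f H.
  by split=> // x /H[W [_ Wx [fc _]]]; exact: fc.
split=> [x /H[W [_ Wx [fc _]]]|v]; first exact: fc.
split=> [x /H[W [_ Wx [_ fd]]]|]; first exact: (fd v).1.
by apply: IH => x /H[W [oW Wx [_ fd]]]; exists W; split => //; exact: (fd v).2.
Qed.

Lemma eq_cC k U f g : open U -> (forall y, U y -> f y = g y) ->
  class_C k U f -> class_C k U g.
Proof.
move=> oU; elim: k f g => [|k IH] f g fg [fc fd].
  by split=> [x Ux|]; [exact: (near_continuous oU Ux fg (fc x Ux))|].
split=> [x Ux|v]; first exact: (near_continuous oU Ux fg (fc x Ux)).
have [d1 d2] := fd v.
have H x : U x -> has_rderiv g v x (rderiv f v x).
  by move=> Ux; apply: (has_rderiv_near oU Ux fg); apply: rderivable_has; exact: d1.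
split=> [x /H/has_rderivP[]//|]; apply: IH d2 => x /H/has_rderivP[_ ->//].
Qed.

Lemma cC_intro k U f (D : V -> V -> R[i]) : open U ->
  (forall x, U x -> {for x, continuous f}) ->
  (forall v x, U x -> has_rderiv f v x (D v x)) ->
  (forall v, class_C k U (D v)) -> class_C k.+1 U f.
Proof.
move=> oU fc fd Dc; split=> // v; split=> [x /(fd v)/has_rderivP[]//|].
by apply: eq_cC (Dc v) => // x /(fd v)/has_rderivP[_ ->].
Qed.

Lemma cC_cont k U f x : class_C k U f -> U x -> {for x, continuous f}.
Proof. by case: k => [|k] [fc _] /fc. Qed.

Lemma cC_has k U f v x : class_C k.+1 U f -> U x -> has_rderiv f v x (rderiv f v x).
Proof. by move=> [_ /(_ v)[d1 _]] Ux; apply: rderivable_has; exact: d1. Qed.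

Lemma cC_rderiv k U f v : class_C k.+1 U f -> class_C k U (rderiv f v).
Proof. by move=> [_ /(_ v)[]]. Qed.

Lemma cC_cst k U c : open U -> class_C k U (fun=> c).
Proof.
move=> oU; elim: k c => [|k IH] c.
  by split=> [x _|]; [exact: cst_continuous|].
by apply: (cC_intro (D := fun _ _ => 0) oU) => [x _|v x _|v];
  [exact: cst_continuous|exact: has_rderiv_cst|exact: IH].
Qed.

Lemma cCD k U f g : open U -> class_C k U f -> class_C k U g ->
  class_C k U (fun y => f y + g y).
Proof.
move=> oU; elim: k f g => [|k IH] f g cf cg.
  by split=> [x Ux|]; [|by []]; exact: (cvgD (cC_cont cf Ux) (cC_cont cg Ux)).
apply: (cC_intro (D := fun v x => rderiv f v x + rderiv g v x) oU) => [x Ux|v x Ux|v].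
- exact: (cvgD (cC_cont cf Ux) (cC_cont cg Ux)).
- exact: (has_rderivD (cC_has v cf Ux) (cC_has v cg Ux)).
- by apply: IH; exact: cC_rderiv.
Qed.

Lemma cCM k U f g : open U -> class_C k U f -> class_C k U g ->
  class_C k U (fun y => f y * g y).
Proof.
move=> oU; elim: k f g => [|k IH] f g cf cg.
  by split=> [x Ux|]; [|by []]; exact: (cvgM (cC_cont cf Ux) (cC_cont cg Ux)).
apply: (cC_intro (D := fun v x => rderiv f v x * g x + f x * rderiv g v x) oU) => [x Ux|v x Ux|v].
- exact: (cvgM (cC_cont cf Ux) (cC_cont cg Ux)).
- exact: (has_rderivM (cC_has v cf Ux) (cC_has v cg Ux)).
- by apply: cCD => //; apply: IH; [exact: cC_rderiv|exact: cC_mon|exact: cC_mon|exact: cC_rderiv].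
Qed.

Lemma conjC_cvg (T : Type) (F : set_system T) (FF : Filter F) (f : T -> R[i]) c :
  f x @[x --> F] --> c -> (f x)^* @[x --> F] --> c^*.
Proof.
move=> /cvgrPdist_lt H; apply/cvgrPdist_lt => e /H; apply: filterS => x.
by rewrite -normcJ rmorphB.
Qed.

Lemma cC_conj k U f : open U -> class_C k U f -> class_C k U (fun y => (f y)^*).
Proof.
move=> oU; elim: k f => [|k IH] f cf.
  by split=> [x Ux|]; [|by []]; exact: (conjC_cvg _ (cC_cont cf Ux)).
apply: (cC_intro (D := fun v x => (rderiv f v x)^*) oU) => [x Ux|v x Ux|v].
- exact: (conjC_cvg _ (cC_cont cf Ux)).
- exact: (has_rderiv_conj (cC_has v cf Ux)).
- by apply: IH; exact: cC_rderiv.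
Qed.

Lemma cC_sum k U (I : Type) (r : seq I) (P : pred I) (f : I -> V -> R[i]) : open U ->
  (forall i, P i -> class_C k U (f i)) ->
  class_C k U (fun y => \sum_(i <- r | P i) f i y).
Proof.
move=> oU cf; elim: r => [|i r IH].
  by apply: eq_cC (cC_cst k 0 oU) => // y _; rewrite big_nil.
case Pi: (P i); last by apply: eq_cC IH => // y _; rewrite big_cons Pi.
apply: eq_cC (cCD oU (cf i Pi) IH) => // y _; by rewrite big_cons Pi.
Qed.

Lemma cC_prod k U (I : Type) (r : seq I) (P : pred I) (f : I -> V -> R[i]) : open U ->
  (forall i, P i -> class_C k U (f i)) ->
  class_C k U (fun y => \prod_(i <- r | P i) f i y).
Proof.
move=> oU cf; elim: r => [|i r IH].
  by apply: eq_cC (cC_cst k 1 oU) => // y _; rewrite big_nil.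
case Pi: (P i); last by apply: eq_cC IH => // y _; rewrite big_cons Pi.
apply: eq_cC (cCM oU (cf i Pi) IH) => // y _; by rewrite big_cons Pi.
Qed.

Lemma cC_det k U m (A : V -> 'M[R[i]]_m) : open U ->
  (forall i j, class_C k U (fun y => A y i j)) -> class_C k U (fun y => \det (A y)).
Proof.
move=> oU cA; apply: cC_sum => // s _; apply: cCM => //; first exact: cC_cst.
by apply: cC_prod.
Qed.

Lemma cC_adj k U m (A : V -> 'M[R[i]]_m) : open U ->
  (forall i j, class_C k U (fun y => A y i j)) ->
  forall i j, class_C k U (fun y => (\adj (A y)) i j).
Proof.
move=> oU cA i j; apply: (@eq_cC _ _ (fun y => cofactor (A y) j i)) => //.
  by move=> y _; rewrite mxE.
apply: cCM => //; first exact: cC_cst.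
apply: cC_det => // a b; apply: eq_cC (cA (lift j a) (lift i b)) => // y _.
by rewrite !mxE.
Qed.

Lemma cC_mulmx k U m p q (A : V -> 'M[R[i]]_(m, p)) (B : V -> 'M[R[i]]_(p, q)) : open U ->
  (forall i j, class_C k U (fun y => A y i j)) ->
  (forall i j, class_C k U (fun y => B y i j)) ->
  forall i j, class_C k U (fun y => (A y *m B y) i j).
Proof.
move=> oU cA cB i j.
apply: (@eq_cC _ _ (fun y => \sum_l A y i l * B y l j)) => //.
  by move=> y _; rewrite mxE.
by apply: cC_sum => // l _; exact: cCM.
Qed.

Lemma cC_Re k U f : open U -> class_C k U f -> class_C k U (fun y => (re (f y))%:C).
Proof.
move=> oU cf; apply: (@eq_cC _ _ (fun y => (f y + (f y)^*) * 2^-1)) => //.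
  by move=> y _; rewrite ReJ_add.
by apply: cCM => //; [apply: cCD => //; exact: cC_conj|exact: cC_cst].
Qed.

Lemma cC_Im k U f : open U -> class_C k U f -> class_C k U (fun y => (im (f y))%:C).
Proof.
move=> oU cf; apply: (@eq_cC _ _ (fun y => ((f y)^* + (-1) * f y) * (2^-1 * 'i%C))) => //.
  by move=> y _; rewrite ImJ_sub mulN1r mulrA.
apply: cCM => //; last exact: cC_cst.
by apply: cCD => //; [exact: cC_conj|apply: cCM => //; exact: cC_cst].
Qed.

(** The exponent is generalised because differentiation lowers it. It is -1 for inverses of
    determinants and 1/n for the conformal factor. *)
Lemma cC_powR k U f (a : R) : open U -> (forall x, U x -> 0 < re (f x)) ->
  class_C k U f -> class_C k U (fun y => (re (f y) `^ a)%:C).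
Proof.
move=> oU f0; have cont (a' : R) x : U x -> {for x, continuous f} ->
    {for x, continuous (fun y => (re (f y) `^ a')%:C)}.
  move=> Ux cx.
  apply: (@continuous_comp _ _ _ (fun y => re (f y)) (fun r => (r `^ a')%:C)).
    by apply: (@continuous_comp _ _ _ f (fun r => re r)); [exact: cx|exact: Re_continuous].
  apply: (@continuous_comp _ _ _ (fun r => r `^ a') (fun r => r%:C)); last exact: realC_continuous.
  have h := is_derive1_powR a' (f0 x Ux).
  by apply/differentiable_continuous/derivable1_diffP; apply: ex_derive.
elim: k a => [|k IH] a cf.
  by split=> [x Ux|]; [apply: (cont _ _ Ux); exact: cC_cont cf Ux|].
apply: (cC_intro (D := fun v x => a%:C * (re (f x) `^ (a - 1))%:C * (re (rderiv f v x))%:C) oU) => [x Ux|v x Ux|v].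
- by apply: (cont _ _ Ux); exact: cC_cont cf Ux.
- exact: (has_rderiv_powR _ (f0 _ Ux) (cC_has v cf Ux)).
- apply: cCM => //; last by apply: cC_Re => //; exact: cC_rderiv.
  by apply: cCM => //; [exact: cC_cst|apply: IH; exact: cC_mon].
Qed.

Lemma holomorphic_cC k U f : open U -> (forall x, U x -> differentiable f x) ->
  class_C k U f.
Proof.
move=> oU; elim: k f => [|k IH] f df.
  by split=> // x /df; exact: differentiable_continuous.
apply: (cC_intro (D := fun v x => 'd f x v) oU) => [x /df|v x /df dx|v].
- exact: differentiable_continuous.
- exact: line_eps.
- by apply: IH => x Ux; exact: (holomorphic_derivative v oU df).
Qed.

End RealCalculus.

Lemma linear_diff_comp (K : numFieldType) (V W X : normedModType K)
    (L : {linear W -> X}) (G : V -> W) x v : continuous L -> differentiable G x ->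
  'd (L \o G) x v = L ('d G x v).
Proof.
move=> cL dG; rewrite diff_comp //; last exact: linear_differentiable.
by rewrite /= diff_lin.
Qed.

(** * Frechet differentiability of C^1 functions *)

Section Frechet.
Variables (R : realType) (n : nat).
Local Notation V := 'rV[R[i]]_n.
Implicit Types (f g : V -> R[i]) (U W : set V) (x v h : V).

Lemma has_rderiv_line f v x (t : R) c : has_rderiv f v (x + t%:C *: v) c ->
  is_derive t 1 (fun s : R => re (f (x + s%:C *: v))) (re c) /\
  is_derive t 1 (fun s : R => im (f (x + s%:C *: v))) (im c).
Proof.
move=> H.
have E s : x + (t + s)%:C *: v = x + t%:C *: v + s%:C *: v.
  by rewrite rmorphD scalerDl addrA.
split; apply: eps_is_derive => e e0; have [r r0 Hr] := H e e0;
  exists r => // s /Hr Ht; rewrite E -lecR; apply: le_trans Ht.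
  apply: le_trans (norm_Re_le _).
  by rewrite !ReD !ReN ReM /= mul0r subr0.
apply: le_trans (norm_Im_le _).
by rewrite !ImD !ImN ImM /= mul0r addr0.
Qed.

Lemma has_rderivZ f v x c (a : R) : has_rderiv f v x c ->
  has_rderiv f (a%:C *: v) x (a%:C * c).
Proof.
move=> H e e0; have q0 : 0 < `|a| + 1 by rewrite ltr_wpDl.
have [r r0 Hr] := H _ (divr_gt0 e0 q0).
exists (r / (`|a| + 1)); first by rewrite divr_gt0.
move=> t; rewrite ltr_pdivlMr // => tr.
have ta : `|t * a| < r.
  by rewrite normrM; apply: le_lt_trans tr; rewrite ler_wpM2l // lerDl.
rewrite scalerA mulrA -rmorphM /=; apply: (le_trans (Hr _ ta)).
rewrite lecR normrM mulrCA [leRHS]mulrC ler_wpM2l // -mulrA ler_piMr ?(ltW e0) //.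
by rewrite mulrC ler_pdivrMr // mul1r lerDl.
Qed.

Lemma rderiv_mean_value f (Df : V -> R[i]) v c y (a B : R) :
  (forall t : R, 0 <= t <= 1 -> let z := y + (t * a)%:C *: v in
     has_rderiv f v z (Df z) /\ `|Df z - c| <= B%:C) ->
  `|f (y + a%:C *: v) - f y - a%:C * c| <= (2 * (`|a| * B))%:C.
Proof.
move=> H.
have H' t : 0 <= t <= 1 -> let z := y + t%:C *: (a%:C *: v) in
    has_rderiv f (a%:C *: v) z (a%:C * Df z) /\ `|Df z - c| <= B%:C.
  move=> /H; rewrite scalerA -rmorphM /= => -[h1 h2]; split => //.
  exact: has_rderivZ.
have x1 : y + a%:C *: v = y + 1%:C *: (a%:C *: v) by rewrite scale1r.
have x0 : y = y + 0%:C *: (a%:C *: v) by rewrite scale0r addr0.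
set w := a%:C * c.
have bnd z : `|Df z - c| <= B%:C -> `|a%:C * Df z - w| <= (`|a| * B)%:C.
  by move=> h; rewrite -mulrBr normrM norm_realC rmorphM /= ler_wpM2l // ler0c.
apply: (le_trans (norm_le_ReIm _)); rewrite lecR mulr_natl mulr2n.
apply: lerD.
- have := @real_mean_value _ (fun t => re (f (y + t%:C *: (a%:C *: v))) - t * re w)
    (fun t => re (a%:C * Df (y + t%:C *: (a%:C *: v))) - re w) (`|a| * B).
  rewrite -x0 -x1 mul1r mul0r subr0 !ReD !ReN addrAC; apply => t /H'[d1 /bnd d2].
  split; last by rewrite -lecR -ReN -ReD (le_trans (norm_Re_le _)).
  have [d3 _] := has_rderiv_line d1.
  have d4 : is_derive t 1 (fun s : R => s * re w) (re w).
    by apply: is_derive_eq; rewrite /GRing.scale /=; ring.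
  exact: is_deriveB.
- have := @real_mean_value _ (fun t => im (f (y + t%:C *: (a%:C *: v))) - t * im w)
    (fun t => im (a%:C * Df (y + t%:C *: (a%:C *: v))) - im w) (`|a| * B).
  rewrite -x0 -x1 mul1r mul0r subr0 !ImD !ImN addrAC; apply => t /H'[d1 /bnd d2].
  split; last by rewrite -lecR -ImN -ImD (le_trans (norm_Im_le _)).
  have [_ d3] := has_rderiv_line d1.
  have d4 : is_derive t 1 (fun s : R => s * im w) (im w).
    by apply: is_derive_eq; rewrite /GRing.scale /=; ring.
  exact: is_deriveB.
Qed.

(** Continuous partial derivatives imply differentiability: the increment is made one direction at a
    time, each by the mean value theorem. The base point [y] varies near [x] because the remaining
    directions start from a displaced point. *)
Lemma frechet_seq (I : Type) (b : I -> V) f U x (s : seq I) : open U -> U x ->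
  class_C 1 U f -> forall e : R, 0 < e -> exists2 d : R, 0 < d &
  forall (y : V) (a : I -> R) (r : R), `|y - x| < d%:C -> 0 <= r < d ->
    (forall i, `|a i| <= r) ->
    `|f (y + \sum_(i <- s) (a i)%:C *: b i) - f y -
      \sum_(i <- s) (a i)%:C * rderiv f (b i) x| <= (e * r)%:C.
Proof.
move=> oU Ux cf; elim: s => [|i s IH] e e0.
  exists 1 => // y a r _ /andP[r0 _] ar.
  by rewrite !big_nil addr0 subrr subr0 normr0 ler0c mulr_ge0 // ltW.
have e2 : 0 < e / 2 by rewrite divr_gt0.
have e4 : 0 < (e / 4)%:C :> R[i] by rewrite ltcR divr_gt0.
have [d2 d20 H2] := IH _ e2.
set v := b i; have cD : {for x, continuous (rderiv f v)} := cC_cont (cC_rderiv v cf) Ux.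
have [_ /gt0_realC[d1 d10 ->] H1] := cont_eps cD e4.
have /nbhs_ballP[_ /= /gt0_realC[d3 d30 ->] H3] := open_nbhs_nbhs (conj oU Ux).
set m := Num.min d2 (Num.min d1 d3).
have m0 : 0 < m by rewrite !lt_min d20 d10.
have v0 : 0 <= re `|v| by rewrite -ler0c -normV_re.
have q0 : 0 < re `|v| + 1 by rewrite ltr_wpDl.
(* Starting within d of [x] and moving along [v] with a coefficient of size at most d stays within d
   + d |v| <= m. *)
pose d := m / (re `|v| + 1); have d0 : 0 < d by rewrite divr_gt0.
have dm : d + d * re `|v| = m by rewrite /d; field; rewrite gt_eqF.
have dm' : d <= m by rewrite -dm lerDl mulr_ge0 // ltW.
exists d => // y a r yd /andP[r0 rd] ar.
have near t : 0 <= t <= 1 -> `|y + (t * a i)%:C *: v - x| < m%:C.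
  move=> /andP[t0 t1]; rewrite addrAC -dm rmorphD.
  apply: (le_lt_trans (ler_normD _ _)); apply: ltr_leD => //.
  rewrite norm_realZ [`|v|]normV_re -rmorphM lecR /= ler_wpM2r // normrM.
  apply: le_trans (ltW rd); apply: le_trans (ar i); rewrite ger0_norm //.
  by rewrite ler_piMl.
set y' := y + (a i)%:C *: v.
have h1 : `|f y' - f y - (a i)%:C * rderiv f v x| <= (2 * (`|a i| * (e / 4)))%:C.
  apply: (@rderiv_mean_value f (rderiv f v)) => t t01 z.
  have zm := near t t01; split.
    apply: (cC_has v cf); apply: H3; rewrite -ball_normE /= distrC.
    by apply: (lt_le_trans zm); rewrite lecR !ge_min lexx !orbT.
  have := H1 (z - x); rewrite [x + _]addrC subrK => H; apply/ltW/H.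
  by apply: (lt_le_trans zm); rewrite lecR !ge_min lexx !orbT.
have h2 : `|f (y' + \sum_(j <- s) (a j)%:C *: b j) - f y' -
      \sum_(j <- s) (a j)%:C * rderiv f (b j) x| <= (e / 2 * r)%:C.
  apply: H2 => //; last first.
    by rewrite r0 (lt_le_trans rd) // (le_trans dm') // ge_min lexx.
  have := near 1; rewrite mul1r ler01 lexx => /(_ isT) h.
  by apply: (lt_le_trans h); rewrite lecR ge_min lexx.
rewrite !big_cons addrA -/v -/y'.
rewrite (_ : _ - _ = (f (y' + \sum_(j <- s) (a j)%:C *: b j) - f y' -
      \sum_(j <- s) (a j)%:C * rderiv f (b j) x) +
    (f y' - f y - (a i)%:C * rderiv f v x)); last by ring.
apply: (le_trans (ler_normD _ _)); apply: (le_trans (lerD h2 h1)).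
rewrite -rmorphD lecR /=.
have : `|a i| * (e / 4) <= r * (e / 4) by rewrite ler_wpM2r // divr_ge0 // ltW.
lra.
Qed.

Definition rbasis (k : 'I_n * bool) : V :=
  if k.2 then 'i%C *: delta_mx 0 k.1 else delta_mx 0 k.1.

Definition rcoord (k : 'I_n * bool) (h : V) : R :=
  if k.2 then im (h 0 k.1) else re (h 0 k.1).

Lemma rbasis_sum h : h = \sum_k (rcoord k h)%:C *: rbasis k.
Proof.
rewrite -(pair_bigA _ (fun j b => (rcoord (j, b) h)%:C *: rbasis (j, b))) /=.
rewrite {1}(row_sum_delta h); apply: eq_bigr => j _.
rewrite big_bool /rcoord /rbasis /= scalerA addrC -scalerDl; congr (_ *: _).
by rewrite [LHS]complexE mulrC.
Qed.

Lemma coord_norm_le h j : `|h 0 j| <= `|h|.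
Proof.
rewrite -[leRHS]/(mx_norm h) mx_normE -[leLHS]nngE num_le.
exact: (le_bigmax _ _ (0, j)).
Qed.

Lemma rcoord_le k h : `|rcoord k h| <= re `|h|.
Proof.
rewrite -lecR -normV_re; case: k => j [] /=; rewrite /rcoord /=.
  exact: le_trans (norm_Im_le _) (coord_norm_le _ _).
exact: le_trans (norm_Re_le _) (coord_norm_le _ _).
Qed.

Definition rgrad f x h : R[i] := \sum_k (rcoord k h)%:C * rderiv f (rbasis k) x.

Lemma frechet f U x : open U -> U x -> class_C 1 U f ->
  forall e : R, 0 < e -> exists2 d : R, 0 < d & forall h, `|h| < d%:C ->
    `|f (x + h) - f x - rgrad f x h| <= e%:C * `|h|.
Proof.
move=> oU Ux cf e e0.
have [d d0 H] := frechet_seq rbasis (index_enum _) oU Ux cf e0; exists d => // h hd.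
have h0 : 0 <= re `|h| by rewrite -ler0c -normV_re.
have := H x (fun k => rcoord k h) (re `|h|).
rewrite subrr normr0 ltcR d0 h0 -ltcR -normV_re hd rmorphM /= -normV_re.
by rewrite -rbasis_sum; apply => // k; exact: rcoord_le.
Qed.

Lemma rcoordZ k (t : R) h : rcoord k (t%:C *: h) = t * rcoord k h.
Proof. by case: k => j []; rewrite /rcoord /= mxE ?ImM ?ReM /= mul0r ?subr0 ?addr0. Qed.

Lemma rcoordD k h h' : rcoord k (h + h') = rcoord k h + rcoord k h'.
Proof. by case: k => j []; rewrite /rcoord /= mxE ?ImD ?ReD. Qed.

Lemma rgradZ f x (t : R) h : rgrad f x (t%:C *: h) = t%:C * rgrad f x h.
Proof.
rewrite /rgrad mulr_sumr; apply: eq_bigr => k _.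
by rewrite rcoordZ rmorphM mulrA.
Qed.

Lemma rgradD f x h h' : rgrad f x (h + h') = rgrad f x h + rgrad f x h'.
Proof.
rewrite /rgrad -big_split; apply: eq_bigr => k _.
by rewrite rcoordD rmorphD mulrDl.
Qed.

Lemma rgrad_has f U x v : open U -> U x -> class_C 1 U f ->
  has_rderiv f v x (rgrad f x v).
Proof.
move=> oU Ux cf e e0.
have v0 : 0 <= re `|v| by rewrite -ler0c -normV_re.
have q0 : 0 < re `|v| + 1 by rewrite ltr_wpDl.
have [d d0 H] := frechet oU Ux cf (divr_gt0 e0 q0).
exists (d / (re `|v| + 1)); first by rewrite divr_gt0.
move=> t; rewrite ltr_pdivlMr // => td.
rewrite -rgradZ; apply: (le_trans (H _ _)).
  rewrite norm_realZ [`|v|]normV_re -rmorphM ltcR /=; apply: le_lt_trans td.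
  by rewrite ler_wpM2l // lerDl.
rewrite norm_realZ [`|v|]normV_re -!rmorphM lecR /=.
rewrite mulrCA [leRHS]mulrC ler_wpM2l // -mulrA ler_piMr ?(ltW e0) //.
by rewrite mulrC ler_pdivrMr // mul1r lerDl.
Qed.

(** [class_C] speaks of each direction separately; additivity of the derivative in [v] comes from
    here. *)
Lemma rderiv_rgrad f U x v : open U -> U x -> class_C 1 U f ->
  rderiv f v x = rgrad f x v.
Proof. by move=> oU Ux cf; have [_ ->] := has_rderivP (rgrad_has v oU Ux cf). Qed.

End Frechet.

(** * The chain rule for holomorphic inner maps *)

Section Chain.
Variables (R : realType) (m n : nat).
Implicit Types (f : 'rV[R[i]]_n -> R[i]) (G : 'rV[R[i]]_m -> 'rV[R[i]]_n).
Implicit Types (U : set 'rV[R[i]]_n) (W : set 'rV[R[i]]_m).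

Lemma has_rderiv_comp f U G x v : open U -> U (G x) -> class_C 1 U f ->
  differentiable G x -> has_rderiv (f \o G) v x (rgrad f (G x) ('d G x v)).
Proof.
move=> oU UG cf dG e e0.
set w := 'd G x v; set S := \sum_k re `|rderiv f (rbasis R k) (G x)|.
have nre (V : normedModType R[i]) (y : V) : 0 <= re `|y| by rewrite -ler0c -normV_re.
have S0 : 0 <= S by apply: sumr_ge0 => k _; exact: nre.
have rgrad_le y : `|rgrad f (G x) y| <= (S * re `|y|)%:C.
  rewrite /rgrad; apply: (le_trans (ler_norm_sum _ _ _)).
  rewrite /S mulr_suml rmorph_sum; apply: ler_sum => k _.
  move: (rderiv f (rbasis R k) (G x)) => D.
  rewrite normrM norm_realC [`|D|]normV_re -rmorphM lecR /= mulrC.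
  by apply: ler_wpM2l; [exact: (nre _ D)|exact: rcoord_le].
set L := re `|w|; set N := re `|v|.
have L0 : 0 <= L by exact: nre. have N0 : 0 <= N by exact: nre.
have q1 : 0 < L + N + 1 by rewrite ltr_wpDl // addr_ge0.
have q2 : 0 < S * N + 1 by rewrite ltr_wpDl // mulr_ge0.
(* [e1] controls the error of [f], [e2] that of [G] magnified by the gradient bound S; each
   contributes at most e / 2 |t|. The bound [e2 <= 1] keeps the increment of [G] below |t| (L +
   N). *)
pose e1 := e / (2 * (L + N + 1)); have e10 : 0 < e1 by rewrite divr_gt0 // mulr_gt0.
pose e2 := Num.min 1 (e / (2 * (S * N + 1))).
have e20 : 0 < e2 by rewrite lt_min ltr01 divr_gt0 // mulr_gt0.
have e21 : e2 <= 1 by rewrite ge_min lexx.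
have e2e : e2 <= e / (2 * (S * N + 1)) by rewrite ge_min lexx orbT.
have [d1 d10 H1] := frechet oU UG cf e10.
have e20' : 0 < e2%:C :> R[i] by rewrite ltcR.
have [_ /gt0_realC[d2 d20 ->] H2] := diff_eps dG e20'.
exists (Num.min d1 d2 / (L + N + 1)); first by rewrite divr_gt0 // lt_min d10.
move=> t; rewrite ltr_pdivlMr // lt_min => /andP[t1 t2].
have tN : `|t| * N <= `|t| * (L + N + 1) by rewrite ler_wpM2l //; lra.
have tLN : `|t| * (L + N) <= `|t| * (L + N + 1) by rewrite ler_wpM2l //; lra.
have h2 : `|G (x + t%:C *: v) - G x - t%:C *: w| <= (e2 * (`|t| * N))%:C.
  have := H2 (t%:C *: v); rewrite norm_realZ [`|v|]normV_re -!rmorphM ltcR /= -/N.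
  by move=> /(_ (le_lt_trans tN t2)); rewrite linearZ.
set k := G (x + t%:C *: v) - G x in h2.
have kn : `|k| <= (`|t| * (L + N))%:C.
  rewrite -(subrK (t%:C *: w) k) (le_trans (ler_normD _ _)) // addrC mulrDr rmorphD.
  apply: lerD; first by rewrite norm_realZ [`|w|]normV_re -rmorphM.
  apply: (le_trans h2); rewrite lecR ler_piMl // mulr_ge0 //.
have h1 : `|f (G x + k) - f (G x) - rgrad f (G x) k| <= (e1 * (`|t| * (L + N)))%:C.
  apply: (le_trans (H1 _ _)); last first.
    rewrite (_ : (e1 * _)%:C = e1%:C * (`|t| * (L + N))%:C); last exact: rmorphM.
    by apply: ler_wpM2l => //; rewrite ler0c ltW.
  by apply: (le_lt_trans kn); rewrite ltcR (le_lt_trans tLN).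
have -> : (f \o G) (x + t%:C *: v) = f (G x + k) by rewrite /k /= addrCA subrr addr0.
rewrite /= (_ : _ - _ = (f (G x + k) - f (G x) - rgrad f (G x) k) +
    rgrad f (G x) (k - t%:C *: w)); last first.
  have -> : k - t%:C *: w = k + (- t)%:C *: w by rewrite rmorphN scaleNr.
  by rewrite rgradD rgradZ rmorphN /=; ring.
apply: (le_trans (ler_normD _ _)); apply: (le_trans (lerD h1 (rgrad_le _))).
rewrite -rmorphD lecR /=.
have h3 : re `|k - t%:C *: w| <= e2 * (`|t| * N) by rewrite -lecR -normV_re.
have h4 : S * re `|k - t%:C *: w| <= e / 2 * `|t|.
  apply: (@le_trans _ _ (S * (e2 * (`|t| * N)))); first by rewrite ler_wpM2l.
  rewrite (_ : S * _ = e2 * (S * N) * `|t|); last by ring.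
  rewrite ler_wpM2r //; apply: (@le_trans _ _ (e / (2 * (S * N + 1)) * (S * N))).
    by rewrite ler_wpM2r // mulr_ge0.
  rewrite (_ : _ * _ = e / 2 * (S * N / (S * N + 1))); last by field; rewrite gt_eqF.
  apply: ler_piMr; first by rewrite divr_ge0 // ltW.
  by rewrite ler_pdivrMr // mul1r lerDl.
have h5 : e1 * (`|t| * (L + N)) <= e / 2 * `|t|.
  rewrite (_ : _ * _ = e / 2 * ((L + N) / (L + N + 1)) * `|t|); last first.
    by rewrite /e1; field; rewrite gt_eqF.
  rewrite ler_wpM2r //; apply: ler_piMr; first by rewrite divr_ge0 // ltW.
  by rewrite ler_pdivrMr // mul1r lerDl.
by apply: le_trans (lerD h5 h4) _; rewrite -mulrDl -splitr.
Qed.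

Lemma coord_differentiable G j x : differentiable G x ->
  differentiable (fun y => G y 0 j) x.
Proof.
move=> dG; apply: (@differentiable_comp _ _ _ _ G (fun y => y 0 j)) => //.
exact: differentiable_coord.
Qed.

Lemma coord_diff G j x v : differentiable G x ->
  'd (fun y => G y 0 j) x v = 'd G x v 0 j.
Proof.
move=> dG.
have lin : linear (fun y : 'rV[R[i]]_n => y 0 j) by move=> a u w; rewrite !mxE.
pose L0 := GRing.isLinear.Build _ _ _ _ _ lin.
pose L : {linear 'rV[R[i]]_n -> R[i]} := HB.pack (fun y : 'rV[R[i]]_n => y 0 j) L0.
have cL : continuous L by exact: coord_continuous.
exact: (@linear_diff_comp _ _ _ _ L G x v cL dG).
Qed.

(** The derivative of the composite is a sum of derivatives of [f] composed with [G], times real and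
    imaginary parts of holomorphic functions, so induction on [k] applies. *)
Lemma cC_comp k f U G W : open U -> open W -> (forall x, W x -> U (G x)) ->
  (forall x, W x -> differentiable G x) -> class_C k U f -> class_C k W (f \o G).
Proof.
move=> oU oW WU dG; elim: k f => [|k IH] f cf.
  split=> [x Wx|]; [|by []].
  apply: (@continuous_comp _ _ _ G f); first exact: differentiable_continuous (dG _ Wx).
  exact: cC_cont cf (WU _ Wx).
have cf1 : class_C 1 U f by elim: k cf {IH} => // k IH cf; apply: IH; exact: cC_mon.
apply: (cC_intro (D := fun v x => rgrad f (G x) ('d G x v)) oW) => [x Wx|v x Wx|v].
- apply: (@continuous_comp _ _ _ G f); first exact: differentiable_continuous (dG _ Wx).
  exact: cC_cont cf (WU _ Wx).
- by apply: (has_rderiv_comp _ oU) => //; [exact: WU|exact: dG].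
apply: (@cC_sum _ _ k W _ _ _ (fun k x => (rcoord k ('d G x v))%:C * rderiv f (rbasis R k) (G x))) => // -[j b] _.
apply: cCM => //; last first.
  by apply: (IH (rderiv f (rbasis R (j, b)))); exact: cC_rderiv.
have cG : class_C k W (fun x => 'd G x v 0 j).
  apply: (@eq_cC _ _ _ _ (fun x => 'd (fun x => G x 0 j) x v)) => //.
    by move=> x /dG; exact: coord_diff.
  apply: holomorphic_cC => // x Wx; apply: holomorphic_derivative oW _ Wx => y /dG.
  exact: coord_differentiable.
by rewrite /rcoord /=; case: b => /=; [exact: cC_Im|exact: cC_Re].
Qed.

End Chain.

(** * Wedge powers of the fundamental form *)

Section DetForms.
Variable F : numFieldType.

(** The number of permutations preserving the two blocks, that is k! l!; its positivity is what
    matters. *)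
Definition block_perms k l : nat :=
  \sum_(t : 'S_(k + l)) \prod_(i < k + l) (((i < k)%N == (t i < k)%N) : nat).

Lemma block_perms_gt0 k l : (0 < block_perms k l)%N.
Proof.
rewrite /block_perms (bigD1 1%g) //= big1 // => i _; by rewrite perm1 eqxx.
Qed.

(** A product of two complementary minors is the determinant of the row-permuted matrix masked to
    its diagonal blocks. Expanding it over permutations t and summing over s first gives, for each
    t, the determinant of [M] times the indicator that t preserves the blocks. *)
Lemma laplace_blocks k l (M : 'M[F]_(k + l)) :
  \sum_(s : 'S_(k + l)) (-1) ^+ s *
    \det (\matrix_(i, j) M (s (lshift l i)) (lshift l j)) *
    \det (\matrix_(i, j) M (s (rshift k i)) (rshift k j)) =
  (block_perms k l)%:R * \det M.
Proof.
pose Bl (i j : 'I_(k + l)) : F := ((i < k)%N == (j < k)%N)%:R.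
have E (s : 'S_(k + l)) :
    \det (\matrix_(i, j) M (s (lshift l i)) (lshift l j)) *
    \det (\matrix_(i, j) M (s (rshift k i)) (rshift k j)) =
    \sum_(t : 'S_(k + l)) (-1) ^+ t * \prod_i (M (s i) (t i) * Bl i (t i)).
  transitivity (\det (\matrix_(i, j) (M (s i) j * Bl i j))); last first.
    by apply: eq_bigr => t _; congr (_ * _); apply: eq_bigr => i _; rewrite mxE.
  rewrite -(det_ublock _ 0).
  congr (\det _); apply/matrixP => i j; rewrite -(splitK i) -(splitK j).
  case: (fintype.split i) => a; case: (fintype.split j) => b /=.
  - by rewrite block_mxEul !mxE /Bl /= !ltn_ord eqxx mulr1.
  - by rewrite block_mxEur !mxE /Bl /= ltn_ord ltnNge leq_addr mulr0.
  - by rewrite block_mxEdl !mxE /Bl /= ltn_ord ltnNge leq_addr mulr0.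
  - by rewrite block_mxEdr !mxE /Bl /= !ltnNge !leq_addr eqxx mulr1.
under eq_bigr do rewrite -mulrA E mulr_sumr.
rewrite exchange_big /= /block_perms natr_sum mulr_suml; apply: eq_bigr => t _.
transitivity ((-1) ^+ t * \prod_i Bl i (t i) *
    \sum_(s : 'S_(k + l)) (-1) ^+ s * \prod_i M (s i) (t i)).
  rewrite mulr_sumr; apply: eq_bigr => s _; rewrite big_split /=.
  have : forall a b A B : F, a * (b * (A * B)) = b * B * (a * A) by move=> *; ring.
  exact.
have -> : \sum_(s : 'S_(k + l)) (-1) ^+ s * \prod_i M (s i) (t i) = (-1) ^+ t * \det M.
  rewrite -[in RHS]det_tr -det_perm -det_mulmx -row_permE.
  by apply: eq_bigr => s _; congr (_ * _); apply: eq_bigr => i _; rewrite !mxE.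
by rewrite mulrACA -expr2 sqrr_sign mul1r natr_prod; congr (_ * _).
Qed.

(** The sum over all index sequences of length [p]; the recursion follows that of [wedge_pow]. *)
Fixpoint sumJ (I : finType) (p : nat) (f : seq I -> F) : F :=
  if p is p'.+1 then \sum_k sumJ p' (fun J => f (k :: J)) else f [::].

Lemma eq_sumJ (I : finType) p (f g : seq I -> F) :
  (forall J, size J = p -> f J = g J) -> sumJ p f = sumJ p g.
Proof.
elim: p f g => [|p IH] f g fg /=; first exact: fg.
by apply: eq_bigr => k _; apply: IH => J sJ; apply: fg; rewrite /= sJ.
Qed.

Lemma sumJZ (I : finType) p c (f : seq I -> F) :
  sumJ p (fun J => c * f J) = c * sumJ p f.
Proof.
elim: p f => [|p IH] f //=; rewrite mulr_sumr; apply: eq_bigr => k _; exact: IH.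
Qed.

Lemma sumJ_sum (I I' : finType) p (f : I' -> seq I -> F) :
  \sum_b sumJ p (f b) = sumJ p (fun J => \sum_b f b J).
Proof.
elim: p f => [|p IH] f //=; rewrite exchange_big /=; apply: eq_bigr => k _.
exact: (IH (fun b J => f b (k :: J))).
Qed.

Lemma sumJ_perm (I : finType) p (s : {perm I}) (f : seq I -> F) :
  sumJ p (fun J => f (map s J)) = sumJ p f.
Proof.
elim: p f => [|p IH] f //=.
rewrite [RHS](reindex_inj (@perm_inj _ s)) /=; apply: eq_bigr => k _.
exact: (IH (fun J => f (s k :: J))).
Qed.

Lemma sumJ_ge0 (I : finType) p (f : seq I -> F) : (forall J, 0 <= f J) -> 0 <= sumJ p f.
Proof.
elim: p f => [|p IH] f f0 //=; apply: sumr_ge0 => k _; exact: IH.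
Qed.

Lemma sumJ_gt0 (I : finType) p (J0 : seq I) (f : seq I -> F) : size J0 = p ->
  (forall J, 0 <= f J) -> 0 < f J0 -> 0 < sumJ p f.
Proof.
move=> <-; elim: J0 f => [|k J0 IH] f f0 fJ //=.
rewrite (bigD1 k) //= ltr_pwDl //; first exact: IH.
by apply: sumr_ge0 => j _; exact: sumJ_ge0.
Qed.

End DetForms.

Section Columns.
Variables (F : numFieldType) (n : nat).

(** The determinant is the value on [u] of the wedge product of the coordinate forms listed by
    [s]. *)
Definition mxr k N (s : 'I_k -> 'I_N) (u : 'I_k -> 'rV[F]_N) : 'M[F]_k :=
  \matrix_(r, c) u r 0 (s c).

Definition cons_row k N (w : 'rV[F]_N) (u : 'I_k -> 'rV[F]_N) : 'I_k.+1 -> 'rV[F]_N :=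
  fun r => oapp u w (unlift ord0 r).

Lemma cons_row0 k N (w : 'rV[F]_N) (u : 'I_k -> 'rV[F]_N) : cons_row w u ord0 = w.
Proof. by rewrite /cons_row unlift_none. Qed.

Lemma cons_rowS k N (w : 'rV[F]_N) (u : 'I_k -> 'rV[F]_N) i :
  cons_row w u (lift ord0 i) = u i.
Proof. by rewrite /cons_row liftK. Qed.

(* The holomorphic and antiholomorphic coordinates indexed by [J], interleaved. *)
Definition cols (J : seq 'I_n.+1) p : 'I_(p * 2) -> 'I_(n.+1 + n.+1) :=
  fun c => if odd c then rshift _ (nth ord0 J c./2) else lshift _ (nth ord0 J c./2).

(** All coordinates, in the order z_0, conj z_0, z_1, conj z_1 and so on. *)
Definition cols_id : 'I_(n.+1 * 2) -> 'I_(n.+1 + n.+1) :=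
  fun c => if odd c then rshift _ (inord c./2) else lshift _ (inord c./2).

Lemma cols_idI : injective cols_id.
Proof.
have half_lt (c : 'I_(n.+1 * 2)) : (c./2 < n.+1)%N.
  by rewrite ltn_half_double -muln2 ltn_ord.
move=> c d; rewrite /cols_id => cd; apply: val_inj => /=.
rewrite -(odd_double_half c) -(odd_double_half d); move: cd.
case: (odd c) (odd d) => [] [] /(congr1 val) /=;
  rewrite ?inordK //= => /eqP.
- by rewrite eqn_add2l => /eqP ->.
- by rewrite gtn_eqF // (leq_trans (half_lt d)) // leq_addr.
- by rewrite ltn_eqF // (leq_trans (half_lt c)) // leq_addr.
- by move=> /eqP ->.
Qed.

(** [k = N] is an equation because [n.+1 * 2] and [n.+1 + n.+1] are not convertible. *)
Lemma mxr_mulmx k N (s : 'I_k -> 'I_N) (u : 'I_k -> 'rV[F]_N) (Q : 'M[F]_N) :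
  k = N -> injective s ->
  \det (mxr s (fun r => u r *m Q)) = \det (mxr s u) * \det Q.
Proof.
move=> kN; subst N => si; pose t := perm si.
have -> : mxr s (fun r => u r *m Q) = col_perm t ((\matrix_(r, c) u r 0 c) *m Q).
  apply/matrixP => i j; rewrite !mxE permE; apply: eq_bigr => l _.
  by rewrite !mxE.
have -> : mxr s u = col_perm t (\matrix_(r, c) u r 0 c).
  by apply/matrixP => i j; rewrite !mxE permE.
by rewrite !col_permE !det_mulmx mulrAC.
Qed.

Definition selmx (J : seq 'I_n.+1) : 'M[F]_n.+1 :=
  \matrix_(i, j) (i == nth ord0 J j)%:R.

(** [J] selects the holomorphic and the antiholomorphic coordinates alike, so the selection matrix
    acts twice and the signs of reorderings cancel. *)
Lemma mxr_cols (J : seq 'I_n.+1) (u : 'I_(n.+1 * 2) -> 'rV[F]_(n.+1 + n.+1)) :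
  \det (mxr (@cols J n.+1) u) = \det (mxr cols_id u) * \det (selmx J) ^+ 2.
Proof.
have <- : \det (block_mx (selmx J) 0 0 (selmx J)) = \det (selmx J) ^+ 2.
  by rewrite det_ublock expr2.
rewrite -mxr_mulmx; [|by rewrite muln2 addnn|exact: cols_idI].
congr (\det _); apply/matrixP => i c; rewrite !mxE big_split_ord /=.
have half_lt : (c./2 < n.+1)%N by rewrite ltn_half_double -muln2 ltn_ord.
rewrite /cols /cols_id; case: (odd c).
  rewrite big1 ?add0r => [|j _]; last by rewrite block_mxEur mxE mulr0.
  rewrite (bigD1 (nth ord0 J c./2)) //= big1 ?addr0 => [|j /negPf nj].
    by rewrite block_mxEdr mxE inordK // eqxx mulr1.
  by rewrite block_mxEdr mxE inordK // nj mulr0.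
rewrite [X in _ = _ + X]big1 ?addr0 => [|j _]; last by rewrite block_mxEdl mxE mulr0.
rewrite (bigD1 (nth ord0 J c./2)) //= big1 ?addr0 => [|j /negPf nj].
  by rewrite block_mxEul mxE inordK // eqxx mulr1.
by rewrite block_mxEul mxE inordK // nj mulr0.
Qed.

(** A square in [F] may be negative, as in the complex numbers; here the determinant is an
    integer. *)
Lemma selmx_sqr_ge0 J : 0 <= \det (selmx J) ^+ 2.
Proof.
have -> : selmx J = map_mx intr (\matrix_(i, j) (i == nth ord0 J j)%:R : 'M[int]_n.+1).
  by apply/matrixP => i j; rewrite !mxE; case: eqP.
by rewrite det_map_mx -rmorphXn /= ler0z sqr_ge0.
Qed.

Lemma selmx_nuniq J : size J = n.+1 -> ~~ uniq J -> \det (selmx J) = 0.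
Proof.
move=> sJ /(uniqPn ord0)[i [j [ij jn ne]]].
rewrite -det_tr; rewrite sJ in jn.
apply: (determinant_alternate (i1 := Ordinal (ltn_trans ij jn)) (i2 := Ordinal jn)).
  by rewrite -val_eqE /= ltn_eqF.
by move=> k; rewrite !mxE /= ne.
Qed.

Lemma selmx_uniq J : size J = n.+1 -> uniq J -> \det (selmx J) ^+ 2 = 1.
Proof.
move=> sJ uJ.
have inj : injective (fun i : 'I_n.+1 => nth ord0 J i).
  by move=> i j /eqP; rewrite nth_uniq ?sJ // => /eqP; exact: val_inj.
have -> : selmx J = (perm_mx (perm inj))^T.
  by apply/matrixP => i j; rewrite !mxE permE eq_sym.
by rewrite det_tr det_perm sqrr_sign.
Qed.

Lemma selmx_map (s : 'S_n.+1) J : size J = n.+1 ->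
  \det (selmx (map s J)) ^+ 2 = \det (selmx J) ^+ 2.
Proof.
move=> sJ; case: (boolP (uniq J)) => uJ.
  by rewrite !selmx_uniq ?size_map // map_inj_uniq //; exact: perm_inj.
by rewrite !selmx_nuniq ?size_map // map_inj_uniq //; exact: perm_inj.
Qed.

(** Only orderings of distinct indices contribute, each by 1: [Cvol] counts (n + 1)! of them and
    [Cbal] n!. *)
Definition Cvol : F := sumJ n.+1 (fun J => \det (selmx J) ^+ 2).
Definition Cbal : F := sumJ n (fun J => \det (selmx (ord0 :: J)) ^+ 2).

Lemma Cvol_gt0 : 0 < Cvol.
Proof.
apply: (sumJ_gt0 (size_enum_ord n.+1)) => [J|]; first exact: selmx_sqr_ge0.
by rewrite selmx_uniq ?size_enum_ord ?enum_uniq.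
Qed.

Lemma Cbal_gt0 : 0 < Cbal.
Proof.
pose J0 := [seq i <- enum 'I_n.+1 | i != ord0].
have u0 : uniq (ord0 :: J0) by rewrite /= mem_filter eqxx filter_uniq // enum_uniq.
have s0 : size (ord0 :: J0) = n.+1.
  rewrite -[RHS](size_enum_ord n.+1); apply/perm_size/uniq_perm => //.
    exact: enum_uniq.
  by move=> i; rewrite inE mem_filter mem_enum andbT; case: eqP.
have sJ : size J0 = n by case: s0.
apply: (sumJ_gt0 sJ) => [J|]; first exact: selmx_sqr_ge0.
by rewrite selmx_uniq.
Qed.

Lemma Cbal_eq b : sumJ n (fun J => \det (selmx (b :: J)) ^+ 2) = Cbal.
Proof.
rewrite -(sumJ_perm _ (tperm ord0 b)); apply: eq_sumJ => J sJ.
rewrite -{1}(tpermL ord0 b) -[_ :: map _ _]/(map (tperm ord0 b) (ord0 :: J)).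
by rewrite selmx_map //= sJ.
Qed.

Lemma vol_columns (u : 'I_(n.+1 * 2) -> 'rV[F]_(n.+1 + n.+1)) :
  sumJ n.+1 (fun J => \det (mxr (@cols J n.+1) u)) = Cvol * \det (mxr cols_id u).
Proof.
rewrite /Cvol mulrC -sumJZ; apply: eq_sumJ => J _; exact: mxr_cols.
Qed.

Definition eL (b : 'I_n.+1) : 'rV[F]_(n.+1 + n.+1) := delta_mx 0 (lshift _ b).
Definition eR (b : 'I_n.+1) : 'rV[F]_(n.+1 + n.+1) := delta_mx 0 (rshift _ b).

Lemma det_cons_row k N (s : 'I_k.+1 -> 'I_N) (w : 'rV[F]_N) (u : 'I_k -> 'rV[F]_N) :
  w 0 (s ord0) = 1 -> (forall c, w 0 (s (lift ord0 c)) = 0) ->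
  \det (mxr s (cons_row w u)) = \det (mxr (fun c => s (lift ord0 c)) u).
Proof.
move=> w1 w0; rewrite (expand_det_row _ ord0) (bigD1 ord0) //= big1 ?addr0 => [|c].
  rewrite mxE cons_row0 w1 mul1r /cofactor addn0 expr0 mul1r; congr (\det _).
  by apply/matrixP => i j; rewrite !mxE cons_rowS.
case: (unliftP ord0 c) => [c' ->|->] // _.
by rewrite mxE cons_row0 w0 mul0r.
Qed.

Lemma cols_cons b J (c : 'I_(n * 2)) :
  @cols (b :: J) n.+1 (lift ord0 (lift ord0 c)) = @cols J n c.
Proof.
rewrite /cols (_ : (lift ord0 (lift ord0 c) : nat) = c.+2) //.
by rewrite -[odd c.+2]/(~~ ~~ odd c) negbK.
Qed.

Lemma bal_det b J (u : 'I_(n * 2) -> 'rV[F]_(n.+1 + n.+1)) : size J = n -> b \notin J ->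
  \det (mxr (@cols (b :: J) n.+1) (cons_row (eL b) (cons_row (eR b) u))) =
  \det (mxr (@cols J n) u).
Proof.
move=> sJ bJ.
have nJ c : (c < n * 2)%N -> nth ord0 J c./2 != b.
  move=> cn; apply: contraNneq bJ => <-; apply: mem_nth.
  by rewrite sJ ltn_half_double -muln2.
rewrite (@det_cons_row (n * 2).+1); last 2 first.
- by rewrite mxE /= eqxx.
- move=> c; case: (unliftP ord0 c) => [c' ->|->].
    rewrite cols_cons mxE /cols; case: (odd c') => /=.
      by rewrite eq_sym eq_lrshift.
    by rewrite eq_lshift (negPf (nJ _ (ltn_ord _))).
  by rewrite mxE /cols /= eq_sym eq_lrshift.
rewrite (@det_cons_row (n * 2)); last 2 first.
- by rewrite mxE /cols /= eqxx.
- move=> c; rewrite cols_cons mxE /cols; case: (odd c) => /=.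
    by rewrite eq_rshift (negPf (nJ _ (ltn_ord _))).
  by rewrite eq_lrshift.
by congr (\det _); apply/matrixP => i j; rewrite !mxE cols_cons.
Qed.

(** Minors of size 2n are completed to full determinants, which are multiplicative. If [J] has no
    repetition exactly one index b is missing from it, and rows e_b, conj e_b are prepended; if it
    has one, both sides vanish. *)
Lemma bal_columns (u : 'I_(n * 2) -> 'rV[F]_(n.+1 + n.+1)) :
  sumJ n (fun J => \det (mxr (@cols J n) u)) =
  Cbal * \sum_b \det (mxr cols_id (cons_row (eL b) (cons_row (eR b) u))).
Proof.
rewrite mulr_sumr.
transitivity (\sum_b sumJ n (fun J =>
    \det (mxr (@cols (b :: J) n.+1) (cons_row (eL b) (cons_row (eR b) u))))); last first.
  apply: eq_bigr => b _; rewrite mulrC -(Cbal_eq b) -sumJZ.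
  by apply: eq_sumJ => J _; exact: mxr_cols.
rewrite sumJ_sum; apply: eq_sumJ => J sJ.
have H0 b : b \in J ->
    \det (mxr (@cols (b :: J) n.+1) (cons_row (eL b) (cons_row (eR b) u))) = 0.
  move=> bJ; rewrite mxr_cols selmx_nuniq ?expr0n ?mulr0 //= ?sJ //.
  by rewrite bJ.
rewrite (bigID (fun b => b \in J)) /= big1 ?add0r => [|b /H0 //].
rewrite (eq_bigr (fun=> \det (mxr (@cols J n) u))) => [|b bJ]; last exact: bal_det.
case: (boolP (uniq J)) => uJ; last first.
  have -> : \det (mxr (@cols J n) u) = 0; last by rewrite big1.
  have [i [j [ij jn ne]]] := uniqPn ord0 uJ; rewrite sJ in jn.
  have lt2 k : (k < n)%N -> (k * 2 < n * 2)%N by rewrite ltn_pmul2r.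
  rewrite -det_tr; apply: (determinant_alternate
    (i1 := Ordinal (lt2 _ (ltn_trans ij jn))) (i2 := Ordinal (lt2 _ jn))).
    by rewrite -val_eqE /= eqn_pmul2r // ltn_eqF.
  by move=> k; rewrite !mxE /cols /= !muln2 !odd_double !doubleK ne.
rewrite (eq_bigl (fun b => b \in [predC J])) // sumr_const.
have E : (n + #|[predC J]| = n.+1)%N by rewrite -{1}sJ -(card_uniqP uJ) cardC card_ord.
by have -> : #|[predC J]| = 1%N by apply/eqP; rewrite -(eqn_add2l n) E addn1.
Qed.

End Columns.

Section WedgePowers.
Variables (R : realType) (n : nat).
Local Notation C := R[i].
Local Notation V := 'rV[C]_n.+1.
Implicit Types (H : 'M[C]_n.+1) (u : V) (Hx : V -> 'M[C]_n.+1).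

Definition conjv (v : V) : V := map_mx Num.conj v.

(* A real vector of [C^n], in the complex coordinates [(z, conj z)]. *)
Definition real_row (v : V) : 'rV[C]_(n.+1 + n.+1) := row_mx v (conjv v).

(** The Gram matrix is absorbed into the holomorphic half: on twisted rows the fundamental form
    becomes the standard one, i/2 times the sum of dz_k /\ d(conj z_k). *)
Definition twist H : 'M[C]_(n.+1 + n.+1) := block_mx H 0 0 1%:M.

Lemma real_twist v H : real_row v *m twist H = row_mx (v *m H) (conjv v).
Proof. by rewrite mul_row_block !mulmx0 addr0 add0r mulmx1. Qed.

Lemma det2 (A : 'M[C]_2) :
  \det A = A ord0 ord0 * A ord_max ord_max - A ord0 ord_max * A ord_max ord0.
Proof.
have e1 : lift ord0 ord0 = ord_max :> 'I_2 by exact: val_inj.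
have e2 : lift ord_max ord0 = ord0 :> 'I_2 by exact: val_inj.
rewrite (expand_det_row _ ord0) big_ord_recl big_ord1 /cofactor !det_mx11 !mxE.
by rewrite !e1 !e2 /= expr0 mul1r expr1 mulN1r mulrN.
Qed.

Lemma fundamental_formE Hx x (u : 'I_2 -> V) :
  fundamental_form Hx x u = 'i%C / 2%:R *
    \sum_k \det (mxr (@cols n [:: k] 1) (fun r => real_row (u r) *m twist (Hx x))).
Proof.
rewrite /fundamental_form; congr (_ * _).
have E v w : herm (Hx x) v w = \sum_k (v *m Hx x) 0 k * (w 0 k)^*.
  by rewrite /herm mxE; apply: eq_bigr => k _; rewrite !mxE.
rewrite !E -sumrB; apply: eq_bigr => k _.
have mE r c : mxr (@cols n [:: k] 1) (fun r => real_row (u r) *m twist (Hx x)) r c =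
    row_mx (u r *m Hx x) (conjv (u r)) 0 (@cols n [:: k] 1 c).
  by rewrite mxE real_twist.
rewrite [\det _]det2 !mE /cols /=.
by rewrite !row_mxEl !row_mxEr [conjv _ _ _]mxE [conjv _ _ _]mxE [X in _ - X]mulrC.
Qed.

Definition wedge_const (p : nat) : C :=
  \prod_(q < p) (((2`! * (q * 2)`!)%:R)^-1 * ('i%C / 2%:R * (block_perms 2 (q * 2))%:R)).

(** Each factor of the wedge power prepends one index to [J]; [laplace_blocks] merges its minor of
    size 2 with the one of size 2p. *)
Lemma wedge_powE Hx p x (u : 'I_(p * 2) -> V) :
  wedge_pow (fundamental_form Hx) p x u =
  wedge_const p * sumJ p (fun J =>
    \det (mxr (@cols n J p) (fun r => real_row (u r) *m twist (Hx x)))).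
Proof.
elim: p u => [|p IH] u /=.
  by rewrite /wedge_const big_ord0 mul1r det_mx00.
rewrite /wedge.
pose row r := real_row (u r) *m twist (Hx x).
pose M k J := mxr (@cols n (k :: J) p.+1) row.
transitivity (((2`! * (p * 2)`!)%:R)^-1 * ('i%C / 2%:R * wedge_const p) *
    \sum_(s : 'S_(2 + p * 2)) \sum_k sumJ p (fun J => (-1) ^+ s *
      \det (\matrix_(i < 2, j < 2) M k J (s (lshift (p * 2) i)) (lshift (p * 2) j)) *
      \det (\matrix_(i < p * 2, j < p * 2) M k J (s (rshift 2 i)) (rshift 2 j)))).
  rewrite -mulrA; congr (_ * _); rewrite mulr_sumr; apply: eq_bigr => s _.
  rewrite fundamental_formE IH.
  have comm : forall a b c d e : C, a * (b * c) * (d * e) = b * d * (a * c * e).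
    by move=> *; ring.
  rewrite comm; congr (_ * _); rewrite mulr_sumr mulr_suml; apply: eq_bigr => k _.
  rewrite -[LHS]sumJZ; apply: eq_sumJ => J sJ; apply: (f_equal2 *%R (f_equal2 *%R erefl _)).
    apply: (congr1 (fun A : 'M[C]_2 => \det A)); apply/matrixP => i j; rewrite !mxE; congr (_ _ _).
    by rewrite /cols /=; case: j => [[|[|]]].
  apply: (congr1 (fun A : 'M[C]_(p * 2) => \det A)); apply/matrixP => i j; rewrite !mxE; congr (_ _ _).
  by rewrite /cols /= negbK.
rewrite exchange_big /=.
under eq_bigr do rewrite sumJ_sum.
have -> : wedge_const p.+1 = ((2`! * (p * 2)`!)%:R)^-1 * ('i%C / 2%:R * wedge_const p) *
    (block_perms 2 (p * 2))%:R.
  rewrite /wedge_const big_ord_recr /=; move: (\prod_(_ < _) _) => w.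
  have comm : forall a b c d : C, a * (b * (c * d)) = b * (c * a) * d.
    by move=> *; ring.
  exact: comm.
rewrite -[RHS]mulrA; congr (_ * _); rewrite mulr_sumr; apply: eq_bigr => k _.
by rewrite -sumJZ; apply: eq_sumJ => J _; exact: laplace_blocks.
Qed.

Lemma wedge_const_neq0 p : wedge_const p != 0.
Proof.
apply/prodf_neq0 => q _; rewrite mulf_neq0 ?invr_eq0 ?pnatr_eq0 //.
  by rewrite -lt0n muln_gt0 !fact_gt0.
rewrite !mulf_neq0 ?invr_eq0 ?pnatr_eq0 //.
  by rewrite eq_complex /= oner_eq0 andbF.
by rewrite -lt0n block_perms_gt0.
Qed.

Lemma det_twist H : \det (twist H) = \det H.
Proof. by rewrite det_ublock det1 mulr1. Qed.

Lemma volume_formE Hx x (u : 'I_(n.+1 * 2) -> V) :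
  wedge_pow (fundamental_form Hx) n.+1 x u =
  wedge_const n.+1 * Cvol C n * \det (Hx x) * \det (mxr (@cols_id n) (fun r => real_row (u r))).
Proof.
rewrite wedge_powE vol_columns mxr_mulmx; [|by rewrite muln2 addnn|exact: cols_idI].
by rewrite det_twist; ring.
Qed.

(** The contraction of the top form dz_0 /\ d(conj z_0) /\ ... with the basis vectors of z_a and
    conj z_b. It does not depend on the point, so all derivatives fall on the adjugate. *)
Definition bal_vec (a b : 'I_n.+1) (u : 'I_(n * 2) -> V) : C :=
  \det (mxr (@cols_id n) (cons_row (eL C a) (cons_row (eR C b) (fun r => real_row (u r))))).

Lemma cons_row_mulmx k N (w : 'rV[C]_N) (u : 'I_k -> 'rV[C]_N) (Q : 'M[C]_N) :
  (fun r => cons_row w u r *m Q) = cons_row (w *m Q) (fun r => u r *m Q).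
Proof. by apply/funext => r; rewrite /cons_row; case: unlift. Qed.

Lemma eL_twist a H : eL C a *m twist H = \sum_b H a b *: eL C b.
Proof.
apply/rowP => c; rewrite summxE -rowE mxE.
rewrite -(splitK c); case: (fintype.split c) => j /=.
  rewrite block_mxEul (bigD1 j) //= big1 ?addr0 => [|b /negPf bj].
    by rewrite !mxE !eqxx mulr1.
  by rewrite !mxE eqxx eq_lshift eq_sym bj mulr0.
rewrite block_mxEur mxE big1 // => b _.
by rewrite !mxE eqxx eq_rlshift mulr0.
Qed.

Lemma eR_twist b H : eR C b *m twist H = eR C b.
Proof.
apply/rowP => c; rewrite -rowE mxE -(splitK c); case: (fintype.split c) => j /=.
  by rewrite block_mxEdl !mxE eqxx eq_lrshift.
by rewrite block_mxEdr !mxE eqxx eq_rshift eq_sym.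
Qed.

Lemma mxr_cons_linear k N (s : 'I_k.+1 -> 'I_N) (I : finType) (c : I -> C)
    (w : I -> 'rV[C]_N) (u : 'I_k -> 'rV[C]_N) :
  \det (mxr s (cons_row (\sum_i c i *: w i) u)) =
  \sum_i c i * \det (mxr s (cons_row (w i) u)).
Proof.
have E (v : 'rV[C]_N) : \det (mxr s (cons_row v u)) =
    \sum_j v 0 (s j) * cofactor (mxr s (cons_row 0 u)) ord0 j.
  rewrite (expand_det_row _ ord0); apply: eq_bigr => j _.
  rewrite mxE cons_row0; congr (_ * (_ * \det _)).
  by apply/matrixP => a b; rewrite !mxE !cons_rowS.
rewrite E; under [RHS]eq_bigr do rewrite E mulr_sumr.
rewrite exchange_big; apply: eq_bigr => j _.
rewrite summxE mulr_suml; apply: eq_bigr => i _.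
by rewrite mxE mulrA.
Qed.

(** The prepended row e_b is not twisted, so it is rewritten as the twist of the row b of H^-1; the
    factor det H that comes out of the full determinant turns H^-1 into the adjugate. *)
Lemma balanced_formE Hx x (u : 'I_(n * 2) -> V) : Hx x \in unitmx ->
  wedge_pow (fundamental_form Hx) n x u =
  wedge_const n * Cbal C n * \sum_a \sum_b (\adj (Hx x)) b a * bal_vec a b u.
Proof.
move=> Hu; set H := Hx x.
rewrite wedge_powE bal_columns -mulrA; congr (_ * (_ * _)).
have E b : \det (mxr (@cols_id n) (cons_row (eL C b) (cons_row (eR C b)
      (fun r => real_row (u r) *m twist H)))) =
    \sum_a (\adj H) b a * bal_vec a b u.
  have -> : eL C b = \sum_a (invmx H) b a *: (eL C a *m twist H).
    transitivity (eL C b *m twist (invmx H) *m twist H).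
      rewrite -mulmxA /twist mulmx_block !(mul0mx, mulmx0, addr0, add0r) mulmx1.
      by rewrite mulVmx // -scalar_mx_block mulmx1.
    by rewrite eL_twist mulmx_suml; apply: eq_bigr => a _; rewrite scalemxAl.
  rewrite mxr_cons_linear; apply: eq_bigr => a _.
  rewrite -{1}(eR_twist b H) -cons_row_mulmx -cons_row_mulmx.
  have kN : (n.+1 * 2 = n.+1 + n.+1)%N by rewrite muln2 addnn.
  rewrite mxr_mulmx; [|exact: kN|exact: cols_idI].
  rewrite det_twist /bal_vec /invmx Hu mxE.
  have d0 : \det H != 0 by rewrite -unitfE -unitmxE.
  have comm : forall d e f : C, d != 0 -> d^-1 * e * (f * d) = e * f.
    by move=> d e f dn0; field.
  exact: comm.
rewrite [RHS]exchange_big /=; apply: eq_bigr => b _; exact: E.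
Qed.

End WedgePowers.

(** * The balanced condition as equations on the adjugate *)

Section Cramer.
Variable F : numFieldType.

Lemma lift_lift0 k (i : 'I_k.+1) : lift (lift ord0 i) ord0 = ord0 :> 'I_k.+2.
Proof. exact: val_inj. Qed.

Lemma lift_liftS k (i : 'I_k.+1) (j : 'I_k) :
  lift (lift ord0 i) (lift ord0 j) = lift ord0 (lift i j) :> 'I_k.+2.
Proof. by apply: val_inj; rewrite /= /bump !add1n ltnS addnS. Qed.

Lemma cons_row_lift0 k N (w : 'rV[F]_N) (u : 'I_k -> 'rV[F]_N) :
  (fun j => cons_row w u (lift ord0 j)) = u.
Proof. by apply/funext => j; rewrite cons_rowS. Qed.

Lemma cons_row_lift k N (w : 'rV[F]_N) (u : 'I_k.+1 -> 'rV[F]_N) i :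
  (fun j => cons_row w u (lift (lift ord0 i) j)) = cons_row w (fun j => u (lift i j)).
Proof.
apply/funext => j; case: (unliftP ord0 j) => [j' ->|->].
  by rewrite lift_liftS !cons_rowS.
by rewrite lift_lift0 !cons_row0.
Qed.

(** The sum expands a determinant along its first column, which holds the values of the linear form
    [g] and is therefore a combination of the other columns. *)
Lemma cramer k N (s : 'I_k -> 'I_N) (W : 'I_k.+1 -> 'rV[F]_N) (g : 'cV[F]_N) :
  k = N -> injective s ->
  \sum_(r < k.+1) (-1) ^+ r * (W r *m g) 0 0 * \det (mxr s (fun j => W (lift r j))) = 0.
Proof.
move=> kN; subst N => si.
pose A : 'M[F]_k.+1 := \matrix_(r, c) oapp (fun c' => W r 0 (s c')) ((W r *m g) 0 0) (unlift ord0 c).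
transitivity (\det A).
  rewrite (expand_det_col _ ord0); apply: eq_bigr => r _.
  have -> : A r ord0 = (W r *m g) 0 0 by rewrite mxE unlift_none.
  rewrite /cofactor addn0 mulrCA mulrA; congr (_ * \det _).
  by apply/matrixP => i j; rewrite !mxE liftK.
pose z : 'rV[F]_k.+1 := \row_c oapp (fun c' => - g (s c') 0) 1 (unlift ord0 c).
have z0 : z 0 ord0 = 1 by rewrite mxE unlift_none.
have zS c : z 0 (lift ord0 c) = - g (s c) 0 by rewrite mxE liftK.
have A0 r : A r ord0 = (W r *m g) 0 0 by rewrite mxE unlift_none.
have AS r c : A r (lift ord0 c) = W r 0 (s c) by rewrite mxE liftK.
rewrite -det_tr; apply/eqP/det0P; exists z.
  by apply/eqP => /rowP/(_ ord0)/eqP; rewrite z0 mxE oner_eq0.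
apply/rowP => r; rewrite [RHS]mxE [LHS]mxE big_ord_recl z0 mul1r mxE A0 mxE.
rewrite (reindex_inj si) -big_split /= big1 // => c _.
by rewrite zS [A^T _ _]mxE AS mulNr [g _ _ * _]mulrC addrN.
Qed.

End Cramer.

Section RealFrame.
Variables (R : realType) (n : nat).
Local Notation C := R[i].
Local Notation V := 'rV[C]_n.+1.

Definition frame (r : 'I_(n.+1 * 2)) : V :=
  if odd r then 'i%C *: delta_mx 0 (inord r./2) else delta_mx 0 (inord r./2).

Lemma conjv_delta k : conjv (delta_mx 0 k : V) = delta_mx 0 k.
Proof. by apply/rowP => j; rewrite !mxE rmorph_nat. Qed.

Lemma conjvZ (a : C) (v : V) : conjv (a *: v) = a^* *: conjv v.
Proof. by apply/rowP => j; rewrite !mxE rmorphM. Qed.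

Lemma conj_i : ('i%C : C)^* = - 'i%C.
Proof. by apply: eqCP; rewrite /= ?oppr0. Qed.

(** The real frame e_k, i e_k is the standard frame times [Q], which is invertible since
    [Q *m Q' = 2]. *)
Lemma frame_det : \det (mxr (@cols_id n) (fun r => real_row (frame r))) != 0.
Proof.
pose I : 'M[C]_n.+1 := 'i%C%:M.
pose Q : 'M[C]_(n.+1 + n.+1) := block_mx 1%:M 1%:M I (- I).
pose Q' : 'M[C]_(n.+1 + n.+1) := block_mx 1%:M (- I) 1%:M I.
have II : I *m I = - 1%:M.
  by rewrite -scalar_mxM -expr2 sqr_i; apply/matrixP => i j; rewrite !mxE mulNrn.
have QQ : Q *m Q' = 2%:M.
  rewrite mulmx_block !mul1mx !mulmx1 !mulNmx mulmxN II opprK addNr subrr.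
  have e2 : 1%:M + 1%:M = 2%:M :> 'M[C]_n.+1.
    by apply/matrixP => i j; rewrite !mxE -mulrnDl.
  by rewrite e2 -scalar_mx_block.
have dQ : \det Q != 0.
  apply/negP => /eqP Q0; have : \det (Q *m Q') = 0 by rewrite det_mulmx Q0 mul0r.
  by rewrite QQ det_scalar => /eqP; rewrite expf_eq0 pnatr_eq0 andbF.
pose E (r : 'I_(n.+1 * 2)) : 'rV[C]_(n.+1 + n.+1) := delta_mx 0 (@cols_id n r).
have kN : (n.+1 * 2 = n.+1 + n.+1)%N by rewrite muln2 addnn.
have -> : (fun r => real_row (frame r)) = (fun r => E r *m Q).
  apply/funext => r; rewrite /E -rowE /frame /cols_id; case: (odd r).
    rewrite /real_row conjvZ conjv_delta conj_i.
    apply/rowP => c; rewrite [RHS]mxE -(splitK c); case: (fintype.split c) => j /=.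
      by rewrite row_mxEl block_mxEdl !mxE eqxx eq_sym mulr_natr.
    by rewrite row_mxEr block_mxEdr !mxE eqxx eq_sym mulNr mulr_natr.
  rewrite /real_row conjv_delta.
  apply/rowP => c; rewrite [RHS]mxE -(splitK c); case: (fintype.split c) => j /=.
    by rewrite row_mxEl block_mxEul !mxE eqxx eq_sym.
  by rewrite row_mxEr block_mxEur !mxE eqxx eq_sym.
rewrite mxr_mulmx; [|exact: kN|exact: cols_idI].
rewrite (_ : mxr _ _ = 1%:M) ?det1 ?mul1r //.
by apply/matrixP => i j; rewrite !mxE eqxx (inj_eq (@cols_idI n)) eq_sym.
Qed.

(** Real vectors span the complexified space. In [cramer], applied to [xi] followed by the frame,
    every term but the first contains [xi] in its minor and vanishes, which isolates the coordinates
    of [xi]. *)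
Lemma real_rows_nondegenerate (xi : 'rV[C]_(n.+1 + n.+1)) :
  (forall u : 'I_(n * 2).+1 -> V,
    \det (mxr (@cols_id n) (cons_row xi (fun r => real_row (u r)))) = 0) -> xi = 0.
Proof.
move=> H; apply/rowP => c; rewrite [RHS]mxE.
pose T r := real_row (frame r).
have kN : (n.+1 * 2 = n.+1 + n.+1)%N by rewrite muln2 addnn.
have := @cramer _ (n.+1 * 2) _ (@cols_id n) (cons_row xi T) (delta_mx c 0) kN (@cols_idI n).
rewrite big_ord_recl cons_row0 cons_row_lift0 big1 => [|i _].
  rewrite addr0 expr0 mul1r => /eqP; rewrite mulf_eq0 (negPf frame_det) orbF => /eqP.
  by rewrite -colE mxE.
rewrite [X in \det (mxr _ X)](_ : _ = cons_row xi (fun j => T (lift i j))); last exact: cons_row_lift.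
by rewrite (H (fun j => frame (lift i j))) mulr0.
Qed.

End RealFrame.

Section Wirtinger.
Variables (R : realType) (n : nat).
Local Notation C := R[i].
Implicit Types (f : 'rV[C]_n -> C) (U : set 'rV[C]_n) (x v : 'rV[C]_n).

Definition dz j f x : C :=
  (rderiv f (delta_mx 0 j) x - 'i%C * rderiv f ('i%C *: delta_mx 0 j) x) / 2%:R.
Definition dzb j f x : C :=
  (rderiv f (delta_mx 0 j) x + 'i%C * rderiv f ('i%C *: delta_mx 0 j) x) / 2%:R.

Lemma rderiv_wirtinger f U x v : open U -> U x -> class_C 1 U f ->
  rderiv f v x = \sum_j (v 0 j * dz j f x + (v 0 j)^* * dzb j f x).
Proof.
move=> oU Ux cf; rewrite (rderiv_rgrad _ oU Ux cf) /rgrad.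
rewrite -(pair_bigA _ (fun j b => (rcoord (j, b) v)%:C * rderiv f (rbasis R (j, b)) x)) /=.
apply: eq_bigr => j _; rewrite big_bool /rcoord /rbasis /= /dz /dzb.
move: (rderiv f _ x) (rderiv f _ x) (v 0 j) => a b z.
have -> : (re z)%:C = (z + z^*) / 2%:R by exact: ReJ_add.
have -> : (im z)%:C = (z^* - z) / 2%:R * 'i%C by exact: ImJ_sub.
by field.
Qed.

Lemma has_rderiv_sum (I : Type) (r : seq I) (P : pred I) (f : I -> 'rV[C]_n -> C) x v (D : I -> C) :
  (forall i, P i -> has_rderiv (f i) v x (D i)) ->
  has_rderiv (fun y => \sum_(i <- r | P i) f i y) v x (\sum_(i <- r | P i) D i).
Proof.
move=> H; elim: r => [|i r IH].
  rewrite big_nil (_ : (fun y => _) = (fun=> 0)); first exact: has_rderiv_cst.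
  by apply/funext => y; rewrite big_nil.
rewrite big_cons (_ : (fun y => _) = (fun y => if P i then
    f i y + \sum_(j <- r | P j) f j y else \sum_(j <- r | P j) f j y)); last first.
  by apply/funext => y; rewrite big_cons.
case Pi: (P i) => //; apply: has_rderivD => //; exact: H.
Qed.

End Wirtinger.

Section BalancedPDE.
Variables (R : realType) (n : nat).
Local Notation C := R[i].
Local Notation V := 'rV[C]_n.+1.
Implicit Types (Hx : V -> 'M[C]_n.+1) (U : set V).

(** The vector whose contraction with the top form is, up to a constant, the exterior derivative of
    the n-th power; the complex dimension is n + 1. *)
Definition bal_defect Hx x : 'rV[C]_(n.+1 + n.+1) :=
  \sum_a (\sum_b dzb b (fun y => (\adj (Hx y)) b a) x) *: eL C a +
  \sum_b (- \sum_a dz a (fun y => (\adj (Hx y)) b a) x) *: eR C b.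

Lemma mxr_cons_add k N (s : 'I_k.+1 -> 'I_N) (w1 w2 : 'rV[C]_N) (u : 'I_k -> 'rV[C]_N) :
  \det (mxr s (cons_row (w1 + w2) u)) =
  \det (mxr s (cons_row w1 u)) + \det (mxr s (cons_row w2 u)).
Proof.
have := mxr_cons_linear s (fun _ : bool => 1) (fun i : bool => if i then w1 else w2) u.
by rewrite !big_bool /= !scale1r !mul1r.
Qed.

Lemma row_delta_sum (c d : 'I_n.+1 -> C) :
  \sum_a c a *: eL C a + \sum_b d b *: eR C b = row_mx (\row_a c a) (\row_b d b).
Proof.
apply/rowP => j; rewrite mxE !summxE -(splitK j); case: (fintype.split j) => i /=.
  rewrite row_mxEl mxE [X in _ + X]big1 ?addr0 => [|b _].
    rewrite (bigD1 i) //= big1 ?addr0 => [|a /negPf ai].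
      by rewrite !mxE !eqxx mulr1.
    by rewrite !mxE eqxx eq_lshift eq_sym ai mulr0.
  by rewrite !mxE eqxx eq_lrshift mulr0.
rewrite row_mxEr mxE big1 ?add0r => [|b _].
  rewrite (bigD1 i) //= big1 ?addr0 => [|a /negPf ai].
    by rewrite !mxE !eqxx mulr1.
  by rewrite !mxE eqxx eq_rshift eq_sym ai mulr0.
by rewrite !mxE eqxx eq_rlshift mulr0.
Qed.

Lemma ext_d_balanced Hx U x (u : 'I_(n * 2).+1 -> V) : open U -> U x ->
  (forall i j, class_C 1 U (fun y => Hx y i j)) ->
  (forall y, U y -> Hx y \in unitmx) ->
  ext_d (wedge_pow (fundamental_form Hx) n) x u =
  wedge_const R n * Cbal C n *
    \det (mxr (@cols_id n) (cons_row (bal_defect Hx x) (fun r => real_row (u r)))).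
Proof.
move=> oU Ux cH uH.
have cq b a : class_C 1 U (fun y => (\adj (Hx y)) b a) by exact: cC_adj.
set k := wedge_const R n * Cbal C n.
pose D i b a := rderiv (fun y => (\adj (Hx y)) b a) (u i) x.
have E (i : 'I_(n * 2).+1) : rderiv (fun y => wedge_pow (fundamental_form Hx) n y (fun j => u (lift i j))) (u i) x =
    k * \sum_a \sum_b D i b a * bal_vec a b (fun j => u (lift i j)).
  apply: (@has_rderivP _ _ _ _ _ _ _).2.
  apply: (@has_rderiv_near _ _ (fun y => k * \sum_a \sum_b (\adj (Hx y)) b a *
      bal_vec a b (fun j => u (lift i j))) _ U) => //.
    by move=> y Uy; rewrite balanced_formE //; exact: uH.
  rewrite -[X in has_rderiv _ _ _ X](add0r) -[X in has_rderiv _ _ _ (X + _)](mul0r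
     (\sum_a \sum_b (\adj (Hx x)) b a * bal_vec a b (fun j => u (lift i j)))).
  apply: has_rderivM; first exact: has_rderiv_cst.
  apply: has_rderiv_sum => a _; apply: has_rderiv_sum => b _.
  rewrite -[X in has_rderiv _ _ _ X](addr0) -[X in has_rderiv _ _ _ (_ + X)](mulr0 ((\adj (Hx x)) b a)).
  apply: has_rderivM; last exact: has_rderiv_cst.
  exact: (cC_has _ (cq b a)).
(* [cramer] for e_a, conj e_b and the vectors [u], with [g] the complex gradient of the entry (b,
   a): the sum over [u] equals minus the two terms in which [g] is evaluated at e_a and conj e_b. *)
have Cr b a : \sum_(i < (n * 2).+1) (-1) ^+ i * (D i b a * bal_vec a b (fun j => u (lift i j))) =
    dzb b (fun y => (\adj (Hx y)) b a) x *
      \det (mxr (@cols_id n) (cons_row (eL C a) (fun r => real_row (u r)))) -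
    dz a (fun y => (\adj (Hx y)) b a) x *
      \det (mxr (@cols_id n) (cons_row (eR C b) (fun r => real_row (u r)))).
  set q := fun y => (\adj (Hx y)) b a.
  pose g : 'cV[C]_(n.+1 + n.+1) := col_mx (\col_j dz j q x) (\col_j dzb j q x).
  have kN : (n.+1 * 2 = n.+1 + n.+1)%N by rewrite muln2 addnn.
  have := @cramer _ (n.+1 * 2) _ (@cols_id n)
    (cons_row (eL C a) (cons_row (eR C b) (fun r => real_row (u r)))) g kN (@cols_idI n).
  have gL : (eL C a *m g) 0 0 = dz a q x by rewrite -rowE mxE col_mxEu mxE.
  have gR : (eR C b *m g) 0 0 = dzb b q x by rewrite -rowE mxE col_mxEd mxE.
  have gU i : (real_row (u i) *m g) 0 0 = D i b a.
    rewrite /D (rderiv_wirtinger (u i) oU Ux (cq b a)) mul_row_col !mxE -big_split /=.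
    by apply: eq_bigr => j _; rewrite !mxE.
  rewrite big_ord_recl big_ord_recl cons_row0 cons_rowS cons_row0 gL gR.
  rewrite cons_row_lift0.
  set W := fun r => real_row (u r).
  have e1 : (fun j => cons_row (eL C a) (cons_row (eR C b) W) (lift (lift ord0 ord0) j)) =
      cons_row (eL C a) W.
    by have := cons_row_lift (eL C a) (cons_row (eR C b) W) ord0; rewrite cons_row_lift0.
  have e2 i : (fun j => cons_row (eL C a) (cons_row (eR C b) W)
        (lift (lift ord0 (lift ord0 i)) j)) =
      cons_row (eL C a) (cons_row (eR C b) (fun j => real_row (u (lift i j)))).
    have := cons_row_lift (eL C a) (cons_row (eR C b) W) (lift ord0 i).
    by rewrite (cons_row_lift (eR C b) W i).
  rewrite e1 expr0 mul1r expr1 mulN1r.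
  rewrite [X in _ + (_ + X)](_ : _ = \sum_(i < (n * 2).+1) (-1) ^+ i *
      (D i b a * bal_vec a b (fun j => u (lift i j)))); last first.
    by apply: eq_bigr => i _; rewrite e2 !cons_rowS gU /= /bump !add1n !exprS !mulN1r opprK -mulrA.
  move: (\sum_(i < _) _) => S H; rewrite -[LHS]subr0 -H; ring.
rewrite /ext_d.
transitivity (k * \sum_a \sum_b \sum_(i < (n * 2).+1) (-1) ^+ i *
    (D i b a * bal_vec a b (fun j => u (lift i j)))).
  under eq_bigr => i _ do rewrite E mulrCA.
  rewrite -mulr_sumr; congr (_ * _).
  under eq_bigr => i _ do rewrite mulr_sumr.
  rewrite exchange_big /=; apply: eq_bigr => a _.
  under eq_bigr => i _ do rewrite mulr_sumr.
  by rewrite exchange_big.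
congr (_ * _); under eq_bigr => a _ do under eq_bigr => b _ do rewrite Cr.
rewrite /bal_defect mxr_cons_add !mxr_cons_linear.
under eq_bigr => a _ do rewrite big_split /=.
rewrite big_split /=; congr (_ + _).
  by apply: eq_bigr => a _; rewrite mulr_suml.
rewrite exchange_big /=; apply: eq_bigr => b _; rewrite mulNr mulr_suml -sumrN.
by [].
Qed.

Lemma closed_balancedP Hx U : open U ->
  (forall i j, class_C 1 U (fun y => Hx y i j)) ->
  (forall y, U y -> Hx y \in unitmx) ->
  closed_on U (wedge_pow (fundamental_form Hx) n) <->
  forall x, U x ->
    (forall b, \sum_a dz a (fun y => (\adj (Hx y)) b a) x = 0) /\
    (forall a, \sum_b dzb b (fun y => (\adj (Hx y)) b a) x = 0).
Proof.
move=> oU cH uH.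
have k0 : wedge_const R n * Cbal C n != 0.
  by rewrite mulf_neq0 ?wedge_const_neq0 // gt_eqF // Cbal_gt0.
have dE x : bal_defect Hx x = row_mx
    (\row_a \sum_b dzb b (fun y => (\adj (Hx y)) b a) x)
    (\row_b - \sum_a dz a (fun y => (\adj (Hx y)) b a) x).
  exact: row_delta_sum.
split=> [cl x Ux|H x u Ux].
  have : bal_defect Hx x = 0.
    apply: real_rows_nondegenerate => u; have := cl x u Ux.
    rewrite (ext_d_balanced _ oU) // => /eqP; rewrite mulf_eq0 (negPf k0) => /eqP //.
  have Z : (0 : 'rV[C]_(n.+1 + n.+1)) = row_mx 0 0 by rewrite row_mx0.
  rewrite dE Z => /eq_row_mx[/rowP h1 /rowP h2].
  split=> [b|a]; first by have := h2 b; rewrite !mxE => /eqP; rewrite oppr_eq0 => /eqP.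
  by have := h1 a; rewrite !mxE.
rewrite (ext_d_balanced _ oU) //.
have -> : bal_defect Hx x = 0.
  have [h1 h2] := H x Ux; rewrite dE -[RHS]row_mx0; congr row_mx.
    by apply/rowP => a; rewrite !mxE h2.
  by apply/rowP => a; rewrite !mxE h1 oppr0.
rewrite (_ : \det _ = 0) ?mulr0 // (expand_det_row _ ord0) big1 // => c _.
by rewrite mxE cons_row0 mxE mul0r.
Qed.

End BalancedPDE.

(** * Transition maps *)

Lemma near_diff (R : realType) (V W : normedModType R[i]) (U : set V) (f g : V -> W) x :
  open U -> U x -> (forall y, U y -> f y = g y) -> differentiable f x ->
  'd g x = 'd f x :> (V -> W).
Proof.
move=> oU Ux fg df.
have /nbhs_ballP[_ /= /gt0_realC[d d0 ->] Hd] := open_nbhs_nbhs (conj oU Ux).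
apply: (@diff_intro _ _ _ g x ('d f x) (diff_continuous df) _).2.
move=> e /(diff_eps df)[_ /gt0_realC[r r0 ->] Hr].
exists (Num.min d r)%:C; first by rewrite ltcR lt_min d0.
move=> h; rewrite normV_re ltcR lt_min => /andP[hd hr].
rewrite -!fg //; first by rewrite -normV_re; apply: Hr; rewrite normV_re ltcR.
by apply: Hd; rewrite -ball_normE /= opprD addrA subrr sub0r normrN normV_re ltcR.
Qed.

Lemma near_diff_comp (R : realType) (V W Z : normedModType R[i]) (U : set V)
    (F : V -> W) (G : W -> Z) (h : V -> Z) x v : open U -> U x ->
  (forall y, U y -> G (F y) = h y) ->
  differentiable F x -> differentiable G (F x) ->
  'd h x v = 'd G (F x) ('d F x v).
Proof.
move=> oU Ux FG dF dG.
have E := @near_diff R V Z U (G \o F) h x oU Ux FG (differentiable_comp dF dG).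
by rewrite (congr1 (fun k => k v) E) (congr1 (fun k => k v) (diff_comp dF dG)).
Qed.

Section HermAlgebra.
Variables (R : realType) (n : nat).
Implicit Types (A B H J : 'M[R[i]]_n) (v w : 'rV[R[i]]_n).

Definition mxstar m p (A : 'M[R[i]]_(m, p)) : 'M[R[i]]_(p, m) := (map_mx Num.conj A)^T.

Lemma mxstarM m p q (A : 'M[R[i]]_(m, p)) (B : 'M[R[i]]_(p, q)) :
  mxstar (A *m B) = mxstar B *m mxstar A.
Proof. by rewrite /mxstar map_mxM trmx_mul. Qed.

Lemma mxstarK m p (A : 'M[R[i]]_(m, p)) : mxstar (mxstar A) = A.
Proof. by apply/matrixP => i j; rewrite !mxE conjCK. Qed.

Lemma det_mxstar A : \det (mxstar A) = (\det A)^*.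
Proof. by rewrite /mxstar det_tr det_map_mx. Qed.

Lemma mxstar_delta (i : 'I_n) : mxstar (delta_mx 0 i : 'rV_n) = delta_mx i 0.
Proof. by apply/matrixP => a b; rewrite !mxE rmorph_nat andbC. Qed.

Lemma hermE H v w : herm H v w = (v *m H *m mxstar w) 0 0. Proof. by []. Qed.

Lemma herm_mulmx H J v w : herm H (v *m J) (w *m J) = herm (J *m H *m mxstar J) v w.
Proof. by rewrite !hermE mxstarM !mulmxA. Qed.

Lemma herm_inj A B : (forall v w, herm A v w = herm B v w) -> A = B.
Proof.
move=> H; apply/matrixP => i j; have := H (delta_mx 0 i) (delta_mx 0 j).
by rewrite !hermE !mxstar_delta -!rowE -!colE !mxE.
Qed.

Lemma hermsymmP A : reflect (A = mxstar A) (A \is hermsymmx).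
Proof.
apply: (iffP (is_hermitianmxP _ _ _)); rewrite /= expr0 scale1r => {1}->.
  by rewrite /mxstar map_trmx.
by rewrite /mxstar -map_trmx.
Qed.

Lemma hermsymm_conj H J : H \is hermsymmx -> J *m H *m mxstar J \is hermsymmx.
Proof.
move=> /hermsymmP hH; apply/hermsymmP.
by rewrite !mxstarM mxstarK -hH mulmxA.
Qed.

End HermAlgebra.

Lemma mulmx_eq (K : comPzRingType) m n (A B : 'M[K]_(m, n)) :
  (forall v : 'rV_m, v *m A = v *m B) -> A = B.
Proof. by move=> AB; apply/row_matrixP => i; rewrite !rowE; exact: AB. Qed.

Lemma diff_id_eq (R : realType) (V : normedModType R[i]) (x : V) : 'd id x = id :> (V -> V).
Proof. exact: (@diff_lin _ _ _ idfun x (fun y => cvg_id)). Qed.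

Section Transitions.
Variables (R : realType) (n : nat) (M : complexManifold R n).
Implicit Types (phi psi : M -> M) (c d e : chart R n M) (x : 'rV[R[i]]_n).

Definition tr phi c d x : 'rV[R[i]]_n := cmap d (phi (cinv c x)).

Definition trdom phi c d : set 'rV[R[i]]_n :=
  [set x | cimg c x /\ cdom d (phi (cinv c x))].

(** Vectors are rows, so Jacobians act on the right and the factors of a composite appear in the
    order of application. *)
Definition jac phi c d x : 'M[R[i]]_n := lin1_mx ('d (tr phi c d) x).

Lemma jacE phi c d x v : v *m jac phi c d x = 'd (tr phi c d) x v.
Proof. exact: mul_rV_lin1. Qed.

Lemma tr_img phi c d x : trdom phi c d x -> cimg d (tr phi c d x).
Proof. by move=> [_ /cmapP[]]. Qed.

Lemma tr_inv phi c d x : trdom phi c d x -> cinv d (tr phi c d x) = phi (cinv c x).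
Proof. by move=> [_ /cmapP[]]. Qed.

Lemma trdom_open phi c d : continuous phi -> open (trdom phi c d).
Proof.
move=> cphi; rewrite openE => x [cx dx].
have h1 : nbhs x (cimg c) by apply: open_nbhs_nbhs; split => //; exact: cimg_open.
have h2 : nbhs x ((phi \o cinv c) @^-1` cdom d).
  have cf : {for x, continuous (phi \o cinv c)}.
    exact: (continuous_comp (cinv_cont cx) (cphi _)).
  by apply: cf; apply: open_nbhs_nbhs; split => //; exact: cdom_open.
by rewrite /interior; apply: filterS (filterI h1 h2) => y [].
Qed.

Lemma tr_diff phi c d x : holomorphic phi -> atlas c -> atlas d -> trdom phi c d x ->
  differentiable (tr phi c d) x.
Proof. by move=> [_ hphi] cM dM [cx dx]; exact: hphi. Qed.

Lemma jac_chain phi psi c e d x : holomorphic phi -> holomorphic psi ->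
  atlas c -> atlas e -> atlas d -> trdom phi c e x -> trdom psi e d (tr phi c e x) ->
  jac (psi \o phi) c d x = jac phi c e x *m jac psi e d (tr phi c e x).
Proof.
move=> hphi hpsi cM eM dM xe xd.
have h1 := tr_diff hphi cM eM xe; have h2 := tr_diff hpsi eM dM xd.
apply: mulmx_eq => v.
rewrite (jacE (psi \o phi) c d x v) (mulmxA v) (jacE phi c e x v).
rewrite (jacE psi e d (tr phi c e x) ('d (tr phi c e) x v)).
have fg y : trdom phi c e y -> (tr psi e d \o tr phi c e) y = tr (psi \o phi) c d y.
  by move=> ye; rewrite /= {1}/tr tr_inv.
exact: (@near_diff_comp _ _ _ _ _ (tr phi c e) (tr psi e d) _ x v (@trdom_open phi c e hphi.1) xe fg h1 h2).
Qed.

Lemma trdom_comp phi psi c e d x : trdom phi c e x ->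
  trdom (psi \o phi) c d x -> trdom psi e d (tr phi c e x).
Proof.
by move=> xe [cx dx]; split; [exact: tr_img|rewrite tr_inv].
Qed.

Lemma tr_comp phi psi c e d x : trdom phi c e x ->
  tr psi e d (tr phi c e x) = tr (psi \o phi) c d x.
Proof. by move=> xe; rewrite {1}/tr tr_inv. Qed.

Lemma jac_id c x : cimg c x -> jac idfun c c x = 1%:M.
Proof.
move=> cx; apply: mulmx_eq => v; rewrite (jacE idfun c c x v) mulmx1.
have fg y : cimg c y -> id y = tr idfun c c y by move=> /cinvP[].
have := near_diff (@cimg_open _ _ _ c) cx fg (@linear_differentiable _ _ _ idfun x (fun y => cvg_id)).
by move=> /(congr1 (fun g => g v)) ->; rewrite diff_id_eq.
Qed.

Lemma jac_unit phi psi c d x : holomorphic phi -> holomorphic psi -> cancel phi psi ->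
  atlas c -> atlas d -> trdom phi c d x -> jac phi c d x \in unitmx.
Proof.
move=> hphi hpsi K cM dM xd.
have xc : trdom (psi \o phi) c c x.
  by split; [exact: xd.1|rewrite /= K; exact: (cinvP xd.1).1].
have := jac_chain hphi hpsi cM dM cM xd (trdom_comp xd xc).
rewrite (_ : psi \o phi = idfun); last by apply/funext => p; rewrite /= K.
rewrite jac_id; last exact: xd.1.
by move=> H; have [J1 _] := mulmx1_unit (esym H).
Qed.

End Transitions.

(** * Piola's identity *)

Section Dz.
Variables (R : realType) (n : nat).
Local Notation C := R[i].
Implicit Types (f g : 'rV[C]_n -> C) (U : set 'rV[C]_n) (x v : 'rV[C]_n) (j : 'I_n).

Definition has_dz j f x c := exists p q : C,
  [/\ has_rderiv f (delta_mx 0 j) x p, has_rderiv f ('i%C *: delta_mx 0 j) x q &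
      c = (p - 'i%C * q) / 2%:R].

Lemma has_dzE j f x c : has_dz j f x c -> dz j f x = c.
Proof.
by move=> [p [q [/has_rderivP[_ hp] /has_rderivP[_ hq] ->]]]; rewrite /dz hp hq.
Qed.

Lemma cC_has_dz j f U x : open U -> U x -> class_C 1 U f -> has_dz j f x (dz j f x).
Proof.
move=> oU Ux cf; exists (rderiv f (delta_mx 0 j) x), (rderiv f ('i%C *: delta_mx 0 j) x).
by split; [exact: cC_has cf Ux|exact: cC_has cf Ux|].
Qed.

Lemma has_dz_cst j x c : has_dz j (fun=> c) x 0.
Proof.
exists 0, 0; split; [exact: has_rderiv_cst|exact: has_rderiv_cst|].
by rewrite mulr0 subr0 mul0r.
Qed.

Lemma has_dzD j f g x c d : has_dz j f x c -> has_dz j g x d ->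
  has_dz j (fun y => f y + g y) x (c + d).
Proof.
move=> [p [q [hp hq ->]]] [p' [q' [hp' hq' ->]]]; exists (p + p'), (q + q').
split; [exact: has_rderivD|exact: has_rderivD|].
by rewrite -mulrDl mulrDr opprD addrACA.
Qed.

Lemma has_dzM j f g x c d : has_dz j f x c -> has_dz j g x d ->
  has_dz j (fun y => f y * g y) x (c * g x + f x * d).
Proof.
move=> [p [q [hp hq ->]]] [p' [q' [hp' hq' ->]]].
exists (p * g x + f x * p'), (q * g x + f x * q').
split; [exact: has_rderivM|exact: has_rderivM|].
ring.
Qed.

Lemma has_dz_near j f g U x c : open U -> U x -> (forall y, U y -> f y = g y) ->
  has_dz j f x c -> has_dz j g x c.
Proof.
move=> oU Ux fg [p [q [hp hq ->]]]; exists p, q.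
split; [exact: (has_rderiv_near oU Ux fg hp)|exact: (has_rderiv_near oU Ux fg hq)|by []].
Qed.

Lemma has_dz_sum (I : Type) (r : seq I) (P : pred I) j (f : I -> 'rV[C]_n -> C) x (D : I -> C) :
  (forall i, P i -> has_dz j (f i) x (D i)) ->
  has_dz j (fun y => \sum_(i <- r | P i) f i y) x (\sum_(i <- r | P i) D i).
Proof.
move=> H; elim: r => [|i r IH].
  rewrite big_nil (_ : (fun y => _) = (fun=> 0)); first exact: has_dz_cst.
  by apply/funext => y; rewrite big_nil.
rewrite big_cons (_ : (fun y => _) = (fun y => if P i then
    f i y + \sum_(j <- r | P j) f j y else \sum_(j <- r | P j) f j y)); last first.
  by apply/funext => y; rewrite big_cons.
by case Pi: (P i); [exact: (has_dzD (H i Pi) IH)|exact: IH].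
Qed.

Lemma has_dz_prod j k (f : 'I_k -> 'rV[C]_n -> C) x (D : 'I_k -> C) :
  (forall i, has_dz j (f i) x (D i)) ->
  has_dz j (fun y => \prod_i f i y) x
    (\sum_i \prod_l (if l == i then D l else f l x)).
Proof.
elim: k f D => [|k IH] f D H.
  rewrite big_ord0 (_ : (fun y => _) = (fun=> 1)); first exact: has_dz_cst.
  by apply/funext => y; rewrite big_ord0.
rewrite (_ : (fun y => _) = (fun y => f ord0 y * \prod_i f (lift ord0 i) y)); last first.
  by apply/funext => y; rewrite big_ord_recl.
have := has_dzM (H ord0) (IH (fun i => f (lift ord0 i)) (fun i => D (lift ord0 i)) (fun i => H _)).
congr has_dz; rewrite [RHS]big_ord_recl; congr (_ + _).
  by rewrite [RHS]big_ord_recl.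
by rewrite mulr_sumr; apply: eq_bigr => i _; rewrite [RHS]big_ord_recl; congr (_ * _).
Qed.

(** Jacobi's formula: differentiating the factor of row i in each product replaces that row by its
    derivative, and the resulting determinant is expanded along it. *)
Lemma has_dz_det j k (A : 'rV[C]_n -> 'M[C]_k) x (D : 'M[C]_k) :
  (forall i l, has_dz j (fun y => A y i l) x (D i l)) ->
  has_dz j (fun y => \det (A y)) x (\tr (D *m \adj (A x))).
Proof.
move=> H.
have -> : \tr (D *m \adj (A x)) = \sum_(s : 'S_k) ((-1) ^+ s *
    \sum_i \prod_l (if l == i then D l (s l) else A x l (s l))).
  under [RHS]eq_bigr do rewrite mulr_sumr.
  rewrite exchange_big; apply: eq_bigr => i _.
  pose B := \matrix_(l, c) (if l == i then D l c else A x l c).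
  transitivity (\det B); last first.
    by apply: eq_bigr => s _; congr (_ * _); apply: eq_bigr => l _; rewrite mxE.
  rewrite (expand_det_row B i) mxE; apply: eq_bigr => c _.
  rewrite !mxE eqxx; congr (_ * _); rewrite /cofactor; congr (_ * \det _).
  by apply/matrixP => a b; rewrite !mxE eq_sym (negPf (neq_lift _ _)).
apply: has_dz_sum => s _.
have := has_dzM (has_dz_cst j x ((-1) ^+ s)) (has_dz_prod (fun i => H i (s i))).
by rewrite mul0r add0r.
Qed.

Lemma has_dz_holo j f x : differentiable f x -> has_dz j f x ('d f x (delta_mx 0 j)).
Proof.
move=> df; exists ('d f x (delta_mx 0 j)), ('d f x ('i%C *: delta_mx 0 j)).
split; [exact: line_eps|exact: line_eps|].
rewrite (linearZC ('d f x) 'i%C) mulrA -expr2 sqr_i mulN1r opprK.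
by rewrite -mulr2n -[_ *+ 2]mulr_natr mulfK // pnatr_eq0.
Qed.

Lemma has_dz_conj_holo j f x : differentiable f x -> has_dz j (fun y => (f y)^*) x 0.
Proof.
move=> df; exists ('d f x (delta_mx 0 j))^*, ('d f x ('i%C *: delta_mx 0 j))^*.
split; [apply: has_rderiv_conj; exact: line_eps|apply: has_rderiv_conj; exact: line_eps|].
by rewrite (linearZC ('d f x) 'i%C) rmorphM /= conj_i mulrA mulrN -expr2 sqr_i opprK mul1r subrr mul0r.
Qed.

End Dz.

(** The differential of [G] is complex linear, so in the combination defining d/dz_j the
    antiholomorphic derivatives of [f] cancel. *)
Lemma has_dz_comp (R : realType) m n (f : 'rV[R[i]]_n -> R[i]) U
    (G : 'rV[R[i]]_m -> 'rV[R[i]]_n) x j : open U -> U (G x) -> class_C 1 U f ->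
  differentiable G x ->
  has_dz j (fun y => f (G y)) x (\sum_l 'd G x (delta_mx 0 j) 0 l * dz l f (G x)).
Proof.
move=> oU UG cf dG.
have E v := has_rderiv_comp v oU UG cf dG.
have E1 v : has_rderiv (f \o G) v x (\sum_l ('d G x v 0 l * dz l f (G x) + ('d G x v 0 l)^* * dzb l f (G x))).
  by rewrite -(rderiv_wirtinger _ oU UG cf) (rderiv_rgrad _ oU UG cf); exact: E.
exists (\sum_l ('d G x (delta_mx 0 j) 0 l * dz l f (G x) + ('d G x (delta_mx 0 j) 0 l)^* * dzb l f (G x))).
exists (\sum_l ('d G x ('i%C *: delta_mx 0 j) 0 l * dz l f (G x) + ('d G x ('i%C *: delta_mx 0 j) 0 l)^* * dzb l f (G x))).
split; [exact: E1|exact: E1|].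
rewrite mulr_sumr -sumrB mulr_suml; apply: eq_bigr => l _.
have -> : 'd G x ('i%C *: delta_mx 0 j) 0 l = 'i%C * 'd G x (delta_mx 0 j) 0 l.
  by rewrite linearZ mxE.
rewrite rmorphM /= conj_i.
move: ('d G x _ 0 l) (dz _ _ _) (dzb _ _ _) => w a b.
have i2 : 'i%C * 'i%C = -1 :> R[i] by rewrite -expr2 sqr_i.
have -> : 'i%C * ('i%C * w * a + - 'i%C * w^* * b) = ('i%C * 'i%C) * (w * a - w^* * b) by ring.
by rewrite i2; field.
Qed.

Section Piola.
Variables (R : realType) (n : nat).
Local Notation C := R[i].
Variables (F : 'rV[C]_n -> 'rV[C]_n) (W : set 'rV[C]_n).
Hypotheses (oW : open W) (dF : forall y, W y -> differentiable F y).

Definition jacobian y : 'M[C]_n := lin1_mx ('d F y).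

Lemma jacobianE y a k : jacobian y a k = 'd F y (delta_mx 0 a) 0 k.
Proof. by rewrite mxE. Qed.

Lemma jacobian_coord y a k : W y ->
  'd (fun z => F z 0 k) y (delta_mx 0 a) = jacobian y a k.
Proof. by move=> Wy; rewrite (coord_diff k _ (dF Wy)) jacobianE. Qed.

Let dFk k y (Wy : W y) := coord_differentiable k (dF Wy).

Lemma jacobian_cC k a l : class_C k W (fun y => jacobian y a l).
Proof.
apply: (@eq_cC _ _ _ _ (fun y => 'd (fun z => F z 0 l) y (delta_mx 0 a))) => //.
  by move=> y; exact: jacobian_coord.
apply: holomorphic_cC => // y Wy.
exact: (holomorphic_derivative _ oW (dFk l) Wy).
Qed.

Lemma jacobian_diff y a l : W y -> differentiable (fun y => jacobian y a l) y.
Proof.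
move=> Wy; apply: (@near_differentiable _ _ _ (fun y => 'd (fun z => F z 0 l) y (delta_mx 0 a))).
  by apply: filterS (open_nbhs_nbhs (conj oW Wy)) => z; exact: jacobian_coord.
exact: (holomorphic_derivative _ oW (dFk l) Wy).
Qed.

(** With A = adj J and T_a = dJ/dz_a, differentiating J A = det J and multiplying by A gives det J
    dA/dz_a = tr(T_a A) A - A T_a A. Summing the entries (l, a) over a, the two terms agree because
    T_a is symmetric in a and its row index. *)
Lemma piola x l : W x -> jacobian x \in unitmx ->
  \sum_a dz a (fun y => \adj (jacobian y) l a) x = 0.
Proof.
move=> Wx uJ.
pose J := jacobian x; pose A := \adj J; pose d := \det J.
pose T a : 'M[C]_n := \matrix_(b, k) 'd (fun y => 'd (fun z => F z 0 k) y (delta_mx 0 b)) x (delta_mx 0 a).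
pose dA a : 'M[C]_n := \matrix_(b, k) dz a (fun y => \adj (jacobian y) b k) x.
have hT a b k : has_dz a (fun y => jacobian y b k) x (T a b k).
  apply: (has_dz_near oW Wx (f := fun y => 'd (fun z => F z 0 k) y (delta_mx 0 b))).
    by move=> y; exact: jacobian_coord.
  rewrite mxE; apply: has_dz_holo.
  exact: (holomorphic_derivative _ oW (dFk k) Wx).
have hA a b k : has_dz a (fun y => \adj (jacobian y) b k) x (dA a b k).
  rewrite mxE; apply: (cC_has_dz _ oW Wx).
  exact: (cC_adj oW (jacobian_cC 1)).
have hd a := has_dz_det (hT a).
have prod a : J *m dA a = (\tr (T a *m A))%:M - T a *m A.
  apply/matrixP => b k; rewrite !mxE.
  have h1 : has_dz a (fun y => \sum_c jacobian y b c * \adj (jacobian y) c k) x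
      (\sum_c (T a b c * A c k + J b c * dA a c k)).
    by apply: has_dz_sum => c _; exact: has_dzM (hT a b c) (hA a c k).
  have h2 : has_dz a (fun y => \det (jacobian y) * (b == k)%:R) x
      (\tr (T a *m A) * (b == k)%:R + d * 0).
    exact: has_dzM (hd a) (has_dz_cst a x _).
  have e : (fun y => \sum_c jacobian y b c * \adj (jacobian y) c k) =
      (fun y => \det (jacobian y) * (b == k)%:R).
    apply/funext => y; have := congr1 (fun B : 'M_n => B b k) (mul_mx_adj (jacobian y)).
    by rewrite !mxE mulr_natr.
  have := has_dzE h1; rewrite e (has_dzE h2) mulr0 addr0 mulr_natr big_split /= => ->.
  by rewrite addrC addKr.
have ad a : d *: dA a = \tr (T a *m A) *: A - A *m T a *m A.
  have : A *m (J *m dA a) = d *: dA a by rewrite mulmxA mul_adj_mx mul_scalar_mx.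
  move=> <-; rewrite prod mulmxBr mul_mx_scalar mulmxA; congr (_ - _).
have d0 : d != 0 by move: uJ; rewrite unitmxE unitfE.
apply: (mulfI d0); rewrite mulr0 mulr_sumr.
transitivity (\sum_a (\tr (T a *m A) * A l a - (A *m T a *m A) l a)).
  apply: eq_bigr => a _; transitivity ((d *: dA a) l a).
    by rewrite [RHS]mxE; congr (_ * _); rewrite [RHS]mxE.
  by rewrite ad [LHS]mxE; congr (_ + _); rewrite [LHS]mxE.
rewrite sumrB; apply/eqP; rewrite subr_eq0; apply/eqP.
have Tsym a b k : T a b k = T b a k.
  by rewrite !mxE; exact: (holomorphic_derivative_sym _ _ oW (dFk k) Wx).
transitivity (\sum_a \sum_b \sum_k T a b k * A k b * A l a).
  by apply: eq_bigr => a _; rewrite mulr_suml; apply: eq_bigr => b _; rewrite mxE mulr_suml.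
transitivity (\sum_a \sum_b \sum_k A l b * T a b k * A k a); last first.
  apply: eq_bigr => a _; rewrite -mulmxA mxE; apply: eq_bigr => b _.
  by rewrite [X in _ = _ * X]mxE mulr_sumr; apply: eq_bigr => k _; rewrite mulrA.
rewrite exchange_big; apply: eq_bigr => b _; apply: eq_bigr => a _; apply: eq_bigr => k _.
by rewrite Tsym; ring.
Qed.

End Piola.

Lemma invmxM (K : comUnitRingType) n (A B : 'M[K]_n) : A \in unitmx -> B \in unitmx ->
  invmx (A *m B) = invmx B *m invmx A.
Proof.
move=> uA uB; have uAB : A *m B \in unitmx by rewrite unitmx_mul uA.
apply: (can_inj (mulKmx uAB)); rewrite mulmxV // mulmxA -(mulmxA A) mulmxV // mulmx1.
by rewrite mulmxV.
Qed.

Section PullbackPDE.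
Variables (R : realType) (n : nat).
Local Notation C := R[i].
Implicit Types (H : 'rV[C]_n -> 'M[C]_n) (U W : set 'rV[C]_n).

Definition adj_divfree H x := forall b, \sum_a dz a (fun y => \adj (H y) b a) x = 0.

Lemma adjM (A B : 'M[C]_n) : A \in unitmx -> B \in unitmx ->
  \adj (A *m B) = \adj B *m \adj A.
Proof.
move=> uA uB.
have E (P : 'M[C]_n) : P \in unitmx -> \adj P = \det P *: invmx P.
  by move=> uP; rewrite /invmx uP scalerA divrr ?scale1r.
rewrite !E ?unitmx_mul ?uA // invmxM // -scalemxAl -scalemxAr scalerA det_mulmx.
by rewrite mulrC.
Qed.

Lemma adj_divfree_pull H1 H2 F U W x : open U -> open W -> W x ->
  (forall y, W y -> U (F y)) -> (forall y, W y -> differentiable F y) ->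
  (forall y, W y -> jacobian F y \in unitmx) ->
  (forall y, U y -> H2 y \in unitmx) ->
  (forall i j, class_C 1 U (fun y => H2 y i j)) ->
  (forall y, W y -> H1 y = jacobian F y *m H2 (F y) *m mxstar (jacobian F y)) ->
  adj_divfree H2 (F x) -> adj_divfree H1 x.
Proof.
move=> oU oW Wx WU dF uJ uH cH HE D b.
pose J := jacobian F; pose S y := \adj (mxstar (J y)); pose q y := \adj (H2 y).
(* [adj (J^* )] is antiholomorphic, so that only the other two factors are
   differentiated, the last one by Piola's identity. *)
have adjE y : W y -> \adj (H1 y) = S y *m (q (F y) *m \adj (J y)).
  move=> Wy; have uS : mxstar (J y) \in unitmx.
    rewrite unitmxE det_mxstar unitfE fmorph_eq0 -unitfE -unitmxE; exact: uJ.
  have u1 := uJ _ Wy; have u2 := uH _ (WU _ Wy).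
  have u12 : J y *m H2 (F y) \in unitmx by rewrite unitmx_mul u1 u2.
  by rewrite (HE y Wy) (adjM u12 uS) (adjM u1 u2).
have qc p l : class_C 1 U (fun y => q y p l) by apply: cC_adj => // i j; exact: cH.
have ac a l : has_dz a (fun y => \adj (J y) l a) x (dz a (fun y => \adj (J y) l a) x).
  exact: (cC_has_dz _ oW Wx (cC_adj oW (jacobian_cC oW dF 1) l a)).
have Sc a p : has_dz a (fun y => S y b p) x 0.
  rewrite (_ : (fun y => S y b p) = (fun y => (-1) ^+ (p + b) *
      \det (row' p (col' b (mxstar (J y)))))); last by apply/funext => y; rewrite mxE.
  have h0 : has_dz a (fun y => \det (row' p (col' b (mxstar (J y))))) x
      (\tr (0 *m \adj (row' p (col' b (mxstar (J x)))))).
    apply: has_dz_det => i c; rewrite mxE.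
    rewrite (_ : (fun y => _) = (fun y => (J y (lift b c) (lift p i))^*)).
      exact: (has_dz_conj_holo a (jacobian_diff oW dF _ _ Wx)).
    by apply/funext => y; rewrite !mxE.
  have := has_dzM (has_dz_cst a x ((-1) ^+ (p + b))) h0.
  by rewrite mul0mx linear0 mul0r mulr0 addr0.
have hq a p l := has_dz_comp a oU (WU _ Wx) (qc p l) (dF _ Wx).
have h a : has_dz a (fun y => \adj (H1 y) b a) x
    (\sum_p S x b p * \sum_l ((\sum_k J x a k * dz k (fun y => q y p l) (F x)) * \adj (J x) l a +
      q (F x) p l * dz a (fun y => \adj (J y) l a) x)).
  apply: (has_dz_near oW Wx (f := fun y => \sum_p S y b p * \sum_l q (F y) p l * \adj (J y) l a)).
    by move=> y Wy; rewrite adjE // [RHS]mxE; apply: eq_bigr => p _; rewrite [X in _ = _ * X]mxE.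
  apply: has_dz_sum => p _.
  have hs : has_dz a (fun y => \sum_l q (F y) p l * \adj (J y) l a) x
    (\sum_l ((\sum_k J x a k * dz k (fun y => q y p l) (F x)) * \adj (J x) l a +
      q (F x) p l * dz a (fun y => \adj (J y) l a) x)).
    apply: has_dz_sum => l _; apply: has_dzM (ac a l).
    have := hq a p l; congr has_dz; apply: eq_bigr => k _.
    by rewrite /J jacobianE.
  by have := has_dzM (Sc a p) hs; rewrite mul0r add0r.
under eq_bigr do rewrite (has_dzE (h _)).
rewrite exchange_big big1 // => p _; rewrite -mulr_sumr.
rewrite [X in _ * X](_ : _ = 0) ?mulr0 // exchange_big /=.
under eq_bigr do rewrite big_split /= -mulr_sumr (piola oW dF _ Wx (uJ _ Wx)) mulr0 addr0.
(* The factor J from the chain rule meets adj J and gives det J, leaving the divergence of the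
   adjugate of [H2] at the image point. *)
transitivity (\det (J x) * \sum_l dz l (fun y => q y p l) (F x)); last by rewrite D mulr0.
rewrite mulr_sumr; apply: eq_bigr => l _.
under eq_bigr do rewrite mulr_suml.
rewrite exchange_big /=.
transitivity (\sum_k (\adj (J x) *m J x) l k * dz k (fun y => q y p l) (F x)).
  apply: eq_bigr => k _; rewrite mxE mulr_suml; apply: eq_bigr => a _; ring.
rewrite mul_adj_mx (bigD1 l) //= big1 ?addr0 => [|k kl].
  by rewrite mxE eqxx mulr1n.
by rewrite mxE eq_sym (negPf kl) mulr0n mul0r.
Qed.

End PullbackPDE.

(** * Pulling back metrics *)

Section PosDef.
Variables (R : realType).
Local Notation C := R[i].

Definition posdef n (H : 'M[C]_n) := H \is hermsymmx /\ forall v, v != 0 -> 0 < herm H v v.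

Lemma posdef_conj n (H J : 'M[C]_n) : J \in unitmx -> posdef H ->
  posdef (J *m H *m mxstar J).
Proof.
move=> uJ [hH pH]; split; first exact: hermsymm_conj.
move=> v v0; rewrite -herm_mulmx; apply: pH.
by apply: contra_neq v0 => vJ; rewrite -(mulmxK uJ v) vJ mul0mx.
Qed.

Lemma posdef_unit n (H : 'M[C]_n) : posdef H -> H \in unitmx.
Proof.
move=> [_ pH]; rewrite -row_free_unit -kermx_eq0; apply/negPn/negP => /rowV0Pn[v vk v0].
have := pH v v0; rewrite hermE (sub_kermxP vk) mul0mx mxE ltxx; exact.
Qed.

(** In a unitary diagonalisation the eigenvalues are the values of the form on the rows of the
    unitary matrix. *)
Lemma posdef_det n (H : 'M[C]_n) : posdef H -> 0 < \det H.
Proof.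
move=> [hH pH].
have hn := hermitian_normalmx hH.
have [P uP HE] : exists2 P, P \is unitarymx & H = invmx P *m diag_mx (spectral_diag H) *m P.
  by exists (spectralmx H); [exact: spectral_unitarymx|exact/orthomx_spectralP].
have uP' := unitarymx_unit uP.
rewrite HE !det_mulmx mulrAC -det_mulmx mulVmx // det1 mul1r det_diag.
apply: prodr_gt0 => i _; set d := spectral_diag H in HE *.
have v0 : delta_mx 0 i *m P != 0 :> 'rV_n.
  apply/negP => /eqP vP; have := mulmxK uP' (delta_mx 0 i : 'rV_n).
  rewrite vP mul0mx => /(congr1 (fun w : 'rV_n => w 0 i)).
  by rewrite !mxE !eqxx => /esym/eqP; rewrite oner_eq0.
have := pH _ v0; rewrite herm_mulmx {1}HE hermE.
have PP : P *m mxstar P = 1%:M by rewrite /mxstar map_trmx; exact/unitarymxP.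
have -> : P *m (invmx P *m diag_mx d *m P) *m mxstar P = diag_mx d.
  by rewrite -!mulmxA PP mulmx1 mulmxA mulmxV // mul1mx.
by rewrite mxstar_delta -rowE -colE !mxE eqxx mulr1n.
Qed.

Lemma mxstar_inv n (H : 'M[C]_n) : mxstar (invmx H) = invmx (mxstar H).
Proof. by rewrite /mxstar map_invmx trmx_inv. Qed.

Lemma posdef_inv n (H : 'M[C]_n) : posdef H -> posdef (invmx H).
Proof.
move=> pH; have uH := posdef_unit pH; have [hH p] := pH.
have HS : H = mxstar H by exact/hermsymmP.
have -> : invmx H = invmx H *m H *m mxstar (invmx H).
  by rewrite mulVmx // mul1mx mxstar_inv -HS.
by apply: posdef_conj; rewrite ?unitmx_inv.
Qed.

Lemma mxstarD m p (A B : 'M[C]_(m, p)) : mxstar (A + B) = mxstar A + mxstar B.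
Proof. by rewrite /mxstar map_mxD linearD. Qed.

Lemma mxstarZ m p (a : R) (A : 'M[C]_(m, p)) : mxstar (a%:C *: A) = a%:C *: mxstar A.
Proof.
rewrite /mxstar map_mxZ linearZ; congr (_ *: _).
by rewrite -[LHS]/(conjc a%:C) /conjc /= oppr0.
Qed.

Lemma hermDl n (A B : 'M[C]_n) v w : herm (A + B) v w = herm A v w + herm B v w.
Proof. by rewrite !hermE mulmxDr mulmxDl mxE. Qed.

Lemma hermZl n (a : C) (A : 'M[C]_n) v w : herm (a *: A) v w = a * herm A v w.
Proof. by rewrite !hermE -scalemxAr -scalemxAl mxE. Qed.

Lemma posdefZ n (a : R) (A : 'M[C]_n) : 0 < a -> posdef A -> posdef (a%:C *: A).
Proof.
move=> a0 [/hermsymmP hA pA]; split.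
  by apply/hermsymmP; rewrite mxstarZ -hA.
by move=> v /pA pv; rewrite hermZl mulr_gt0 // ltcR.
Qed.

Lemma posdef_sum2 n (a b : R) (A B : 'M[C]_n) : 0 <= a -> 0 <= b -> 0 < a + b ->
  posdef A -> posdef B -> posdef (a%:C *: A + b%:C *: B).
Proof.
move=> a0 b0 ab [/hermsymmP hA pA] [/hermsymmP hB pB]; split.
  by apply/hermsymmP; rewrite mxstarD !mxstarZ -hA -hB.
move=> v v0; rewrite hermDl !hermZl; have := pA v v0; have := pB v v0.
move: (herm A v v) (herm B v v) => p q q0 p0.
have [{}a0|a1] := ltP 0 a.
  by rewrite ltr_wpDr ?mulr_gt0 ?ltcR // mulr_ge0 ?ler0c // ltW.
have {}ab : 0 < b by move: ab a1; lra.
by rewrite ltr_wpDl ?mulr_gt0 ?ltcR // mulr_ge0 ?ler0c // ltW.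
Qed.

Lemma posdef_block n (A : 'M[C]_n) (g : R) : posdef A -> 0 < g ->
  posdef (block_mx A 0 0 (g%:C)%:M : 'M_(n + 1)).
Proof.
move=> [/hermsymmP hA pA] g0; split.
  apply/hermsymmP; rewrite /mxstar map_block_mx tr_block_mx !map_mx0 !trmx0 [X in block_mx X]hA.
  rewrite map_scalar_mx tr_scalar_mx; congr (block_mx _ _ _ _%:M).
  by rewrite -[RHS]/(conjc g%:C) /conjc /= oppr0.
move=> v v0; rewrite -(hsubmxK v) hermE mul_row_block !mulmx0 addr0 add0r.
rewrite /mxstar map_row_mx tr_row_mx mul_row_col mxE -hermE.
set x := lsubmx v; set z := rsubmx v.
have hz : (z *m (g%:C)%:M *m (map_mx Num.conj z)^T) 0 0 = g%:C * (z 0 0 * (z 0 0)^*).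
  by rewrite mul_mx_scalar -scalemxAl mxE; congr (_ * _); rewrite mxE big_ord1 !mxE.
rewrite hz -normCK; have [x0|x0] := eqVneq x 0.
  have z0 : z 0 0 != 0.
    apply: contra_neq v0 => z0; rewrite -(hsubmxK v) -/x -/z x0.
    by rewrite (mx11_scalar z) z0 raddf0 row_mx0.
  by rewrite x0 hermE mul0mx mul0mx mxE add0r mulr_gt0 ?ltcR // exprn_gt0 // normr_gt0.
by rewrite ltr_wpDr ?pA // mulr_ge0 ?ler0c ?(ltW g0) // exprn_ge0.
Qed.

End PosDef.

Section Pull.
Variables (R : realType) (n : nat) (M : complexManifold R n).
Implicit Types (phi psi : M -> M) (c d e : chart R n M) (x : 'rV[R[i]]_n)
  (h : hermitianMetric M).

Lemma gram_pd h c x : atlas c -> cimg c x -> posdef (gram h c x).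
Proof. by move=> cM cx; split; [exact: gram_hermitian|move=> v; exact: gram_posdef]. Qed.

Definition pulls phi h' h := forall c d x, atlas c -> atlas d -> trdom phi c d x ->
  gram h' c x = jac phi c d x *m gram h d (tr phi c d x) *m mxstar (jac phi c d x).

Lemma herm_jac phi c d x H v w :
  herm H ('d (tr phi c d) x v) ('d (tr phi c d) x w) =
  herm (jac phi c d x *m H *m mxstar (jac phi c d x)) v w.
Proof. by rewrite -herm_mulmx (jacE phi c d x v) (jacE phi c d x w). Qed.

Lemma pulls_id h : pulls idfun h h.
Proof.
move=> c d x cM dM [cx dx]; apply: herm_inj => v w.
rewrite -herm_jac; exact: gram_change.
Qed.

Section Exists.
Variables (phi psi : M -> M) (h : hermitianMetric M).
Hypotheses (hphi : holomorphic phi) (hpsi : holomorphic psi) (K : cancel phi psi).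

Let tgt (p : M) : chart R n M := s2val (cid2 (atlas_cover (phi p))).

Let tgtM p : atlas (tgt p). Proof. by rewrite /tgt; case: cid2. Qed.

Let tgtP p : cdom (tgt p) (phi p). Proof. by rewrite /tgt; case: cid2. Qed.

(** A chart around the image point is chosen separately for every point. [pull_gramE] shows that the
    value does not depend on the choice, so near each point a fixed chart gives smoothness. *)
Definition pull_gram c x : 'M[R[i]]_n :=
  let d := tgt (cinv c x) in
  jac phi c d x *m gram h d (tr phi c d x) *m mxstar (jac phi c d x).

Lemma pull_gramE c d x : atlas c -> atlas d -> trdom phi c d x ->
  pull_gram c x = jac phi c d x *m gram h d (tr phi c d x) *m mxstar (jac phi c d x).
Proof.
move=> cM dM xd; rewrite /pull_gram; set e := tgt _.
have eM : atlas e by exact: tgtM.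
have xe : trdom phi c e x by split; [exact: xd.1|exact: tgtP].
have ed : trdom idfun e d (tr phi c e x) by exact: (trdom_comp (psi := idfun) xe xd).
rewrite (pulls_id h eM dM ed) (tr_comp idfun d xe).
by rewrite (jac_chain hphi (holomorphic_id M) cM eM dM xe ed) mxstarM !mulmxA.
Qed.

Lemma pull_smooth c : atlas c ->
  forall i j, smooth (cimg c) (fun x => pull_gram c x i j).
Proof.
move=> cM i j k; apply: cC_local => x cx.
pose d := tgt (cinv c x); have dM : atlas d by exact: tgtM.
have oW : open (trdom phi c d) by exact: (trdom_open hphi.1).
have Wd y (Wy : trdom phi c d y) := tr_diff hphi cM dM Wy.
exists (trdom phi c d); split; [by []|by split => //; exact: tgtP|].
pose J y := jac phi c d y.
have E y : trdom phi c d y ->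
    (J y *m gram h d (tr phi c d y) *m mxstar (J y)) i j = pull_gram c y i j.
  by move=> Wy; rewrite (pull_gramE cM dM Wy).
refine (eq_cC oW E _).
have cJ a b : class_C k (trdom phi c d) (fun y => J y a b).
  exact: (@jacobian_cC _ _ (tr phi c d) _ oW Wd).
have cG a b : class_C k (trdom phi c d) (fun y => gram h d (tr phi c d y) a b).
  exact: (cC_comp (@cimg_open _ _ _ d) oW (fun y => @tr_img _ _ _ phi c d y) Wd (gram_smooth h dM a b k)).
have cS a b : class_C k (trdom phi c d) (fun y => mxstar (J y) a b).
  have E' y : trdom phi c d y -> (J y b a)^* = mxstar (J y) a b by move=> _; rewrite !mxE.
  exact: (eq_cC oW E' (cC_conj oW (cJ b a))).
exact: (cC_mulmx oW (cC_mulmx oW cJ cG) cS).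
Qed.

Lemma pull_pd c x : atlas c -> cimg c x -> posdef (pull_gram c x).
Proof.
move=> cM cx; set d := tgt (cinv c x).
have xd : trdom phi c d x by split => //; exact: tgtP.
rewrite (pull_gramE cM (tgtM _) xd); apply: posdef_conj.
  exact: (jac_unit hphi hpsi K cM (tgtM _) xd).
by apply: gram_pd; [exact: tgtM|exact: tr_img].
Qed.

Lemma pull_change c d x : atlas c -> atlas d -> cimg c x -> cdom d (cinv c x) ->
  forall v w, herm (pull_gram c x) v w =
    herm (pull_gram d (cmap d (cinv c x)))
      ('d (cmap d \o cinv c) x v) ('d (cmap d \o cinv c) x w).
Proof.
move=> cM dM cx dx v w.
apply: etrans _ (esym (herm_jac idfun c d x _ v w)).
suff -> : pull_gram c x = jac idfun c d x *m pull_gram d (tr idfun c d x) *m mxstar (jac idfun c d x) by [].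
set e := tgt (cinv c x); have eM : atlas e by exact: tgtM.
have xd : trdom idfun c d x by [].
have xe : trdom phi c e x by split => //; exact: tgtP.
have de : trdom phi d e (tr idfun c d x) by exact: (trdom_comp (psi := phi) xd xe).
rewrite (pull_gramE cM eM xe) (pull_gramE dM eM de) (tr_comp phi e xd).
have -> := jac_chain (holomorphic_id M) hphi cM dM eM xd de.
by rewrite mxstarM !mulmxA.
Qed.

Definition pull_metric : hermitianMetric M := HermitianMetric pull_smooth
  (fun c x cM cx => (pull_pd cM cx).1)
  (fun c x v cM cx => (pull_pd cM cx).2 v) pull_change.

Lemma pull_metricP : pulls phi pull_metric h.
Proof. by move=> c d x; exact: pull_gramE. Qed.

End Exists.

Definition vol_inv phi h := forall c d x, atlas c -> atlas d -> trdom phi c d x ->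
  \det (gram h c x) = \det (jac phi c d x) * \det (gram h d (tr phi c d x)) * (\det (jac phi c d x))^*.

Lemma vol_inv_pulls phi h h' : pulls phi h' h -> vol_inv phi h ->
  forall c x, atlas c -> cimg c x -> \det (gram h' c x) = \det (gram h c x).
Proof.
move=> P V c x cM cx; have [d dM dx] := atlas_cover (phi (cinv c x)).
by rewrite (P c d) // !det_mulmx det_mxstar (V c d x).
Qed.

Lemma vol_inv_id h : vol_inv idfun h.
Proof. by move=> c d x cM dM xd; rewrite (pulls_id h cM dM xd) !det_mulmx det_mxstar. Qed.

Lemma conj_factor (a b z : R[i]) : a * (b * z * b^*) * a^* = a * b * z * (a * b)^*.
Proof. by rewrite rmorphM; ring. Qed.

Lemma vol_inv_comp phi psi h : holomorphic phi -> holomorphic psi ->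
  vol_inv phi h -> vol_inv psi h -> vol_inv (psi \o phi) h.
Proof.
move=> hphi hpsi P1 P2 c d x cM dM xd.
have [e eM ex] := atlas_cover (phi (cinv c x)).
have xe : trdom phi c e x by split; [exact: xd.1|].
have ed := trdom_comp xe xd.
rewrite (P1 c e x cM eM xe) (P2 e d _ eM dM ed) (tr_comp psi d xe).
rewrite (jac_chain hphi hpsi cM eM dM xe ed) det_mulmx; exact: conj_factor.
Qed.

Lemma vol_inv_inv phi psi h : holomorphic phi -> holomorphic psi ->
  cancel phi psi -> cancel psi phi -> vol_inv phi h -> vol_inv psi h.
Proof.
move=> hphi hpsi K1 K2 V c d x cM dM xd.
have xc : trdom (phi \o psi) c c x.
  by split; [exact: xd.1|rewrite /= K2; exact: (cinvP xd.1).1].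
have dc := trdom_comp xd xc.
have xE : tr phi d c (tr psi c d x) = x.
  by rewrite (tr_comp phi c xd) /tr /= K2 (cinvP xd.1).2.
rewrite (V d c _ dM cM dc) xE.
have := jac_chain hpsi hphi cM dM cM xd dc.
rewrite (_ : phi \o psi = idfun); last by apply/funext => p; rewrite /= K2.
rewrite (jac_id xd.1) => /(congr1 determinant); rewrite det1 det_mulmx.
by move=> ab; rewrite conj_factor -ab rmorph1 mul1r mulr1.
Qed.

Lemma mulmx_real_row k (v : 'rV[R[i]]_k.+1) (J : 'M[R[i]]_k.+1) :
  real_row v *m block_mx J 0 0 (map_mx Num.conj J) = real_row (v *m J).
Proof. by rewrite mul_row_block !mulmx0 addr0 add0r /real_row /conjv map_mxM. Qed.

Lemma vol_cancel (w k f a b j j' : R[i]) : w != 0 -> k != 0 -> f != 0 ->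
  w * k * b * (f * (j * j')) = w * k * a * f -> a = j * b * j'.
Proof.
move=> w0 k0 f0 H; apply: (mulfI (mulf_neq0 (mulf_neq0 w0 k0) f0)).
by rewrite mulrAC -H; ring.
Qed.

(** Both forms are evaluated on the real frame, where the top form is nonzero. A complex linear map
    acts on real rows by J and its conjugate, whence the two determinant factors. In dimension 0 all
    determinants are 1. *)
Lemma volume_invariant_vol phi h : holomorphic phi ->
  volume_invariant h phi -> vol_inv phi h.
Proof.
move=> hphi V c d x cM dM xd.
case: n M phi h hphi V c d x cM dM xd => [|k] M' phi' h' hphi V c d x cM dM xd.
  by rewrite !det_mx00 !mul1r rmorph1.
have dF := tr_diff hphi cM dM xd.
have := etrans (esym (volume_formE (gram h' d) (tr phi' c d x)
  (fun r => 'd (tr phi' c d) x (frame R r)))) (etrans (V c d x (@frame R k) cM dM xd.1 xd.2)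
  (volume_formE (gram h' c) x (@frame R k))).
rewrite (_ : (fun r => real_row ('d (tr phi' c d) x (frame R r))) =
    (fun r => real_row (frame R r) *m block_mx (jac phi' c d x) 0 0 (map_mx Num.conj (jac phi' c d x)))); last first.
  by apply/funext => r; rewrite mulmx_real_row (jacE phi' c d x (frame R r)).
rewrite mxr_mulmx; [|by rewrite muln2 addnn|exact: cols_idI].
rewrite det_ublock det_map_mx.
exact: (vol_cancel (@wedge_const_neq0 R k.+1) (lt0r_neq0 (Cvol_gt0 _ k)) (frame_det R k)).
Qed.

End Pull.

Section Divfree.
Variables (R : realType).
Local Notation C := R[i].

Lemma adj_mxstar n (A : 'M[C]_n) : \adj (mxstar A) = mxstar (\adj A).
Proof. by rewrite /mxstar -trmx_adj map_mx_adj. Qed.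

Lemma dzb_conj n (f g : 'rV[C]_n -> C) U x j : open U -> U x -> class_C 1 U f ->
  (forall y, U y -> (f y)^* = g y) -> dzb j g x = (dz j f x)^*.
Proof.
move=> oU Ux cf fg.
have E v : rderiv g v x = (rderiv f v x)^*.
  by have [_ ->] := has_rderivP (has_rderiv_near oU Ux fg (has_rderiv_conj (cC_has v cf Ux))).
rewrite /dzb /dz !E rmorphM /= rmorphB rmorphM fmorphV rmorph_nat /= conj_i.
by rewrite mulNr opprK.
Qed.

Lemma adj_divfree_closed n (H : 'rV[C]_n.+1 -> 'M[C]_n.+1) U : open U ->
  (forall i j, class_C 1 U (fun y => H y i j)) ->
  (forall y, U y -> posdef (H y)) ->
  (closed_on U (wedge_pow (fundamental_form H) n) <->
   forall x, U x -> adj_divfree H x).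
Proof.
move=> oU cH pH; have uH y Uy := posdef_unit (pH y Uy).
rewrite (closed_balancedP oU cH uH); split=> [D x Ux|D x Ux]; first exact: (D x Ux).1.
split=> [|a]; first exact: D.
have cA b c : class_C 1 U (fun y => (\adj (H y)) b c) by exact: (cC_adj oU cH).
transitivity ((\sum_b dz b (fun y => (\adj (H y)) a b) x)^*); last first.
  by rewrite (D x Ux a) rmorph0.
rewrite rmorph_sum; apply: eq_bigr => b _; apply: (dzb_conj b oU Ux (cA a b)) => y Uy.
have [/hermsymmP hH _] := pH y Uy.
by rewrite [in RHS]hH adj_mxstar [RHS]mxE [RHS]mxE.
Qed.

Definition metric_divfree n (M : complexManifold R n) (h : hermitianMetric M) :=
  forall c x, atlas c -> cimg c x -> adj_divfree (gram h c) x.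

Lemma balanced_divfree n (M : complexManifold R n) (h : hermitianMetric M) :
  balanced h <-> metric_divfree h.
Proof.
case: n M h => [|n] M h.
  split=> [_ c x _ _ b|_ c cM x u cx]; first by rewrite big_ord0.
  rewrite /ext_d big1 // => i _.
  by have [_ ->] := has_rderivP (has_rderiv_cst (u i) x 1); rewrite mulr0.
have H c (cM : atlas c) := adj_divfree_closed (@cimg_open _ _ _ c)
  (fun i j => gram_smooth h cM i j 1%N) (fun y => gram_pd h cM (x := y)).
split=> [B c x cM|D c cM]; first exact: ((H c cM).1 (B c cM) x).
by apply: (H c cM).2 => x; exact: D.
Qed.

Lemma pulls_divfree n (M : complexManifold R n) (h h' : hermitianMetric M) phi psi :
  holomorphic phi -> holomorphic psi -> cancel phi psi ->
  pulls phi h' h -> metric_divfree h -> metric_divfree h'.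
Proof.
move=> hphi hpsi K P D c x cM cx; have [d dM dx] := atlas_cover (phi (cinv c x)).
have xd : trdom phi c d x by [].
apply: (@adj_divfree_pull _ _ (gram h' c) (gram h d) (tr phi c d) (cimg d) (trdom phi c d)).
- exact: cimg_open.
- exact: (trdom_open hphi.1).
- exact: xd.
- by move=> y; exact: tr_img.
- by move=> y; exact: (tr_diff hphi cM dM).
- by move=> y; exact: (jac_unit hphi hpsi K cM dM).
- by move=> y dy; exact: (posdef_unit (gram_pd h dM dy)).
- by move=> i j; exact: (gram_smooth h dM i j 1%N).
- by move=> y; exact: P.
- exact: (D d _ dM (tr_img xd)).
Qed.

End Divfree.

(** * Pull-backs of the metric by the iterates of the automorphism *)

Section Family.
Variables (R : realType) (n : nat) (M : complexManifold R n) (f : automorphism M).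
Variable h : hermitianMetric M.

Let aut_iterK k : cancel (aut_iter f k) (aut_iter f (- k)).
Proof. by move=> p; rewrite -aut_iterD addNr. Qed.

Definition iter_metric (k : int) : hermitianMetric M :=
  pull_metric h (aut_iter_holo f k) (aut_iter_holo f (- k)) (aut_iterK k).

Lemma iter_metricP k : pulls (aut_iter f k) (iter_metric k) h.
Proof. exact: pull_metricP. Qed.

Lemma iter_metric_pulls k a : pulls (aut_iter f a) (iter_metric (k + a)) (iter_metric k).
Proof.
move=> c d x cM dM xd.
have [e eM ex] := atlas_cover (aut_iter f k (cinv d (tr (aut_iter f a) c d x))).
have de : trdom (aut_iter f k) d e (tr (aut_iter f a) c d x) by split; [exact: tr_img|].
rewrite (iter_metricP dM eM de).
have E : aut_iter f (k + a) = aut_iter f k \o aut_iter f a by apply/funext => p; exact: aut_iterD.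
have xe : trdom (aut_iter f (k + a)) c e x.
  by split; [exact: xd.1|rewrite aut_iterD -(tr_inv xd); exact: ex].
rewrite (iter_metricP cM eM xe) E (tr_comp (aut_iter f k) e xd).
rewrite (jac_chain (aut_iter_holo f a) (aut_iter_holo f k) cM dM eM xd de).
by rewrite mxstarM !mulmxA.
Qed.

Lemma iter_metric_divfree k : metric_divfree h -> metric_divfree (iter_metric k).
Proof.
exact: (pulls_divfree (aut_iter_holo f k) (aut_iter_holo f (- k)) (@aut_iterK k) (@iter_metricP k)).
Qed.

Hypothesis V : volume_invariant h f.

Lemma aut_iter_vol k : vol_inv (aut_iter f k) h.
Proof.
have V1 : vol_inv f h by exact: (volume_invariant_vol (aut_holo f) V).
have V2 : vol_inv (aut_inv f) h.
  exact: (vol_inv_inv (aut_holo f) (aut_inv_holo f) (autK f) (aut_invK f) V1).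
have I (g : M -> M) m : holomorphic g -> vol_inv g h -> vol_inv (iter m g) h.
  move=> hg vg; elim: m => [|m IH]; first exact: vol_inv_id.
  exact: (vol_inv_comp (holomorphic_iter m hg) hg IH vg).
by case: k => m; [exact: (I _ m (aut_holo f))|exact: (I _ m.+1 (aut_inv_holo f))].
Qed.

Lemma iter_metric_det k c x : atlas c -> cimg c x ->
  \det (gram (iter_metric k) c x) = \det (gram h c x).
Proof. exact: (vol_inv_pulls (@iter_metricP k) (aut_iter_vol (k := k))). Qed.

End Family.

(** * A bump function *)

Section Bump.
Variable R : realType.
Implicit Types (x t : R) (j : nat).

(* Up to constants, the derivatives of exp(-1/x) are combinations of these. *)
Definition flat j x : R := if 0 < x then x^-1 ^+ j * expR (- x^-1) else 0.

Lemma flat_ge0 j x : 0 <= flat j x.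
Proof. by rewrite /flat; case: ifP => // x0; rewrite mulr_ge0 ?expR_ge0 ?exprn_ge0 // invr_ge0 ltW. Qed.

Lemma flat_gt0 j x : 0 < x -> 0 < flat j x.
Proof. by move=> x0; rewrite /flat x0 mulr_gt0 ?expR_gt0 ?exprn_gt0 // invr_gt0. Qed.

Lemma flat_le0 j x : x <= 0 -> flat j x = 0.
Proof. by move=> x0; rewrite /flat ltNge x0. Qed.

(** One term of the exponential series, e^y >= y^(j+2) / (j+2)! at y = 1/x. A quadratic bound is
    what makes the derivative at 0 vanish. *)
Lemma flat_bound j x : flat j x <= (j.+2)`!%:R * x ^+ 2.
Proof.
have f0 : 0 <= (j.+2)`!%:R * x ^+ 2 by rewrite mulr_ge0 ?ler0n ?sqr_ge0.
rewrite /flat; case: ifP => // x0; have y0 : 0 < x^-1 by rewrite invr_gt0.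
have := expR_ge1Dxn j.+1 (ltW y0); set y := x^-1 in y0 * => H.
have e0 : 0 < expR y by exact: expR_gt0.
have fn0 : 0 < (j.+2)`!%:R :> R by rewrite ltr0n fact_gt0.
rewrite expRN ler_pdivrMr //.
have -> : y ^+ j = (j.+2)`!%:R * x ^+ 2 * (y ^+ j.+2 / (j.+2)`!%:R).
  rewrite -addn2 exprD /y; field; rewrite ?gt_eqF //=.
by rewrite ler_wpM2l //; apply: le_trans H; rewrite lerDr.
Qed.

(** The family is closed under differentiation up to linear combinations, which yields all orders of
    smoothness by induction. *)
Lemma is_derive_flat j x : is_derive x 1 (flat j) (- j%:R * flat j.+1 x + flat j.+2 x).
Proof.
have [x0|x0|->] := ltrgtP x 0.
- rewrite !flat_le0 ?ltW // mulr0 addr0.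
  have d0 : is_derive x 1 (fun=> 0 : R) (0 : R) by exact: is_derive_cst.
  apply: near_eq_is_derive d0; near=> y; rewrite flat_le0 // ltW //; near: y; exact: lt_nbhsl.
- have iv : is_derive x 1 (fun y : R => y^-1) (- x ^- 2).
    have xn : x != 0 by rewrite gt_eqF.
    apply: DeriveDef; first exact: (@derivableV _ _ id x 1 xn (@derivable_id _ _ x 1)).
    by rewrite (@deriveV _ _ id x 1 xn (@derivable_id _ _ x 1)) derive_id /GRing.scale /= mulr1.
  have xj : is_derive x 1 (fun y : R => y^-1 ^+ j) (j%:R * x^-1 ^+ j.-1 * (- x ^- 2)).
    by have := is_deriveX j iv; rewrite exprfctE.
  have ex : is_derive x 1 (fun y : R => expR (- y^-1)) (expR (- x^-1) * - - x ^- 2).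
    exact: (@is_derive1_comp _ expR (fun y => - y^-1)).
  have df : is_derive x 1 (fun y : R => y^-1 ^+ j * expR (- y^-1))
      (- j%:R * flat j.+1 x + flat j.+2 x).
    apply: (@is_derive_eq _ _ _ _ _ _ _ _ (is_deriveM xj ex)).
    rewrite /GRing.scale /= /flat x0 opprK.
    case: j {xj} => [|j]; rewrite /= ?exprVn ?exprS; field; by rewrite ?expf_neq0 ?gt_eqF.
  apply: near_eq_is_derive df; near=> y.
  by rewrite /flat ifT //; near: y; exact: lt_nbhsr.
rewrite !flat_le0 // mulr0 addr0; apply: eps_is_derive => e e0.
have c0 : 0 < (j.+2)`!%:R :> R by rewrite ltr0n fact_gt0.
exists (e / (j.+2)`!%:R); first by rewrite divr_gt0.
move=> t; rewrite ltr_pdivlMr // => te.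
rewrite add0r mulr0 (flat_le0 j (lexx 0)) !subr0 ger0_norm ?flat_ge0 //.
apply: le_trans (flat_bound j t) _; rewrite -real_normK ?num_real // expr2 mulrA.
by rewrite ler_wpM2r // mulrC ltW.
Unshelve. all: by end_near. Qed.

Definition bump x : R := flat 0 (1 + x) * flat 0 (1 - x).

Lemma bump_ge0 x : 0 <= bump x.
Proof. by rewrite mulr_ge0 ?flat_ge0. Qed.

Lemma bump_gt0 x : -1 < x < 1 -> 0 < bump x.
Proof. by move=> /andP[x1 x2]; rewrite mulr_gt0 // flat_gt0 //; move: x1 x2; lra. Qed.

Lemma bump_eq0 x : 1 <= `|x| -> bump x = 0.
Proof.
rewrite ler_normr /bump => /orP[] x1; first by rewrite (@flat_le0 _ (1 - x)) ?mulr0 //; lra.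
by rewrite (@flat_le0 _ (1 + x)) ?mul0r //; lra.
Qed.

Section Compose.
Variables (n : nat) (l dl : 'rV[R[i]]_n -> R).
Hypotheses (lc : continuous l) (lD : forall (x v : 'rV[R[i]]_n) t, l (x + t%:C *: v) = l x + t * dl v).
Implicit Types v : 'rV[R[i]]_n.

Lemma affine_has_rderiv (g : R -> R) g' v y : is_derive (l y) 1 g g' ->
  has_rderiv (fun y => (g (l y))%:C) v y (g' * dl v)%:C.
Proof.
move=> dg; apply: is_derive_has; rewrite /rline /=; last exact: is_derive_cst.
have dL : is_derive (0 : R) 1 (fun t : R => l y + t * dl v) (dl v).
  apply: eps_is_derive => e e0; exists 1 => // s _.
  rewrite (_ : _ - _ = 0); last by ring.
  by rewrite normr0 mulr_ge0 // ltW.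
under eq_fun do rewrite lD.
apply: (@is_derive1_comp _ g (fun t => l y + t * dl v)) => //.
by rewrite mul0r addr0.
Qed.

Lemma flat_cC k j : class_C k setT (fun y => (flat j (l y))%:C).
Proof.
elim: k j => [|k IH] j.
  split=> [y _|]; [|by []]; apply: (@continuous_comp _ _ _ l (fun x : R => (flat j x)%:C)); first exact: lc.
  apply: (@continuous_comp _ _ _ (flat j) (fun x : R => x%:C)); last exact: realC_continuous.
  apply/differentiable_continuous/derivable1_diffP.
  exact: (@ex_derive _ _ _ _ _ _ _ (is_derive_flat j (l y))).
apply: (cC_intro (D := fun v y => ((- j%:R * flat j.+1 (l y) + flat j.+2 (l y)) * dl v)%:C) openT).
- by move=> y; exact: (cC_cont (IH j)).
- by move=> v y _; apply: affine_has_rderiv; exact: is_derive_flat.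
move=> v; apply: (@eq_cC _ _ k setT (fun y => (- j%:R * dl v)%:C * (flat j.+1 (l y))%:C +
   (dl v)%:C * (flat j.+2 (l y))%:C)); first exact: openT.
  by move=> y _; rewrite -!rmorphM -rmorphD; congr (_%:C); ring.
by apply: cCD; [exact: openT| |]; apply: cCM; try exact: openT; try exact: cC_cst openT; exact: IH.
Qed.

End Compose.

Lemma bump_cC n (l dl : 'rV[R[i]]_n -> R) k : continuous l ->
  (forall (x v : 'rV[R[i]]_n) t, l (x + t%:C *: v) = l x + t * dl v) ->
  class_C k setT (fun y => (bump (l y))%:C).
Proof.
move=> lc lD.
have h1 : class_C k setT (fun y => (flat 0 (1 + l y))%:C).
  apply: (@flat_cC _ (fun y => 1 + l y) dl) => [y|x v t].
    apply: (@continuous_comp _ _ _ l (fun s => 1 + s)); first exact: lc.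
    by apply: cvgD; [exact: cvg_cst|exact: cvg_id].
  by rewrite lD addrA.
have h2 : class_C k setT (fun y => (flat 0 (1 - l y))%:C).
  apply: (@flat_cC _ (fun y => 1 - l y) (fun v => - dl v)) => [y|x v t].
    apply: (@continuous_comp _ _ _ l (fun s => 1 - s)); first exact: lc.
    by apply: cvgB; [exact: cvg_cst|exact: cvg_id].
  by rewrite lD; ring.
apply: (@eq_cC _ _ k setT (fun y => (flat 0 (1 + l y))%:C * (flat 0 (1 - l y))%:C)).
- exact: openT.
- by move=> y _; rewrite -rmorphM.
exact: (cCM openT h1 h2).
Qed.

End Bump.

(** * The metric on M x C *)

Lemma cC_realpow (R : realType) n k (U : set 'rV[R[i]]_n) (f g : 'rV[R[i]]_n -> R[i]) a :
  open U -> (forall y, U y -> 0 < f y) -> class_C k U f ->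
  (forall y, U y -> (re (f y) `^ a)%:C = g y) -> class_C k U g.
Proof.
move=> oU f0 cf E; apply: (eq_cC oU E); apply: cC_powR => // y /f0.
by move=> /gt0_realC[r r0 ->].
Qed.

Lemma cC_invmx (R : realType) n m k (U : set 'rV[R[i]]_n) (H : 'rV[R[i]]_n -> 'M[R[i]]_m) :
  open U -> (forall y, U y -> posdef (H y)) ->
  (forall i j, class_C k U (fun y => H y i j)) ->
  forall i j, class_C k U (fun y => invmx (H y) i j).
Proof.
move=> oU pH cH i j.
have cV : class_C k U (fun y => (\det (H y))^-1).
  apply: (@cC_realpow _ _ _ _ (fun y => \det (H y)) _ (-1) oU) => [y Uy||y Uy].
  - exact: posdef_det (pH y Uy).
  - exact: cC_det.
  have [r r0 ->] := gt0_realC (posdef_det (pH y Uy)).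
  by rewrite /= powR_inv1 ?ltW // fmorphV.
have E y : U y -> (\det (H y))^-1 * \adj (H y) i j = invmx (H y) i j.
  by move=> Uy; rewrite /invmx (posdef_unit (pH y Uy)) [RHS]mxE.
exact: (eq_cC oU E (cCM oU cV (cC_adj oU cH i j))).
Qed.

Section Columns.
Variables (R : realType) (n : nat).
Local Notation C := R[i].
Local Notation V := 'rV[C]_(n + 1).

Lemma has_rderiv_line_cst (f : V -> C) v x :
  (forall t : R, f (x + t%:C *: v) = f x) -> has_rderiv f v x 0.
Proof.
move=> E e e0; exists 1 => // t _.
by rewrite E subrr mulr0 subr0 normr0 ler0c mulr_ge0 // ltW.
Qed.

Lemma has_dz_lsub (q : 'rV[C]_n -> C) (U : set 'rV[C]_n) (y : V) j : open U -> U (lsubmx y) ->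
  class_C 1 U q ->
  has_dz j (fun y : V => q (lsubmx y)) y
    (\sum_l (lsubmx (delta_mx 0 j : V)) 0 l * dz l q (lsubmx y)).
Proof.
move=> oU Uy cq.
have := has_dz_comp j oU Uy cq (lsubmx_differentiable y).
by rewrite (diff_lin y (@lsubmx_continuous R n)).
Qed.

Lemma has_dz_lsubl q U (y : V) a : open U -> U (lsubmx y) -> class_C 1 U q ->
  has_dz (lshift 1 a) (fun y : V => q (lsubmx y)) y (dz a q (lsubmx y)).
Proof.
move=> oU Uy cq; have := has_dz_lsub (lshift 1 a) oU Uy cq; congr has_dz.
rewrite (bigD1 a) //= big1 ?addr0 => [|l /negPf la].
  by rewrite !mxE !eqxx mul1r.
by rewrite !mxE eqxx (inj_eq (@lshift_inj _ _)) la mul0r.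
Qed.

Lemma has_dz_lsubr q U (y : V) i : open U -> U (lsubmx y) -> class_C 1 U q ->
  has_dz (rshift n i) (fun y : V => q (lsubmx y)) y 0.
Proof.
move=> oU Uy cq; have := has_dz_lsub (rshift n i) oU Uy cq; congr has_dz.
by rewrite big1 // => l _; rewrite !mxE eq_lrshift andbF mul0r.
Qed.

End Columns.

Lemma det_size0 (K : comPzRingType) n (A : 'M[K]_n) : n = 0%N -> \det A = 1.
Proof. by case: n A => // A _; exact: det_mx00. Qed.

Lemma mx_comb3 (K : pzRingType) m n (a b c : K) (A B D : 'M[K]_(m, n)) i j :
  (a *: A + b *: B + c *: D) i j = a * A i j + b * B i j + c * D i j.
Proof. by rewrite !mxE. Qed.

Lemma sum3_eq0 (K : nmodType) n (A B D : 'I_n -> K) : \sum_i A i = 0 ->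
  \sum_i B i = 0 -> \sum_i D i = 0 -> \sum_i (A i + B i + D i) = 0.
Proof. by move=> A0 B0 D0; rewrite !big_split /= A0 B0 D0 !addr0. Qed.

Section ChartMetric.
Variables (R : realType) (n : nat) (M : complexManifold R n).
Variables (f : automorphism M) (tau : R[i]) (h : hermitianMetric M).
Hypotheses (tau0 : 0 < im tau) (Dh : metric_divfree h) (Vh : volume_invariant h f).
Local Notation C := R[i].
Local Notation V := 'rV[C]_(n + 1).
Implicit Types (c d : chart R n M) (y : V) (m a : int).

(* The real-linear function on C equal to 1 at 1 and to 0 at tau. *)
Definition slope (z : C) : R := re z - re tau / im tau * im z.

Definition lev y : R := slope (rsubmx y 0 0).

Lemma slopeD z w : slope (z + w) = slope z + slope w.
Proof. by rewrite /slope ReD ImD; ring. Qed.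

Lemma slopeZ t z : slope (t%:C * z) = t * slope z.
Proof. by rewrite /slope ReM ImM /=; ring. Qed.

Lemma slope_period (a : int * int) : slope (period tau a) = a.1%:~R.
Proof.
rewrite /period.
have E (k : int) : k%:~R = (k%:~R)%:C :> C by rewrite rmorph_int.
rewrite slopeD !E slopeZ -[(_)%:C]mulr1 slopeZ /slope /=.
by move: tau0 => /lt0r_neq0 t0; field.
Qed.

Lemma levD y v t : lev (y + t%:C *: v) = lev y + t * lev v.
Proof. by rewrite /lev linearD linearZ /= !mxE slopeD slopeZ. Qed.

Lemma slope_continuous : continuous slope.
Proof.
move=> z; have h1 : {for z, continuous (fun w : C => re tau / im tau * im w)}.
  apply: (@continuous_comp _ _ _ im (fun s : R => re tau / im tau * s)); first exact: Im_continuous.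
  exact: mulrl_continuous.
have h2 : {for z, continuous re} by exact: Re_continuous.
exact: (continuousB h2 h1).
Qed.

Lemma lev_continuous : continuous lev.
Proof.
move=> y; apply: (@continuous_comp _ _ _ (fun y : V => rsubmx y 0 0) slope).
  exact: last_continuous.
exact: slope_continuous.
Qed.

Definition wt m y : R := bump (lev y - m%:~R).

Lemma wt_cC k m U : open U -> class_C k U (fun y => (wt m y)%:C).
Proof.
move=> oU; apply: (@cCS _ _ k setT) => //.
apply: (@bump_cC _ _ (fun y => lev y - m%:~R) lev) => [y|y v t]; last by rewrite levD; ring.
apply: (@continuous_comp _ _ _ lev (fun s => s - m%:~R)); first exact: lev_continuous.
by apply: cvgB; [exact: cvg_id|exact: cvg_cst].
Qed.

Lemma wt_has_dz m (j : 'I_n) y : has_dz (lshift 1 j) (fun y => (wt m y)%:C) y 0.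
Proof.
have l0 : lev (delta_mx 0 (lshift 1 j)) = 0.
  by rewrite /lev /slope !mxE eq_rlshift andbF /= mulr0 subrr.
have l1 : lev ('i%C *: delta_mx 0 (lshift 1 j)) = 0.
  by rewrite /lev linearZ /= /slope !mxE eq_rlshift andbF mulr0 /= mulr0 subrr.
exists 0, 0; split; last by rewrite mulr0 subrr mul0r.
- by apply: has_rderiv_line_cst => t; rewrite /wt levD l0 mulr0 addr0.
- by apply: has_rderiv_line_cst => t; rewrite /wt levD l1 mulr0 addr0.
Qed.

(* The sign makes f^a pull [fam (m + a)] back to [fam m], matching s(z + a) = s(z) + a. *)
Definition fam m := iter_metric f h (- m).

Definition prod_dom c : set V := [set y | cimg c (lsubmx y)].

Lemma prod_dom_open c : open (prod_dom c).
Proof.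
apply: (@open_comp _ _ (lsubmx : V -> 'rV[C]_n)); last exact: cimg_open.
by move=> x _; exact: lsubmx_continuous.
Qed.

Definition dual m c y : 'M[C]_n := invmx (gram (fam m) c (lsubmx y)).

(** The sum over all integers m reduces to two terms: when the level lies in [m, m + 1), the support
    of the bump function leaves only m and m + 1. The first weight is positive there. *)
Definition blend c y : 'M[C]_n :=
  let m := Num.floor (lev y) in (wt m y)%:C *: dual m c y + (wt (m + 1) y)%:C *: dual (m + 1) c y.

Definition vol c y : C := \det (gram h c (lsubmx y)).

(* For [n = 0] the exponent is [0^-1 = 0] and the value is 1. *)
Definition fibre c y : R := re (vol c y * \det (blend c y)) `^ (n%:R)^-1.

Definition susp_gram c y : 'M[C]_(n + 1) :=
  block_mx ((fibre c y)%:C *: invmx (blend c y)) 0 0 ((fibre c y)%:C)%:M.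

Section FixedChart.
Variable (c : chart R n M).
Hypothesis cM : atlas c.

Lemma dual_pd m y : prod_dom c y -> posdef (dual m c y).
Proof. by move=> cy; apply/posdef_inv/gram_pd. Qed.

Lemma wt_floor y (m := Num.floor (lev y)) : 0 < wt m y.
Proof.
apply: bump_gt0; have := floor_le (lev y); have := floorD1_gt (lev y).
by rewrite -/m intrD; lra.
Qed.

Lemma blend_pd y : prod_dom c y -> posdef (blend c y).
Proof.
move=> cy; apply: posdef_sum2; [exact: bump_ge0|exact: bump_ge0| |exact: dual_pd|exact: dual_pd].
by apply: ltr_wpDr; [exact: bump_ge0|exact: wt_floor].
Qed.

(** The floor in [blend] jumps at integers. On this open set the three terms m - 1, m, m + 1 give
    one smooth formula, since on each side of the level m one of the outer weights is zero. *)
Definition slab m : set V := prod_dom c `&` [set y | m%:~R - 1 < lev y < m%:~R + 1].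

Lemma slab_open m : open (slab m).
Proof.
apply: openI; first exact: prod_dom_open.
rewrite (_ : [set y | _] = lev @^-1` `](m%:~R - 1), (m%:~R + 1)[).
  by apply: open_comp; [move=> y _; exact: lev_continuous|exact: itv_open].
by apply/seteqP; split => y /=; rewrite in_itv.
Qed.

Lemma slab_cover y : prod_dom c y -> slab (Num.floor (lev y)) y.
Proof.
move=> cy; split => //=; have := floor_le (lev y); have := floorD1_gt (lev y).
by rewrite intrD; lra.
Qed.

Lemma blend_slab m y : slab m y -> blend c y =
  (wt (m - 1) y)%:C *: dual (m - 1) c y + (wt m y)%:C *: dual m c y +
  (wt (m + 1) y)%:C *: dual (m + 1) c y.
Proof.
move=> [_ /= /andP[y1 y2]]; have [ym|ym] := leP m%:~R (lev y).
  have fE : Num.floor (lev y) = m by apply: floor_def; rewrite ym intrD.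
  have w0 : wt (m - 1) y = 0.
    by apply: bump_eq0; rewrite ler_normr intrB; apply/orP; left; move: ym; lra.
  by rewrite /blend fE w0 scale0r add0r.
have fE : Num.floor (lev y) = m - 1.
  by apply: floor_def; rewrite subrK ym andbT intrB ltW.
have w0 : wt (m + 1) y = 0.
  by apply: bump_eq0; rewrite ler_normr intrD; apply/orP; right; move: ym; lra.
by rewrite /blend fE w0 subrK scale0r addr0.
Qed.

Lemma dual_cC k m i j : class_C k (prod_dom c) (fun y => dual m c y i j).
Proof.
pose q := fun x => invmx (gram (fam m) c x) i j.
have cq : class_C k (cimg c) q.
  apply: cC_invmx; first exact: cimg_open.
  - by move=> x; exact: gram_pd.
  - by move=> a b; exact: gram_smooth.
exact: (cC_comp (@cimg_open _ _ _ c) (@prod_dom_open c) (fun y cy => cy)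
  (fun y _ => lsubmx_differentiable y) cq).
Qed.

Lemma blend_cC k i j : class_C k (prod_dom c) (fun y => blend c y i j).
Proof.
apply: cC_local => y cy.
have [m sy] : exists m, slab m y by exists (Num.floor (lev y)); exact: slab_cover.
exists (slab m); split; [exact: slab_open|exact: sy|].
have E z : slab m z -> (wt (m - 1) z)%:C * dual (m - 1) c z i j +
    (wt m z)%:C * dual m c z i j + (wt (m + 1) z)%:C * dual (m + 1) c z i j = blend c z i j.
  by move=> sz; rewrite (blend_slab sz) mx_comb3.
have T p : class_C k (slab m) (fun z => (wt p z)%:C * dual p c z i j).
  apply: (cCM (@slab_open m)); first exact: wt_cC (@slab_open m).
  by apply: cCS (dual_cC k p i j) => z [].
exact: (eq_cC (@slab_open m) E (cCD (@slab_open m) (cCD (@slab_open m) (T _) (T _)) (T _))).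
Qed.

Lemma vol_gt0 y : prod_dom c y -> 0 < vol c y.
Proof. by move=> cy; apply/posdef_det/gram_pd. Qed.

Lemma vol_blend_gt0 y : prod_dom c y -> 0 < vol c y * \det (blend c y).
Proof. by move=> cy; rewrite mulr_gt0 ?vol_gt0 //; exact/posdef_det/blend_pd. Qed.

Lemma fibre_gt0 y : prod_dom c y -> 0 < fibre c y.
Proof. by move=> /vol_blend_gt0/gt0_realC[r r0 E]; rewrite /fibre E powR_gt0. Qed.

Lemma fibre_exp y : prod_dom c y -> (fibre c y)%:C ^+ n = vol c y * \det (blend c y).
Proof.
move=> cy; have [n0|n0] := posnP n.
  by rewrite /vol !(det_size0 _ n0) mul1r [in LHS]n0.
have [r r0 E] := gt0_realC (vol_blend_gt0 cy).
rewrite /fibre E /= -rmorphXn /= -powR_mulrn ?powR_ge0 // -powRrM mulVf ?pnatr_eq0 -?lt0n //.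
by rewrite powRr1 // ltW.
Qed.

Lemma vol_cC k : class_C k (prod_dom c) (vol c).
Proof.
have cq : class_C k (cimg c) (fun x => \det (gram h c x)).
  by apply: cC_det; [exact: cimg_open|move=> a b; exact: gram_smooth].
exact: (cC_comp (@cimg_open _ _ _ c) (@prod_dom_open c) (fun y cy => cy)
  (fun y _ => lsubmx_differentiable y) cq).
Qed.

Lemma fibre_cC k : class_C k (prod_dom c) (fun y => (fibre c y)%:C).
Proof.
have oD : open (prod_dom c) by exact: prod_dom_open.
apply: (@cC_realpow _ _ k _ (fun y => vol c y * \det (blend c y)) _ (n%:R)^-1 oD) => //.
  by move=> y; exact: vol_blend_gt0.
exact: (cCM oD (vol_cC k) (cC_det oD (blend_cC k))).
Qed.

Lemma susp_gram_cC k i j : class_C k (prod_dom c) (fun y => susp_gram c y i j).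
Proof.
have oD : open (prod_dom c) by exact: prod_dom_open.
case: (split_ordP i) => a ->; case: (split_ordP j) => b ->.
- have E y : prod_dom c y -> (fibre c y)%:C * invmx (blend c y) a b =
      susp_gram c y (lshift 1 a) (lshift 1 b).
    by move=> _; rewrite /susp_gram block_mxEul [RHS]mxE.
  apply: (eq_cC oD E); apply: (cCM oD (fibre_cC k)).
  by apply: (cC_invmx oD) => [y|p q]; [exact: blend_pd|exact: blend_cC].
- have E y : prod_dom c y -> 0 = susp_gram c y (lshift 1 a) (rshift n b).
    by move=> _; rewrite /susp_gram block_mxEur mxE.
  exact: (eq_cC oD E (cC_cst _ _ oD)).
- have E y : prod_dom c y -> 0 = susp_gram c y (rshift n a) (lshift 1 b).
    by move=> _; rewrite /susp_gram block_mxEdl mxE.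
  exact: (eq_cC oD E (cC_cst _ _ oD)).
have E y : prod_dom c y -> (fibre c y)%:C = susp_gram c y (rshift n a) (rshift n b).
  by move=> _; rewrite /susp_gram block_mxEdr !ord1 mxE eqxx mulr1n.
exact: (eq_cC oD E (fibre_cC k)).
Qed.

Lemma susp_gram_pd y : prod_dom c y -> posdef (susp_gram c y).
Proof.
move=> cy; apply: posdef_block; last exact: fibre_gt0.
by apply: posdefZ; [exact: fibre_gt0|exact/posdef_inv/blend_pd].
Qed.

Lemma det_susp_gram y : prod_dom c y -> \det (susp_gram c y) = (fibre c y)%:C * vol c y.
Proof.
move=> cy; have B0 := posdef_det (blend_pd cy).
rewrite /susp_gram det_ublock det_scalar1 detZ (fibre_exp cy) det_inv mulrC.
by rewrite mulfK // gt_eqF.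
Qed.

(** The full determinant is g D. Its factor g cancels against the g in front of K^-1 and against the
    coefficient of |dz|^2, so using the same g in both blocks is what leaves exactly D K and D. *)
Lemma adj_susp_gram y : prod_dom c y ->
  \adj (susp_gram c y) = block_mx (vol c y *: blend c y) 0 0 (vol c y)%:M.
Proof.
move=> cy; have u := posdef_unit (susp_gram_pd cy); have uB := posdef_unit (blend_pd cy).
apply: (can_inj (mulKmx u)); rewrite mul_mx_adj (det_susp_gram cy) /susp_gram mulmx_block.
rewrite !mulmx0 !mul0mx !addr0 add0r -scalemxAl -scalemxAr mulVmx // scalerA.
by rewrite -scalar_mxM scale_scalar_mx mulr1 -scalar_mx_block.
Qed.

Lemma vol_dual m y : prod_dom c y -> vol c y *: dual m c y = \adj (gram (fam m) c (lsubmx y)).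
Proof.
move=> cy; rewrite /vol -(iter_metric_det Vh (- m) cM cy) /dual /invmx.
have pd : posdef (gram (fam m) c (lsubmx y)) by exact: gram_pd.
by rewrite (posdef_unit pd) scalerA divff ?scale1r // gt_eqF // posdef_det.
Qed.

Lemma vol_blend_slab m y : slab m y -> vol c y *: blend c y =
  (wt (m - 1) y)%:C *: \adj (gram (fam (m - 1)) c (lsubmx y)) +
  (wt m y)%:C *: \adj (gram (fam m) c (lsubmx y)) +
  (wt (m + 1) y)%:C *: \adj (gram (fam (m + 1)) c (lsubmx y)).
Proof.
move=> sy; have sC p w : vol c y *: (w *: dual p c y) = w *: \adj (gram (fam p) c (lsubmx y)).
  by rewrite -(vol_dual p sy.1) !scalerA mulrC.
rewrite (blend_slab sy) scalerDr scalerDr.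
exact: (f_equal2 +%R (f_equal2 +%R (sC _ _) (sC _ _)) (sC _ _)).
Qed.

Lemma susp_gram_divfree y : prod_dom c y -> adj_divfree (susp_gram c) y.
Proof.
move=> cy b; have [m sy] : exists m, slab m y by exists (Num.floor (lev y)); exact: slab_cover.
rewrite big_split_ord big_ord1 /=.
have oI := @cimg_open _ _ _ c.
have adjE (z : V) : slab m z -> \adj (susp_gram c z) =
    block_mx (vol c z *: blend c z) 0 0 (vol c z)%:M.
  by move=> [cz _]; exact: adj_susp_gram.
(* In the last row only the z-derivative of D is left, and D is a function on M. *)
rewrite -(splitK b); case: (fintype.split b) => i /=; last first.
  rewrite big1 => [|a _].
    have eV z : slab m z -> vol c z = \adj (susp_gram c z) (rshift n i) (rshift n ord0).
      by move=> /adjE ->; rewrite block_mxEdr !ord1 mxE eqxx mulr1n.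
    rewrite add0r; apply: has_dzE; apply: (has_dz_near (@slab_open m) sy eV).
    apply: (@has_dz_lsubr _ _ (fun x => \det (gram h c x)) (cimg c)) => //.
    exact: (cC_det oI (fun r s => gram_smooth h cM r s 1%N)).
  have eV z : slab m z -> 0 = \adj (susp_gram c z) (rshift n i) (lshift 1 a).
    by move=> /adjE ->; rewrite block_mxEdl mxE.
  apply: has_dzE; apply: (has_dz_near (@slab_open m) sy eV).
  exact: has_dz_cst.
have -> : dz (rshift n 0) (fun z => \adj (susp_gram c z) (lshift 1 i) (rshift n 0)) y = 0.
  have eV z : slab m z -> 0 = \adj (susp_gram c z) (lshift 1 i) (rshift n 0).
    by move=> /adjE ->; rewrite block_mxEur mxE.
  apply: has_dzE; apply: (has_dz_near (@slab_open m) sy eV).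
  exact: has_dz_cst.
rewrite addr0.
pose q p (a : 'I_n) x := \adj (gram (fam p) c x) i a : C.
have hq p (a : 'I_n) : has_dz (lshift 1 a) (fun z => (wt p z)%:C * q p a (lsubmx z)) y
    ((wt p y)%:C * dz a (q p a) (lsubmx y)).
  (* In a direction of M the weight behaves as a constant, so the product rule leaves the divergence
     of one adjugate of the family. *)
  have cq : class_C 1 (cimg c) (q p a).
    exact: (cC_adj oI (fun r s => gram_smooth (fam p) cM r s 1%N)).
  have := has_dzM (wt_has_dz p a y) (has_dz_lsubl a oI cy cq).
  by rewrite mul0r add0r.
have hs (a : 'I_n) := has_dzD (has_dzD (hq (m - 1) a) (hq m a)) (hq (m + 1) a).
have E (a : 'I_n) : dz (lshift 1 a) (fun z => \adj (susp_gram c z) (lshift 1 i) (lshift 1 a)) y =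
    (wt (m - 1) y)%:C * dz a (q (m - 1) a) (lsubmx y) +
    (wt m y)%:C * dz a (q m a) (lsubmx y) + (wt (m + 1) y)%:C * dz a (q (m + 1) a) (lsubmx y).
  apply: has_dzE; apply: has_dz_near (@slab_open m) sy _ (hs a) => z sz.
  rewrite (adjE z sz) block_mxEul (vol_blend_slab sz).
  by rewrite mx_comb3.
under eq_bigr do rewrite E.
have S p : \sum_a (wt p y)%:C * dz a (q p a) (lsubmx y) = 0.
  have D0 : \sum_a dz a (q p a) (lsubmx y) = 0.
    exact: (@iter_metric_divfree _ _ _ f h (- p) Dh c (lsubmx y) cM cy i).
  by rewrite -mulr_sumr D0 mulr0.
exact: (sum3_eq0 (S (m - 1)) (S m) (S (m + 1))).
Qed.

End FixedChart.
End ChartMetric.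

(** * Descent to the suspension *)

Lemma unitmx_mxstar (R : realType) n (A : 'M[R[i]]_n) : (mxstar A \in unitmx) = (A \in unitmx).
Proof. by rewrite !unitmxE det_mxstar !unitfE fmorph_eq0. Qed.

Lemma invmx_conj (R : realType) n (J H : 'M[R[i]]_n) : J \in unitmx -> H \in unitmx ->
  invmx (J *m H *m mxstar J) = mxstar (invmx J) *m invmx H *m invmx J.
Proof.
move=> uJ uH; have uS : mxstar J \in unitmx by rewrite unitmx_mxstar.
by rewrite !invmxM ?unitmx_mul ?uJ // mxstar_inv mulmxA.
Qed.

Lemma comb_conj (K : comPzRingType) n (a b : K) (P Q A B : 'M[K]_n) :
  a *: (P *m A *m Q) + b *: (P *m B *m Q) = P *m (a *: A + b *: B) *m Q.
Proof. by rewrite mulmxDr mulmxDl -!scalemxAr -!scalemxAl. Qed.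

Section Transition.
Variables (R : realType) (n : nat) (M : complexManifold R n).
Variables (f : automorphism M) (tau : R[i]) (h : hermitianMetric M).
Hypotheses (tau0 : 0 < im tau) (Vh : volume_invariant h f).
Local Notation C := R[i].
Local Notation V := 'rV[C]_(n + 1).
Variables (c d : chart R n M) (cM : atlas c) (dM : atlas d) (a : int) (y y' : V).
Hypotheses (yd : trdom (aut_iter f a) c d (lsubmx y))
  (y'E : lsubmx y' = tr (aut_iter f a) c d (lsubmx y))
  (levE : lev tau y' = lev tau y + a%:~R).

Let J := jac (aut_iter f a) c d (lsubmx y).

Let cy : prod_dom c y := yd.1.

Let dy : prod_dom d y'.
Proof. by rewrite /prod_dom /= y'E; exact: tr_img yd. Qed.

Let uJ : J \in unitmx.
Proof.
by apply: (jac_unit (aut_iter_holo f a) (aut_iter_holo f (- a)) _ cM dM yd) => p; rewrite -aut_iterD addNr.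
Qed.

Lemma dual_trans m : dual f h m c y = mxstar (invmx J) *m dual f h (m + a) d y' *m invmx J.
Proof.
have E : gram (fam f h m) c (lsubmx y) = J *m gram (fam f h (m + a)) d (lsubmx y') *m mxstar J.
  have := @iter_metric_pulls _ _ _ f h (- (m + a)) a c d (lsubmx y) cM dM yd.
  by rewrite /fam y'E (_ : - (m + a) + a = - m) // opprD subrK.
have u : gram (fam f h (m + a)) d (lsubmx y') \in unitmx by exact: (posdef_unit (gram_pd _ dM dy)).
by rewrite /dual E; exact: (invmx_conj uJ u).
Qed.

Lemma wt_trans m : wt tau m y = wt tau (m + a) y'.
Proof. by rewrite /wt levE intrD; congr bump; ring. Qed.

(** The two terms of [blend] at the source are matched with those at the target, with indices
    shifted by [a]. *)
Lemma floor_trans : Num.floor (lev tau y') = Num.floor (lev tau y) + a.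
Proof.
have := floor_le (lev tau y); have := floorD1_gt (lev tau y).
move: (Num.floor (lev tau y)) => m; rewrite intrD => m1 m2.
by apply: floor_def; rewrite levE !intrD; apply/andP; split; move: m1 m2; lra.
Qed.

Lemma blend_trans : blend f tau h c y = mxstar (invmx J) *m blend f tau h d y' *m invmx J.
Proof.
rewrite /blend floor_trans; move: (Num.floor (lev tau y)) => m.
rewrite (dual_trans m) (dual_trans (m + 1)) (wt_trans m) (wt_trans (m + 1)) (addrAC m 1 a).
exact: comb_conj.
Qed.

Lemma vol_trans : vol h c y = \det J * vol h d y' * (\det J)^*.
Proof. by rewrite /vol (aut_iter_vol Vh (k := a) cM dM yd) y'E. Qed.

Lemma conj_cancel (j v b : C) : j != 0 -> j * v * j^* * ((j^-1)^* * b * j^-1) = v * b.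
Proof.
move=> j0; have jc : j^* != 0 by rewrite fmorph_eq0.
by rewrite fmorphV; field; rewrite j0.
Qed.

(** D picks up |det J|^2 and det K its inverse, so g is a well defined function on the
    suspension. *)
Lemma fibre_trans : fibre f tau h c y = fibre f tau h d y'.
Proof.
have j0 : \det J != 0 by rewrite -unitfE -unitmxE.
by rewrite /fibre blend_trans vol_trans !det_mulmx det_mxstar det_inv conj_cancel.
Qed.

Lemma susp_gram_trans (Q := block_mx J 0 0 1%:M : 'M[C]_(n + 1)) :
  susp_gram f tau h c y = Q *m susp_gram f tau h d y' *m mxstar Q.
Proof.
have uB := posdef_unit (blend_pd f tau h dM dy).
have -> : mxstar Q = block_mx (mxstar J) 0 0 1%:M.
  by rewrite /mxstar map_block_mx tr_block_mx !map_mx0 !trmx0 map_mx1 trmx1.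
rewrite /susp_gram fibre_trans /Q !mulmx_block !mulmx0 !mul0mx !addr0 !add0r !mul1mx !mulmx1.
rewrite !mul0mx; congr block_mx; rewrite -scalemxAr -scalemxAl; congr (_ *: _).
have uP : mxstar (invmx J) \in unitmx by rewrite unitmx_mxstar unitmx_inv.
rewrite blend_trans !invmxM ?unitmx_mul ?unitmx_inv ?uP ?uB // invmxK.
by rewrite -mxstar_inv invmxK mulmxA.
Qed.

End Transition.

Lemma diff_add_cst (K : numFieldType) (V W : normedModType K) (F : V -> W) (a : W) x v :
  differentiable F x -> 'd (fun y => F y + a) x v = 'd F x v.
Proof.
move=> dF; have := diffD dF (differentiable_cst a x).
by move=> /(congr1 (fun g : V -> W => g v)) /=; rewrite diff_cst addr0.
Qed.

Lemma diff_lsub_comp (R : realType) n (W : normedModType R[i]) (T : 'rV[R[i]]_n -> W)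
    (x v : 'rV[R[i]]_(n + 1)) : differentiable T (lsubmx x) ->
  'd (fun z : 'rV_(n + 1) => T (lsubmx z)) x v = 'd T (lsubmx x) (lsubmx v).
Proof.
move=> dT; apply: etrans (near_diff_comp (F := lsubmx) (G := T) v openT I (fun z _ => erefl)
  (lsubmx_differentiable x) dT) _.
by rewrite (diff_lin x (@lsubmx_continuous R n)).
Qed.

Section SuspensionMetric.
Variables (R : realType) (n : nat) (M : complexManifold R n).
Variables (f : automorphism M) (tau : R[i]) (tau0 : 0 < im tau).
Variables (h : hermitianMetric M).
Hypotheses (Dh : metric_divfree h) (Vh : volume_invariant h f).
Local Notation C := R[i].
Local Notation V := 'rV[C]_(n + 1).
Local Notation S := (suspension f tau0).
Implicit Types (c : chart R n M) (d e : chart R (n + 1) S).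

Definition has_base d c := atlas c /\
  exists B (hB : evenly_covered tau B), d = susp_chart f c hB.

(* The atlas forgets the chart of M from which a chart of the suspension
   comes, so one such chart is chosen. *)
Definition susp_metric_gram d (y : V) : 'M[C]_(n + 1) :=
  if pselect (exists c, has_base d c) is left p then susp_gram f tau h (sval (cid p)) y else 0.

Lemma susp_metric_gramP d : susp_atlas d -> exists2 c, has_base d c &
  susp_metric_gram d = susp_gram f tau h c.
Proof.
move=> [c [B [hB [cM dE]]]]; rewrite /susp_metric_gram; case: pselect => [p|[]].
  by exists (sval (cid p)); [exact: svalP|].
by exists c; split=> //; exists B, hB.
Qed.

(** Two lifts of a point of the suspension differ by an element a of Z^2. With a fixed, the
    transition is f^(a.1) read in [c] and [c'], together with a translation of z, so its
    differential is block diagonal. *)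
Lemma susp_transition d e x c c' : has_base d c -> has_base e c' ->
  cimg d x -> cdom e (cinv d x) -> exists a : int * int,
  [/\ trdom (aut_iter f a.1) c c' (lsubmx x),
      lsubmx (cmap e (cinv d x)) = tr (aut_iter f a.1) c c' (lsubmx x),
      lev tau (cmap e (cinv d x)) = lev tau x + a.1%:~R &
      forall v, 'd (cmap e \o cinv d) x v =
        v *m block_mx (jac (aut_iter f a.1) c c' (lsubmx x)) 0 0 1%:M].
Proof.
move=> [cM [B [hB ->]]] [c'M [B' [hB' ->]]] /= cx [r cr /esym/susp_projP[a ar]].
have lc (z : V) : cimg c (lsubmx z) -> {for z, continuous (fun z : V =>
    susp_act f tau a (cinv c (lsubmx z), rsubmx z 0 0))}.
  move=> cz; apply: (@continuous_comp _ _ _ (fun z : V => (cinv c (lsubmx z), rsubmx z 0 0)));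
    last exact: susp_act_continuous.
  have h1 : {for z, continuous (fun z : V => cinv c (lsubmx z))}.
    exact: (@continuous_comp _ _ _ lsubmx (cinv c) z (@lsubmx_continuous _ _ z) (cinv_cont cz)).
  exact: (cvg_pair h1 (@last_continuous _ _ z)).
(* On this open set the same element a carries the first lift into the domain of the second chart,
   so one formula describes the transition near [x]. *)
pose U : set V := [set z | cimg c (lsubmx z) /\
  (cdom c' `*` B') (susp_act f tau a (cinv c (lsubmx z), rsubmx z 0 0))].
have Ux : U x by split; [exact: cx.1|rewrite ar].
have oU : open U.
  rewrite openE => z [cz Uz]; rewrite /interior; apply: filterI.
    by apply: open_nbhs_nbhs; split => //; exact: (@prod_dom_open _ _ _ c).
  apply: (lc z cz); apply: open_nbhs_nbhs; split => //.
  by apply: openX; [exact: cdom_open|exact: hB'.1].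
pose T := tr (aut_iter f a.1) c c'.
pose F (z : V) : V := row_mx (T (lsubmx z)) (rsubmx z 0 0 + period tau a)%:M.
have FE z : U z -> F z = susp_cmap c' B' (susp_cinv f tau c z).
  move=> [cz Uz].
  by rewrite /susp_cinv -(susp_proj_act f tau a) /susp_cmap (susp_liftK f hB' Uz).
have xc : trdom (aut_iter f a.1) c c' (lsubmx x) by split; [exact: cx.1|exact: Ux.2.1].
have dT := tr_diff (aut_iter_holo f a.1) cM c'M xc.
have dL : differentiable (fun z : V => T (lsubmx z)) x.
  exact: (differentiable_comp (lsubmx_differentiable x) dT).
have dP : differentiable (fun z : V => rsubmx z 0 0 + period tau a) x.
  by apply: differentiableD; [exact: last_differentiable|exact: differentiable_cst].
have dF : differentiable F x by exact: row_mx_differentiable.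
exists a; rewrite -(FE x Ux); split => //.
- by rewrite row_mxKl.
- by rewrite /lev row_mxKr mxE eqxx mulr1n slopeD slope_period.
move=> v; have -> : 'd (susp_cmap c' B' \o susp_cinv f tau c) x = 'd F x :> (V -> V).
  exact: (near_diff oU Ux FE dF).
apply/rowP => j; rewrite -(coord_diff j v dF) -[v in RHS]hsubmxK mul_row_block !mulmx0 addr0 add0r mulmx1.
case: (split_ordP j) => k ->.
  rewrite row_mxEl (jacE (aut_iter f a.1) c c' (lsubmx x) (lsubmx v)) -/T.
  rewrite (_ : (fun z => F z 0 (lshift 1 k)) = (fun z => T (lsubmx z) 0 k)); last first.
    by apply/funext => z; rewrite row_mxEl.
  rewrite (coord_diff k v dL).
  exact: (congr1 (fun w : 'rV[C]_n => w 0 k) (diff_lsub_comp v dT)).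
rewrite row_mxEr [RHS]mxE !ord1.
rewrite (_ : (fun z => F z 0 (rshift n 0)) = (fun z => z 0 (rshift n 0) + period tau a)); last first.
  by apply/funext => z; rewrite row_mxEr !mxE eqxx mulr1n.
rewrite diff_add_cst; last exact: differentiable_coord.
rewrite (@coord_diff _ _ _ id (rshift n 0) x v (@linear_differentiable _ _ _ idfun x (fun y => cvg_id))).
by rewrite diff_id_eq.
Qed.

Lemma susp_metric_smooth d : susp_atlas d ->
  forall i j, smooth (cimg d) (fun x => susp_metric_gram d x i j).
Proof.
move=> /susp_metric_gramP[c [cM [B [hB ->]]] ->] i j k.
by apply: cCS (susp_gram_cC f tau h cM k i j) => x [].
Qed.

Lemma susp_metric_pd d x : susp_atlas d -> cimg d x -> posdef (susp_metric_gram d x).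
Proof.
move=> /susp_metric_gramP[c [cM [B [hB ->]]] ->] [cx _].
exact: susp_gram_pd.
Qed.

Lemma susp_metric_change d e x : susp_atlas d -> susp_atlas e -> cimg d x ->
  cdom e (cinv d x) -> forall v w,
  herm (susp_metric_gram d x) v w =
  herm (susp_metric_gram e (cmap e (cinv d x)))
    ('d (cmap e \o cinv d) x v) ('d (cmap e \o cinv d) x w).
Proof.
move=> /susp_metric_gramP[c dc ->] /susp_metric_gramP[c' ec ->] dx ex v w.
have [a [xc yE levE DE]] := susp_transition dc ec dx ex.
apply: etrans (congr1 (fun H => herm H v w) (susp_gram_trans Vh dc.1 ec.1 xc yE levE)) _.
apply: etrans (esym (herm_mulmx _ _ v w)) _.
exact: (f_equal2 (herm _) (esym (DE v)) (esym (DE w))).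
Qed.

Definition susp_metric : hermitianMetric S := @HermitianMetric R (n + 1) S susp_metric_gram
  susp_metric_smooth (fun d x dM dx => (susp_metric_pd dM dx).1)
  (fun d x v dM dx => (susp_metric_pd dM dx).2 v) susp_metric_change.

Lemma susp_metric_divfree : metric_divfree susp_metric.
Proof.
move=> d x /susp_metric_gramP[c [cM [B [hB dE]]] E] dx.
rewrite /= E; apply: susp_gram_divfree => //.
by move: dx; rewrite dE => -[].
Qed.

End SuspensionMetric.

Theorem proposition3p4 (R : realType) (n : nat) (M : complexManifold R n)
    (f : automorphism M) (tau : R[i]) (tau_gt0 : 0 < complex.Im tau)
    (hM : exists h : hermitianMetric M, balanced h /\ volume_invariant h f) :
  exists h : hermitianMetric (suspension f tau_gt0), balanced h.
Proof.
have [h [/balanced_divfree Dh Vh]] := hM.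
exists (susp_metric tau_gt0 Vh); apply/balanced_divfree.
exact: susp_metric_divfree.
Qed.
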